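(* Let $(\lambda_n)_{n\ge1}$ be a sequence in $\mathbb C\setminus\{0\}$, let $\underline a=(a_n)$, $\underline b=(b_n)$ be sequences with $0<a_n<b_n$, and let $\Delta_n=\log(b_n/a_n)$. Let $q\in(0,1)$ and $\Delta>0$. There is a constant $a_0>0$ depending only on $\Delta$ and $q$ such that the following holds. Assume: (a) for all sufficiently large $n$, $a_{n+1}\le|\lambda_{n+1}|e^{qa_n}$ and $b_{n+1}\ge|\lambda_{n+1}|e^{-qa_n}$; (b) $(a_1\cdots a_n)^{1/n}\to\infty$ as $n\to\infty$; (c) $\Delta_n>\Delta$ for all $n\in\mathbb N$; (d) $\liminf_{n\to\infty}a_n>a_0$. Then \begin{align*} 1+\inf_x\liminf_{n\to\infty}\phi_n(x)&\le \dim_H I_{\underline a}^{\underline b}(E_{\underline\lambda})\le 1+\sup_x\liminf_{n\to\infty}\phi_n(x),\\ 1+\inf_x\limsup_{n\to\infty}\psi_n(x)&\le \dim_P I_{\underline a}^{\underline b}(E_{\underline\lambda})\le 1+\sup_x\limsup_{n\to\infty}\psi_n(x), \end{align*} where the infima and suprema are over $x=(x_1,x_2,\ldots)\in[a_1,b_1]\times[a_2,b_2]\times\cdots$ and \begin{align*} \phi_n(x)&=\frac{\log\big(\min(\Delta_2,x_1)\cdots\min(\Delta_n,x_{n-1})\big)}{\log(x_1\cdots x_n)-\log\min(\Delta_{n+1},x_n)},\\ \psi_n(x)&=\frac{\log\big(\min(\Delta_2,x_1)\cdots\min(\Delta_{n+1},x_n)\big)}{\log(x_1\cdots x_n)}.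 \end{align*}
   Context: For $\lambda\in\mathbb C\setminus\{0\}$ let $E_\lambda(z)=\lambda e^z$. For $\underline\lambda=(\lambda_n)_{n\ge1}$ and sequences $\underline a,\underline b$ with $0<a_n<b_n$, \[ I_{\underline a}^{\underline b}(E_{\underline\lambda})=\{z\in\mathbb C:\ a_n\le |E_{\lambda_n}\circ\cdots\circ E_{\lambda_1}(z)|\le b_n \text{ for every sufficiently large } n\in\mathbb N\}. \] $\dim_H$ and $\dim_P$ denote Hausdorff and packing dimension. *)

(* Defs.v *)
From Stdlib Require Import Reals.
From Coquelicot Require Import Coquelicot.
Open Scope R_scope.

Definition cexp (z : C) : C :=
  (exp (fst z) * cos (snd z), exp (fst z) * sin (snd z)).

Definition Elam (lam : C) (z : C) : C := Cmult lam (cexp z).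

(* Eiter lam n z = E_{lam n} o ... o E_{lam 1} (z); lam 0 is unused. *)
Fixpoint Eiter (lam : nat -> C) (n : nat) (z : C) : C :=
  match n with
  | O => z
  | S m => Elam (lam (S m)) (Eiter lam m z)
  end.

Definition Iab (lam : nat -> C) (a b : nat -> R) (z : C) : Prop :=
  exists N : nat, forall n : nat, (N <= n)%nat ->
    a n <= Cmod (Eiter lam n z) <= b n.

(* r^s for r >= 0, s > 0, with 0^s = 0 *)
Definition rpow (r s : R) : R := if Rlt_dec 0 r then Rpower r s else 0.

Definition nnsum (u : nat -> R) : Rbar :=
  Sup_seq (fun n => Finite (sum_f_R0 u n)).

Fixpoint rbar_psum (f : nat -> Rbar) (n : nat) : Rbar :=
  match n with
  | O => f O
  | S m => Rbar_plus (rbar_psum f m) (f (S m))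
  end.
Definition rbar_sum (f : nat -> Rbar) : Rbar := Sup_seq (rbar_psum f).

Fixpoint prod1 (x : nat -> R) (n : nat) : R :=
  match n with
  | O => 1
  | S m => prod1 x m * x (S m)
  end.

Definition diam_le (U : C -> Prop) (d : R) : Prop :=
  forall z w, U z -> U w -> Cmod (Cminus z w) <= d.

(* H^s_delta(F) = inf { sum_i diam(U_i)^s : F subset U_i U_i, diam U_i <= delta }.
   A cover is given together with upper bounds r_i >= diam U_i; since the
   infimum is taken, this yields the same value. *)
Definition Hs_delta (s delta : R) (F : C -> Prop) : Rbar :=
  Rbar_glb (fun v => exists (U : nat -> C -> Prop) (r : nat -> R),
     (forall z, F z -> exists i, U i z) /\
     (forall i, 0 <= r i <= delta /\ diam_le (U i) (r i)) /\
     v = nnsum (fun i => rpow (r i) s)).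

(* H^s(F) = lim_{delta -> 0} H^s_delta(F) (nondecreasing, so a sup) *)
Definition Hs (s : R) (F : C -> Prop) : Rbar :=
  Sup_seq (fun n => Hs_delta s (/ INR (S n)) F).

Definition dimH (F : C -> Prop) : Rbar :=
  Rbar_glb (fun t => exists s : R, t = Finite s /\ 0 < s /\ Hs s F = Finite 0).

Definition cball (x : C) (r : R) (z : C) : Prop := Cmod (Cminus z x) <= r.

(* a delta-packing of F: disjoint closed balls B(x_i, r_i), x_i in F,
   0 < r_i <= delta (indices with r_i = 0 are unused) *)
Definition is_packing (delta : R) (F : C -> Prop) (x : nat -> C) (r : nat -> R) : Prop :=
  (forall i, 0 <= r i <= delta /\ (0 < r i -> F (x i))) /\
  (forall i j, i <> j -> 0 < r i -> 0 < r j ->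
     forall z, ~ (cball (x i) (r i) z /\ cball (x j) (r j) z)).

(* P^s_delta(F) = sup { sum_i |B_i|^s : delta-packings }, |B_i| = 2 r_i *)
Definition Ps_delta (s delta : R) (F : C -> Prop) : Rbar :=
  Rbar_lub (fun v => exists x r, is_packing delta F x r /\
                      v = nnsum (fun i => rpow (2 * r i) s)).

(* packing premeasure P^s_0(F) = lim_{delta -> 0} P^s_delta(F) (nonincreasing) *)
Definition Ps0 (s : R) (F : C -> Prop) : Rbar :=
  Inf_seq (fun n => Ps_delta s (/ INR (S n)) F).

Definition Ps (s : R) (F : C -> Prop) : Rbar :=
  Rbar_glb (fun v => exists Fi : nat -> C -> Prop,
     (forall z, F z -> exists i, Fi i z) /\ v = rbar_sum (fun i => Ps0 s (Fi i))).

Definition dimP (F : C -> Prop) : Rbar :=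
  Rbar_glb (fun t => exists s : R, t = Finite s /\ 0 < s /\ Ps s F = Finite 0).

Definition Delta_n (a b : nat -> R) (n : nat) : R := ln (b n / a n).

Definition phi_n (a b x : nat -> R) (n : nat) : R :=
  ln (prod1 (fun k => Rmin (Delta_n a b (S k)) (x k)) (n - 1)) /
  (ln (prod1 x n) - ln (Rmin (Delta_n a b (S n)) (x n))).

Definition psi_n (a b x : nat -> R) (n : nat) : R :=
  ln (prod1 (fun k => Rmin (Delta_n a b (S k)) (x k)) n) / ln (prod1 x n).

(* x ranges over [a_1,b_1] x [a_2,b_2] x ... (x_0 is unused) *)
Definition in_box (a b x : nat -> R) : Prop :=
  forall k : nat, (1 <= k)%nat -> a k <= x k <= b k.

(* Main.v *)
Require Import Defs.
From Stdlib Require Import Reals.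
From Stdlib Require Import Lra Lia List Classical ClassicalEpsilon FunctionalExtensionality Cantor ZArith.
From Coquelicot Require Import Coquelicot.
Import ListNotations.
Open Scope R_scope.

(* Write z_n for the n-th iterate of z, x_n = |z_n| and w_n = min(Delta_(n+1), x_n).  A point whose
   orbit stays in the annuli has z_n in the part of the annulus |z| = x_n lying in a vertical strip
   of width Delta_(n+1); up to factors C^n, which (b) makes negligible, this part consists of
   x_n w_n unit squares, and the composed map has derivative x_1 ... x_n.  The mass distributed
   uniformly over the squares thus gives a ball at scale 1/(x_1 ... x_n) the mass
   1/prod_(k <= n) (x_k w_k), with local exponent 1 + psi_n, and a ball at scale w_n/(x_1 ... x_n)
   has local exponent 1 + phi_n; these are the extremal exponents between consecutive scales.

   Upper bounds: count codes of orbits with respect to the unit grid, for coverings directly and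
   for packings after choosing for each ball the level and dyadic scale matching its radius.
   Lower bounds: build a finitely branching tree of separated boxes in the annuli.  Both rest on
   Baire category in the tree, which makes phi_n > theta uniform on a subtree (Hausdorff case)
   and makes one set of a countable cover dense in a subtree (packing case), and on bar induction,
   which replaces measures by finite sums. *)

(** * Sums over arbitrary index types *)

(** Within level $n$ the mass of a ball grows like $r^2$ until its radius reaches $w_n/(x_1\cdots
    x_n)$, where the ball fills the width of the strip, and like $r$ beyond. The exponents in
    question lie between these two slopes, so the quotient of logarithms can be extremal only at the
    breaks; this is where $0\le\theta\le1$ is used. Hypothesis (a) says that the strip of real parts
    sent into the next annulus meets $[-qa_n,qa_n]$. A vertical line in the strip therefore crosses
    the annulus of radius $x_n\ge a_n$, which provides room for a number of boxes comparable to
    $x_nw_n$; $a_0$ is chosen so that this room holds at least one. The obstacle is uniformity. A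
    bound on $\phi_n$ or $\psi_n$ holds along each sequence $x$ only from an index depending on $x$.
    The packing upper bound decomposes the set according to this index; the Hausdorff lower bound
    passes to a subtree. Moduli are known only up to bounded factors, but errors linear in $n$
    between logarithms cost an arbitrarily small $\epsilon$ in the exponent. *)

Notation decide := excluded_middle_informative.

Lemma eq_decide {T : Type} (x y : T) : {x = y} + {x <> y}.
Proof. apply decide. Qed.

Definition lsum {T : Type} (f : T -> R) (l : list T) : R :=
  fold_right (fun x s => f x + s) 0 l.

Lemma lsum_app {T} (f : T -> R) l1 l2 : lsum f (l1 ++ l2) = lsum f l1 + lsum f l2.
Proof. induction l1; simpl; lra. Qed.

Lemma lsum_le {T} (f g : T -> R) l :
  (forall x, In x l -> f x <= g x) -> lsum f l <= lsum g l.
Proof.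
  induction l as [|x l IH]; intros H; simpl; [lra|].
  assert (f x <= g x) by (apply H; now left).
  assert (lsum f l <= lsum g l) by (apply IH; intros; apply H; now right). lra.
Qed.

Lemma lsum_ext {T} (f g : T -> R) l :
  (forall x, In x l -> f x = g x) -> lsum f l = lsum g l.
Proof.
  intros H; apply Rle_antisym; apply lsum_le; intros x Hx; rewrite (H x Hx); lra.
Qed.

Lemma lsum_scal {T} (c : R) (f : T -> R) l : lsum (fun x => c * f x) l = c * lsum f l.
Proof. induction l; simpl; [ring|rewrite IHl; ring]. Qed.

Lemma lsum_plus {T} (f g : T -> R) l :
  lsum (fun x => f x + g x) l = lsum f l + lsum g l.
Proof. induction l; simpl; [ring|rewrite IHl; ring]. Qed.

Lemma lsum_const {T} (c : R) (l : list T) : lsum (fun _ => c) l = c * INR (length l).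
Proof.
  induction l as [|x l IH]; [simpl; ring|].
  change (c + lsum (fun _ => c) l = c * INR (S (length l))). rewrite IH, S_INR. ring.
Qed.

Lemma lsum_ge0 {T} (f : T -> R) l : (forall x, In x l -> 0 <= f x) -> 0 <= lsum f l.
Proof.
  intros H. replace 0 with (lsum (fun _ : T => 0) l) by (rewrite lsum_const; ring).
  apply lsum_le; auto.
Qed.

Lemma lsum_map {T T'} (f : T' -> R) (h : T -> T') l :
  lsum f (map h l) = lsum (fun x => f (h x)) l.
Proof. induction l; simpl; [|rewrite IHl]; reflexivity. Qed.

Lemma lsum_swap {T T'} (f : T -> T' -> R) l l' :
  lsum (fun x => lsum (f x) l') l = lsum (fun y => lsum (fun x => f x y) l) l'.
Proof.
  induction l as [|x l IH]; simpl.
  - rewrite lsum_const; ring.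
  - rewrite IH, <- lsum_plus. reflexivity.
Qed.

Lemma lsum_filter {T} (f : T -> R) (p : T -> bool) l :
  lsum f l = lsum f (filter p l) + lsum f (filter (fun x => negb (p x)) l).
Proof.
  induction l as [|x l IH]; simpl; [lra|].
  destruct (p x); simpl; rewrite IH; lra.
Qed.

Lemma lsum_incl {T} (f : T -> R) l l' :
  (forall x, 0 <= f x) -> NoDup l -> incl l l' -> lsum f l <= lsum f l'.
Proof.
  intros Hf. revert l'. induction l as [|x l IH]; intros l' Hn Hi; simpl.
  - apply lsum_ge0; auto.
  - inversion Hn as [|? ? Hx Hl]; subst.
    destruct (in_split x l') as [l1 [l2 ->]]; [apply Hi; now left|].
    rewrite lsum_app; simpl.
    assert (lsum f l <= lsum f (l1 ++ l2)).
    { apply IH; auto. intros y Hy.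
      assert (In y (l1 ++ x :: l2)) as Hin by (apply Hi; now right).
      apply in_app_iff in Hin. apply in_app_iff.
      destruct Hin as [|[->|]]; tauto. }
    rewrite lsum_app in H. lra.
Qed.

Lemma sum_f_R0_lsum u n : sum_f_R0 u n = lsum u (seq 0 (S n)).
Proof.
  induction n.
  - simpl; ring.
  - simpl sum_f_R0. rewrite IHn. rewrite (seq_S (S n)), lsum_app. simpl; ring.
Qed.

(* [SB f B] is the bound [sum f <= B] for a nonnegative family over an arbitrary,
   possibly infinite, index type. *)
Definition SB {T : Type} (f : T -> R) (B : R) : Prop :=
  forall l, NoDup l -> lsum f l <= B.

Lemma SB_nonneg {T} (f : T -> R) B : SB f B -> 0 <= B.
Proof. intros H. apply (H nil). constructor. Qed.

Lemma SB_le {T} (f g : T -> R) A B :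
  (forall x, f x <= g x) -> A <= B -> SB g A -> SB f B.
Proof.
  intros Hfg HAB H l Hl. pose proof (H l Hl).
  pose proof (lsum_le f g l (fun x _ => Hfg x)). lra.
Qed.

Lemma SB_scal {T} (f : T -> R) c B : 0 <= c -> SB f B -> SB (fun x => c * f x) (c * B).
Proof.
  intros Hc H l Hl. rewrite lsum_scal. apply Rmult_le_compat_l; auto.
Qed.

Lemma SB_zero {T} (f : T -> R) B : (forall x, f x = 0) -> 0 <= B -> SB f B.
Proof.
  intros H HB l _. rewrite (lsum_ext f (fun _ => 0)) by auto. rewrite lsum_const. lra.
Qed.

(** Relabelling: where [P] holds, [h] embeds the indices of [g] into those of [f]; elsewhere [g]
    contributes nothing positive. This moves sums between families indexed by [nat] and families
    indexed by codes. *)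
Lemma SB_inj {T T'} (f : T -> R) (h : T' -> T) (g : T' -> R) (P : T' -> Prop) B :
  (forall x, 0 <= f x) ->
  (forall x y, P x -> P y -> h x = h y -> x = y) ->
  (forall x, ~ P x -> g x <= 0) ->
  (forall x, P x -> g x <= f (h x)) ->
  SB f B -> SB g B.
Proof.
  intros Hf Hinj Hg0 Hgf H l Hl.
  set (p := fun x => if decide (P x) then true else false).
  assert (Hp : forall x, p x = true <-> P x).
  { intros x; unfold p; destruct (decide (P x)); split; congruence || tauto. }
  rewrite (lsum_filter g p).
  assert (lsum g (filter (fun x => negb (p x)) l) <= 0).
  { replace 0 with (lsum (fun _ : T' => 0) (filter (fun x => negb (p x)) l))
      by (rewrite lsum_const; ring).
    apply lsum_le. intros x Hx. apply filter_In in Hx. apply Hg0.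
    rewrite <- Hp. destruct (p x); simpl in Hx; [intuition congruence|congruence]. }
  assert (lsum g (filter p l) <= B); [|lra].
  apply Rle_trans with (lsum f (map h (filter p l))).
  - rewrite lsum_map. apply lsum_le. intros x Hx. apply Hgf, Hp.
    apply filter_In in Hx; tauto.
  - apply H. apply NoDup_map_NoDup_ForallPairs.
    + intros x y Hx Hy. apply filter_In in Hx, Hy. apply Hinj; apply Hp; tauto.
    + now apply NoDup_filter.
Qed.

(** Iterated summation: a finite list of pairs is sorted by first coordinate and each fibre is
    bounded separately. The countings below are chains of this step, over level, code, dyadic scale
    and grid cell. *)
Lemma SB_pair {A B : Type} (f : A * B -> R) (g : A -> R) M :
  (forall a, SB (fun b => f (a, b)) (g a)) -> SB g M -> SB f M.
Proof.
  intros Hf Hg.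
  assert (H : forall la l, NoDup l -> NoDup la ->
            (forall x, In x l -> In (fst x) la) -> lsum f l <= lsum g la).
  { induction la as [|a la IH]; intros l Hl Hla Hin.
    - destruct l as [|x l]; [simpl; lra|]. destruct (Hin x); now left.
    - set (p := fun x : A * B => if eq_decide (fst x) a then true else false).
      rewrite (lsum_filter f p). simpl. apply Rplus_le_compat.
      + assert (E : filter p l = map (fun b => (a, b)) (map snd (filter p l))).
        { rewrite map_map. rewrite <- (map_id (filter p l)) at 1. apply map_ext_in.
          intros [a' b] Hx. apply filter_In in Hx. unfold p in Hx. simpl in *.
          destruct (eq_decide a' a); [subst; auto|intuition congruence]. }
        rewrite E, lsum_map. apply Hf.
        apply (NoDup_filter p) in Hl. rewrite E in Hl.
        now apply NoDup_map_inv in Hl.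
      + inversion Hla; subst. apply IH; auto.
        * now apply NoDup_filter.
        * intros x Hx. apply filter_In in Hx. destruct Hx as [Hx Hp].
          specialize (Hin x Hx). unfold p in Hp.
          destruct (eq_decide (fst x) a); [discriminate|].
          destruct Hin; [congruence|auto]. }
  intros l Hl. apply Rle_trans with (lsum g (nodup eq_decide (map fst l))).
  - apply H; auto.
    + apply NoDup_nodup.
    + intros x Hx. apply nodup_In. now apply in_map.
  - apply Hg, NoDup_nodup.
Qed.

Lemma lsum_geom rho n : 0 <= rho < 1 -> lsum (fun i => rho ^ i) (seq 0 n) <= / (1 - rho).
Proof.
  intros Hr.
  assert (E : (1 - rho) * lsum (fun i => rho ^ i) (seq 0 n) = 1 - rho ^ n).
  { induction n; [simpl; ring|]. rewrite seq_S, lsum_app, Rmult_plus_distr_l, IHn.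
    simpl; ring. }
  apply Rmult_le_reg_l with (1 - rho); [lra|]. rewrite E, Rinv_r by lra.
  assert (0 <= rho ^ n) by (apply pow_le; lra). lra.
Qed.

Lemma SB_geom (f : nat -> R) c rho :
  0 <= c -> 0 <= rho < 1 -> (forall n, f n <= c * rho ^ n) -> SB f (c * / (1 - rho)).
Proof.
  intros Hc Hr Hf. apply SB_le with (fun n => c * rho ^ n) (c * / (1 - rho)); auto; [lra|].
  apply SB_scal; auto. intros l Hl.
  assert (Hmax : exists n, forall x, In x l -> (x < n)%nat).
  { exists (S (list_max l)). intros x Hx.
    pose proof (proj1 (list_max_le l (list_max l)) (Nat.le_refl _)) as Hm.
    rewrite Forall_forall in Hm. specialize (Hm x Hx). lia. }
  destruct Hmax as [n Hn].
  apply Rle_trans with (lsum (fun i => rho ^ i) (seq 0 n)).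
  - apply lsum_incl; auto.
    + intros; apply pow_le; lra.
    + intros x Hx. apply in_seq. specialize (Hn x Hx). lia.
  - now apply lsum_geom.
Qed.

Lemma SB_nat_pair {B : Type} (f : nat * B -> R) e :
  0 < e -> (forall n, SB (fun b => f (n, b)) (e / 2 * (/ 2) ^ n)) -> SB f e.
Proof.
  intros He H. apply SB_pair with (fun n => e / 2 * (/ 2) ^ n); auto.
  apply SB_le with (fun n => e / 2 * (/ 2) ^ n) (e / 2 * / (1 - / 2)).
  - intros; lra.
  - right; field.
  - apply SB_geom; intros; lra.
Qed.

Lemma SB_Z_interval (P : Z -> Prop) (f : Z -> R) c v :
  0 <= v -> 0 <= c ->
  (forall m m', P m -> P m' -> IZR m - IZR m' <= c) ->
  (forall m, P m -> f m <= v) -> (forall m, ~ P m -> f m <= 0) ->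
  SB f (v * (2 * c + 1)).
Proof.
  intros Hv Hc HP Hf Hf0.
  destruct (decide (exists m0, P m0)) as [[m0 H0]|Hno].
  - set (n := Z.to_nat (up c - 1)).
    assert (Hup : IZR (up c) > c /\ IZR (up c) - c <= 1) by apply archimed.
    assert (Hupc : (1 <= up c)%Z).
    { assert (0 < up c)%Z by (apply lt_IZR; lra). lia. }
    (* All points of [P] lie within [c] of one of them, [m0], so a window of [2 * n + 1] integers
       centred there suffices, [n] being [c] rounded down. *)
    set (L := map (fun i => (m0 - Z.of_nat n + Z.of_nat i)%Z) (seq 0 (2 * n + 1))).
    intros l Hl.
    apply Rle_trans with (lsum (fun m => if decide (P m) then v else 0) l).
    { apply lsum_le. intros m _. destruct decide; auto. }
    set (p := fun m => if decide (P m) then true else false).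
    rewrite (lsum_filter _ p).
    rewrite (lsum_ext _ (fun _ => v) (filter p l)).
    2:{ intros m Hm. apply filter_In in Hm. unfold p in Hm.
        destruct decide; [auto|intuition congruence]. }
    rewrite (lsum_ext _ (fun _ => 0) (filter (fun x => negb (p x)) l)).
    2:{ intros m Hm. apply filter_In in Hm. unfold p in Hm.
        destruct decide; simpl in *; [intuition congruence|auto]. }
    rewrite !lsum_const, Rmult_0_l, Rplus_0_r. apply Rmult_le_compat_l; auto.
    assert (Hlen : (length (filter p l) <= length L)%nat).
    { apply NoDup_incl_length; [now apply NoDup_filter|].
      intros m Hm. apply filter_In in Hm. destruct Hm as [_ Hm]. unfold p in Hm.
      destruct (decide (P m)) as [Pm|]; [|discriminate].
      pose proof (HP m m0 Pm H0) as H1. pose proof (HP m0 m H0 Pm) as H2.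
      rewrite <- minus_IZR in H1, H2.
      assert (m - m0 < up c)%Z by (apply lt_IZR; lra).
      assert (m0 - m < up c)%Z by (apply lt_IZR; lra).
      unfold L. apply in_map_iff. exists (Z.to_nat (m - m0 + Z.of_nat n)).
      unfold n. split; [lia|]. apply in_seq. lia. }
    unfold L in Hlen. rewrite length_map, length_seq in Hlen. apply le_INR in Hlen.
    rewrite plus_INR, mult_INR in Hlen. simpl in Hlen.
    assert (INR n <= c).
    { unfold n. rewrite INR_IZR_INZ, Z2Nat.id by lia. rewrite minus_IZR. lra. }
    lra.
  - apply SB_le with (fun _ : Z => 0) 0; [|nra|now apply SB_zero; [|lra]].
    intros m. apply Hf0. intros Hm. apply Hno. now exists m.
Qed.

(** * Covers, packings and null sets in terms of [SB] *)

Lemma nnsum_le_iff u B : Rbar_le (nnsum u) (Finite B) <-> (forall n, sum_f_R0 u n <= B).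
Proof.
  unfold nnsum. split.
  - intros H n. change (Rbar_le (Finite (sum_f_R0 u n)) (Finite B)).
    eapply Rbar_le_trans; [|apply H].
    apply (Sup_seq_minor_le (fun n => Finite (sum_f_R0 u n)) _ n). simpl; lra.
  - intros H. pose proof (Sup_seq_correct (fun n => Finite (sum_f_R0 u n))) as Hs.
    destruct (Sup_seq (fun n => Finite (sum_f_R0 u n))) as [s| |]; simpl in *; auto.
    + apply le_epsilon. intros e He. destruct (Hs (mkposreal e He)) as [_ [n Hn]].
      simpl in Hn. specialize (H n). lra.
    + destruct (Hs B) as [n Hn]. specialize (H n). lra.
Qed.

Lemma nnsum_SB u B : SB u B -> Rbar_le (nnsum u) (Finite B).
Proof.
  intros H. apply nnsum_le_iff. intros n. rewrite sum_f_R0_lsum. apply H, seq_NoDup.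
Qed.

Lemma SB_nnsum u B : (forall i, 0 <= u i) -> Rbar_le (nnsum u) (Finite B) -> SB u B.
Proof.
  intros Hu H l Hl. rewrite nnsum_le_iff in H.
  apply Rle_trans with (sum_f_R0 u (list_max l)); auto.
  rewrite sum_f_R0_lsum. apply lsum_incl; auto. intros x Hx. apply in_seq.
  pose proof (proj1 (list_max_le l (list_max l)) (Nat.le_refl _)) as Hm.
  rewrite Forall_forall in Hm. specialize (Hm x Hx). lia.
Qed.

Lemma nnsum_nonneg u : (forall i, 0 <= u i) -> Rbar_le (Finite 0) (nnsum u).
Proof.
  intros H. apply (Sup_seq_minor_le (fun n => Finite (sum_f_R0 u n)) 0 0). simpl. apply H.
Qed.

Lemma rpow_nonneg r s : 0 <= rpow r s.
Proof. unfold rpow, Rpower. destruct Rlt_dec; [left; apply exp_pos|lra]. Qed.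

Lemma rpow_pos r s : 0 < r -> rpow r s = exp (s * ln r).
Proof. intros H. unfold rpow, Rpower. destruct Rlt_dec; [reflexivity|lra]. Qed.

Lemma rpow_0 s : rpow 0 s = 0.
Proof. unfold rpow. destruct Rlt_dec; [lra|reflexivity]. Qed.

Lemma Rbar_glb_lb (E : Rbar -> Prop) v : E v -> Rbar_le (Rbar_glb E) v.
Proof. apply (proj2_sig (Rbar_ex_glb E)). Qed.

Lemma Rbar_glb_greatest (E : Rbar -> Prop) m :
  (forall v, E v -> Rbar_le m v) -> Rbar_le m (Rbar_glb E).
Proof. intros H. apply (proj2_sig (Rbar_ex_glb E)). exact H. Qed.

Lemma Rbar_lub_ub (E : Rbar -> Prop) v : E v -> Rbar_le v (Rbar_lub E).
Proof. apply (proj2_sig (Rbar_ex_lub E)). Qed.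

Lemma Rbar_lub_least (E : Rbar -> Prop) m :
  (forall v, E v -> Rbar_le v m) -> Rbar_le (Rbar_lub E) m.
Proof. intros H. apply (proj2_sig (Rbar_ex_lub E)). exact H. Qed.

Lemma Hs_delta_nonneg s d F : Rbar_le (Finite 0) (Hs_delta s d F).
Proof.
  apply Rbar_glb_greatest. intros v (U & r & _ & _ & ->). apply nnsum_nonneg.
  intros; apply rpow_nonneg.
Qed.

(** Lets covers be indexed by codes, that is by any type with an injection into [nat]. Naturals
    outside the image of [enc] receive the empty set with radius [0], which costs nothing since
    [rpow 0 s] is [0]. *)
Lemma Hs_delta_cover {T : Type} (enc : T -> nat) (U : T -> C -> Prop) (r : T -> R)
  (s d B : R) (F : C -> Prop) :
  (forall t t', enc t = enc t' -> t = t') -> 0 <= d ->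
  (forall z, F z -> exists t, U t z) ->
  (forall t, 0 <= r t <= d /\ diam_le (U t) (r t)) ->
  SB (fun t => rpow (r t) s) B ->
  Rbar_le (Hs_delta s d F) (Finite B).
Proof.
  intros Hinj Hd HF HU HB.
  assert (Hdec : forall i, exists o : option T,
    match o with Some t => enc t = i | None => forall t, enc t <> i end).
  { intros i. destruct (decide (exists t, enc t = i)) as [[t Ht]|Hn].
    - exists (Some t); auto.
    - exists None. intros t Ht. apply Hn; now exists t. }
  set (dec := fun i => proj1_sig (constructive_indefinite_description _ (Hdec i))).
  assert (Hd' : forall i, match dec i with Some t => enc t = i | None => forall t, enc t <> i end).
  { intros i. exact (proj2_sig (constructive_indefinite_description _ (Hdec i))). }
  set (r' := fun i => match dec i with Some t => r t | None => 0 end).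
  set (U' := fun i => match dec i with Some t => U t | None => fun _ => False end).
  eapply Rbar_le_trans.
  - apply Rbar_glb_lb. exists U', r'. split; [|split; [|reflexivity]].
    + intros z Hz. destruct (HF z Hz) as [t Ht]. exists (enc t). unfold U'.
      specialize (Hd' (enc t)). destruct (dec (enc t)) as [t'|].
      * apply Hinj in Hd'. now subst.
      * now destruct (Hd' t).
    + intros i. unfold U', r'. destruct (dec i); auto.
      split; [lra|]. intros z w [].
  - apply nnsum_SB.
    destruct (decide (exists t : T, True)) as [[t0 _]|Hn].
    + apply SB_inj with (fun t => rpow (r t) s)
        (fun i => match dec i with Some t => t | None => t0 end) (fun i => dec i <> None); auto.
      * intros; apply rpow_nonneg.
      * intros x y Hx Hy Hxy. pose proof (Hd' x). pose proof (Hd' y).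
        destruct (dec x), (dec y); congruence.
      * intros i Hi. unfold r'. destruct (dec i); [exfalso; apply Hi; discriminate|].
        rewrite rpow_0; lra.
      * intros i Hi. unfold r'. destruct (dec i); [lra|congruence].
    + apply SB_zero; [|now apply SB_nonneg in HB].
      intros i. unfold r'. destruct (dec i) as [t|]; [exfalso; eauto|apply rpow_0].
Qed.

Lemma Hs_null s F :
  (forall n e, 0 < e -> Rbar_le (Hs_delta s (/ INR (S n)) F) (Finite e)) -> Hs s F = Finite 0.
Proof.
  intros H. apply Rbar_le_antisym.
  - unfold Hs. rewrite Rbar_sup_eq_lub. apply Rbar_lub_least. intros v [n ->].
    pose proof (Hs_delta_nonneg s (/ INR (S n)) F).
    pose proof (fun e => H n e).
    destruct (Hs_delta s (/ INR (S n)) F) as [v| |]; simpl in *; auto.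
    + apply le_epsilon. intros e He. rewrite Rplus_0_l. now apply H1.
    + apply (H1 1); lra.
  - unfold Hs. eapply Rbar_le_trans; [apply (Hs_delta_nonneg s (/ INR 1) F)|].
    rewrite Rbar_sup_eq_lub. apply Rbar_lub_ub. now exists 0%nat.
Qed.

Lemma Hs_delta_le_Hs s F n : Rbar_le (Hs_delta s (/ INR (S n)) F) (Hs s F).
Proof. unfold Hs. rewrite Rbar_sup_eq_lub. apply Rbar_lub_ub. now exists n. Qed.

Lemma Hs_null_cover s F n e :
  Hs s F = Finite 0 -> 0 < e ->
  exists (U : nat -> C -> Prop) (r : nat -> R),
     (forall z, F z -> exists i, U i z) /\
     (forall i, 0 <= r i <= / INR (S n) /\ diam_le (U i) (r i)) /\
     SB (fun i => rpow (r i) s) e.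
Proof.
  intros H He. apply NNPP. intros Hno.
  assert (Rbar_le (Finite e) (Hs_delta s (/ INR (S n)) F)).
  { apply Rbar_glb_greatest. intros v (U & r & H1 & H2 & ->).
    destruct (Rbar_le_lt_dec (Finite e) (nnsum (fun i => rpow (r i) s))) as [|Hlt]; auto.
    exfalso. apply Hno. exists U, r. split; [auto|split; [auto|]].
    apply SB_nnsum; [intros; apply rpow_nonneg|now apply Rbar_lt_le]. }
  pose proof (Hs_delta_le_Hs s F n) as H1. rewrite H in H1.
  pose proof (Rbar_le_trans _ _ _ H0 H1). simpl in *. lra.
Qed.

Lemma Hs_null_union s F (Fi : nat -> C -> Prop) :
  (forall z, F z -> exists i, Fi i z) -> (forall i, Hs s (Fi i) = Finite 0) ->
  Hs s F = Finite 0.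
Proof.
  intros HF Hi. apply Hs_null. intros n e He.
  assert (Hc : forall i, exists p : (nat -> C -> Prop) * (nat -> R),
     (forall z, Fi i z -> exists j, fst p j z) /\
     (forall j, 0 <= snd p j <= / INR (S n) /\ diam_le (fst p j) (snd p j)) /\
     SB (fun j => rpow (snd p j) s) (e / 2 * (/ 2) ^ i)).
  { intros i.
    destruct (Hs_null_cover s (Fi i) n (e / 2 * (/ 2) ^ i)) as (U & r & H); auto.
    - apply Rmult_lt_0_compat; [lra|apply pow_lt; lra].
    - now exists (U, r). }
  apply choice in Hc. destruct Hc as [p Hp].
  assert (0 < / INR (S n)) by (apply Rinv_0_lt_compat, lt_0_INR; lia).
  apply (Hs_delta_cover (T := nat * nat) Cantor.to_nat
    (fun ij => fst (p (fst ij)) (snd ij)) (fun ij => snd (p (fst ij)) (snd ij))).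
  - apply Cantor.to_nat_inj.
  - lra.
  - intros z Hz. destruct (HF z Hz) as [i Hzi].
    destruct (proj1 (Hp i) z Hzi) as [j Hj]. now exists (i, j).
  - intros [i j]. apply (Hp i).
  - apply SB_nat_pair; auto. intros i. apply (Hp i).
Qed.

(** Stated for an abstract predicate [null] so as to serve both dimensions. Both are infima over
    $s>0$, hence the maximum with $0$. *)
Lemma critical_exponent_le (null : R -> Prop) t : (forall s, t < s -> 0 < s -> null s) ->
  Rbar_le (Rbar_glb (fun d => exists s : R, d = Finite s /\ 0 < s /\ null s)) (Finite (Rmax 0 t)).
Proof.
  intros H. set (d := Rbar_glb _).
  destruct (Rbar_le_lt_dec d (Finite (Rmax 0 t))) as [|Hlt]; auto. exfalso.
  assert (Hex : exists s, Rmax 0 t < s /\ Rbar_lt (Finite s) d).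
  { destruct d as [d| |]; simpl in *; try contradiction.
    - exists ((Rmax 0 t + d) / 2). split; lra.
    - exists (Rmax 0 t + 1). split; [lra|exact I]. }
  destruct Hex as (s & Hs1 & Hs2). pose proof (Rmax_l 0 t). pose proof (Rmax_r 0 t).
  assert (Rbar_le d (Finite s)).
  { apply Rbar_glb_lb. exists s. repeat split; try lra. apply H; lra. }
  eapply Rbar_lt_not_le; eauto.
Qed.

Lemma Ps_delta_nonneg s d F : 0 <= d -> Rbar_le (Finite 0) (Ps_delta s d F).
Proof.
  intros Hd. eapply Rbar_le_trans; [apply nnsum_nonneg with (u := fun _ => 0); intros; lra|].
  (* The empty packing: with all radii [0] no ball is in use. *)
  apply Rbar_lub_ub. exists (fun _ => RtoC 0), (fun _ => 0). split.
  - split; intros; lra.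
  - f_equal. unfold rpow.
    apply functional_extensionality. intros _. destruct Rlt_dec; [lra|reflexivity].
Qed.

(** * Distortion of the exponential map *)

Lemma Rabs_fst_le z : Rabs (fst z) <= Cmod z.
Proof. eapply Rle_trans; [apply Rmax_l|apply Rmax_Cmod]. Qed.

Lemma Rabs_snd_le z : Rabs (snd z) <= Cmod z.
Proof. eapply Rle_trans; [apply Rmax_r|apply Rmax_Cmod]. Qed.

Lemma Cmod_sqr z : Cmod z * Cmod z = fst z * fst z + snd z * snd z.
Proof.
  unfold Cmod. rewrite sqrt_sqrt; [ring|]. nra.
Qed.

Lemma Cmod_le_sum z : Cmod z <= Rabs (fst z) + Rabs (snd z).
Proof.
  pose proof (Rabs_pos (fst z)). pose proof (Rabs_pos (snd z)).
  apply Rsqr_incr_0_var; [|lra]. unfold Rsqr. rewrite Cmod_sqr.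
  rewrite <- (Rabs_pos_eq (fst z * fst z)) by nra.
  rewrite <- (Rabs_pos_eq (snd z * snd z)) by nra.
  rewrite !Rabs_mult. nra.
Qed.

Lemma Cmod_dist_sym z w : Cmod (Cminus z w) = Cmod (Cminus w z).
Proof. rewrite <- Cmod_opp. f_equal. ring. Qed.

Lemma Cmod_dist_triang x y z : Cmod (Cminus x z) <= Cmod (Cminus x y) + Cmod (Cminus y z).
Proof.
  replace (Cminus x z) with (Cplus (Cminus x y) (Cminus y z)) by ring. apply Cmod_triangle.
Qed.

Lemma Cmod_cexp z : Cmod (cexp z) = exp (fst z).
Proof.
  pose proof (exp_pos (fst z)). pose proof (Cmod_ge_0 (cexp z)).
  apply Rsqr_inj; [auto|lra|]. unfold Rsqr. rewrite Cmod_sqr. simpl.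
  pose proof (sin2_cos2 (snd z)) as H1. unfold Rsqr in H1.
  transitivity (exp (fst z) * exp (fst z) * (sin (snd z) * sin (snd z) + cos (snd z) * cos (snd z))).
  - ring.
  - rewrite H1. ring.
Qed.

Lemma Cmod_Elam lam z : Cmod (Elam lam z) = Cmod lam * exp (fst z).
Proof. unfold Elam. now rewrite Cmod_mult, Cmod_cexp. Qed.

Lemma Cmod_Elam_dist lam z w :
  Cmod (Cminus (Elam lam z) (Elam lam w)) = Cmod lam * Cmod (Cminus (cexp z) (cexp w)).
Proof. unfold Elam. rewrite <- Cmod_mult. f_equal. ring. Qed.

(** Law of cosines in the polar coordinates given by real and imaginary part. Radial and angular
    displacement separate, so both distortion bounds reduce to inequalities in one real variable. *)
Lemma cexp_dist_sqr z w :
  Cmod (Cminus (cexp z) (cexp w)) * Cmod (Cminus (cexp z) (cexp w)) =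
  (exp (fst z) - exp (fst w)) * (exp (fst z) - exp (fst w)) +
  2 * exp (fst z) * exp (fst w) * (1 - cos (snd z - snd w)).
Proof.
  rewrite Cmod_sqr. rewrite cos_minus. unfold cexp; simpl.
  pose proof (sin2_cos2 (snd z)) as H1. unfold Rsqr in H1.
  pose proof (sin2_cos2 (snd w)) as H2. unfold Rsqr in H2.
  set (e1 := exp (fst z)). set (e2 := exp (fst w)).
  transitivity (e1 * e1 * (sin (snd z) * sin (snd z) + cos (snd z) * cos (snd z))
   + e2 * e2 * (sin (snd w) * sin (snd w) + cos (snd w) * cos (snd w))
   - 2 * e1 * e2 * (cos (snd z) * cos (snd w) + sin (snd z) * sin (snd w))).
  - ring.
  - rewrite H1, H2. ring.
Qed.

Lemma exp_diff_upper x y M : x <= M -> y <= M -> Rabs (exp x - exp y) <= exp M * Rabs (x - y).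
Proof.
  assert (H : forall x y, x <= y -> y <= M -> Rabs (exp x - exp y) <= exp M * Rabs (x - y)).
  { clear. intros x y Hxy HyM. rewrite !Rabs_left1; [|lra|].
    - pose proof (exp_ineq1_le (x - y)). pose proof (exp_pos y).
      assert (exp x = exp y * exp (x - y)) by (rewrite <- exp_plus; f_equal; ring).
      assert (exp y <= exp M) by (destruct HyM as [HyM| ->]; [left; now apply exp_increasing|lra]).
      rewrite H1. nra.
    - assert (exp x <= exp y); [|lra]. destruct Hxy as [Hxy| ->]; [left; now apply exp_increasing|lra]. }
  intros Hx Hy. destruct (Rle_dec x y); [now apply H|].
  rewrite (Rabs_minus_sym (exp x)), (Rabs_minus_sym x). apply H; lra.
Qed.

Lemma one_minus_cos_upper t : 1 - cos t <= t * t.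
Proof.
  replace (cos t) with (cos (2 * (t / 2))) by (f_equal; field).
  rewrite cos_2a_sin.
  assert (Rabs (sin (t / 2)) <= Rabs (t / 2)).
  { assert (Hp : forall u, 0 <= u -> Rabs (sin u) <= u).
    { intros u Hu. destruct (Req_dec u 0) as [->|Hn]; [rewrite sin_0, Rabs_R0; lra|].
      destruct (Rle_dec u 1).
      - rewrite Rabs_pos_eq; [left; apply sin_lt_x; lra|].
        apply sin_ge_0; [lra|]. pose proof PI2_1. lra.
      - pose proof (SIN_bound u). apply Rabs_le. split; lra. }
    destruct (Rle_dec 0 (t / 2)).
    - rewrite (Rabs_pos_eq (t / 2)); auto.
    - rewrite <- (Rabs_Ropp (sin (t / 2))), <- sin_neg.
      rewrite (Rabs_left (t / 2)) by lra. apply Hp. lra. }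
  apply Rsqr_le_abs_1 in H. unfold Rsqr in H. nra.
Qed.

(** From $1-\cos t\ge t^2/2-t^4/24$ and $t^4\le t^2$ one gets the constant $11/24$; the rounder
    $2/5$ still suffices for the factor [2] in [Elam_expand]. *)
Lemma one_minus_cos_lower t : Rabs t <= 1 -> 2 * (t * t) / 5 <= 1 - cos t.
Proof.
  intros Ht. apply Rabs_le_between in Ht.
  pose proof PI2_1.
  destruct (cos_bound t 0) as [_ H1]; [lra|lra|].
  unfold cos_approx, cos_term in H1. simpl in H1.
  assert (t * t <= 1) by nra.
  assert (t * t * (t * t) <= t * t) by nra.
  match type of H1 with _ <= ?r =>
    replace r with (1 - t * t / 2 + t * t * (t * t) / 24) in H1 by field end.
  nra.
Qed.

(** Since $1-\cos t\le t^2$ for every $t$, the imaginary parts may be arbitrary; only a common bound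
    on the real parts enters. *)
Lemma Elam_lip lam z w M :
  fst z <= M -> fst w <= M ->
  Cmod (Cminus (Elam lam z) (Elam lam w)) <= 2 * Cmod lam * exp M * Cmod (Cminus z w).
Proof.
  intros Hz Hw. rewrite Cmod_Elam_dist.
  pose proof (Cmod_ge_0 lam) as Hl.
  assert (Cmod (Cminus (cexp z) (cexp w)) <= 2 * exp M * Cmod (Cminus z w)); [|nra].
  pose proof (exp_pos M). pose proof (Cmod_ge_0 (Cminus z w)) as HD.
  apply Rsqr_incr_0_var; [|nra]. unfold Rsqr. rewrite cexp_dist_sqr.
  pose proof (exp_diff_upper _ _ M Hz Hw) as H1.
  pose proof (one_minus_cos_upper (snd z - snd w)) as H2.
  pose proof (COS_bound (snd z - snd w)) as H2'.
  assert (He1 : exp (fst z) <= exp M) by (destruct Hz as [Hz| ->]; [left; now apply exp_increasing|lra]).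
  assert (He2 : exp (fst w) <= exp M) by (destruct Hw as [Hw| ->]; [left; now apply exp_increasing|lra]).
  pose proof (exp_pos (fst z)). pose proof (exp_pos (fst w)).
  pose proof (Cmod_sqr (Cminus z w)) as HE. simpl in HE. 
  set (D := Cmod (Cminus z w)) in *.
  assert (H5 : (exp (fst z) - exp (fst w)) * (exp (fst z) - exp (fst w)) <=
     exp M * exp M * ((fst z - fst w) * (fst z - fst w))).
  { replace (exp M * exp M * ((fst z - fst w) * (fst z - fst w)))
      with (Rsqr (exp M * (fst z - fst w))) by (unfold Rsqr; ring).
    apply Rsqr_le_abs_1. rewrite Rabs_mult, (Rabs_pos_eq (exp M)) by lra. exact H1. }
  assert (H6 : exp (fst z) * exp (fst w) <= exp M * exp M) by (apply Rmult_le_compat; lra).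
  assert (H7 : exp (fst z) * exp (fst w) * (1 - cos (snd z - snd w)) <=
     exp M * exp M * ((snd z - snd w) * (snd z - snd w))).
  { apply Rmult_le_compat; try lra. apply Rmult_le_pos; lra. }
  assert (H8 : 0 <= exp M * exp M * ((fst z - fst w) * (fst z - fst w))).
  { apply Rmult_le_pos; apply Rle_0_sqr. }
  assert (0 <= exp M * exp M * ((snd z - snd w) * (snd z - snd w)))
    by (apply Rmult_le_pos; apply Rle_0_sqr).
  replace (2 * exp M * D * (2 * exp M * D)) with (4 * (exp M * exp M) * (D * D)) by ring.
  rewrite HE. unfold Rminus in *. lra.
Qed.

(** By periodicity, expansion can hold only between nearby points; sharing a cell of the unit grid
    provides this nearness. *)
Lemma Elam_expand lam z w :
  Rabs (fst z - fst w) <= 1 -> Rabs (snd z - snd w) <= 1 ->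
  Cmod lam * exp (fst w) * Cmod (Cminus z w) <= 2 * Cmod (Cminus (Elam lam z) (Elam lam w)).
Proof.
  intros Hx Hy. rewrite Cmod_Elam_dist.
  pose proof (Cmod_ge_0 lam) as Hl.
  assert (exp (fst w) * Cmod (Cminus z w) <= 2 * Cmod (Cminus (cexp z) (cexp w))); [|nra].
  pose proof (exp_pos (fst w)) as Hw. pose proof (Cmod_ge_0 (Cminus (cexp z) (cexp w))) as HD.
  apply Rsqr_incr_0_var; [|lra]. unfold Rsqr.
  replace (2 * Cmod (Cminus (cexp z) (cexp w)) * (2 * Cmod (Cminus (cexp z) (cexp w)))) with
    (4 * (Cmod (Cminus (cexp z) (cexp w)) * Cmod (Cminus (cexp z) (cexp w)))) by ring.
  rewrite cexp_dist_sqr.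
  replace (exp (fst w) * Cmod (Cminus z w) * (exp (fst w) * Cmod (Cminus z w))) with
    (exp (fst w) * exp (fst w) * (Cmod (Cminus z w) * Cmod (Cminus z w))) by ring.
  rewrite Cmod_sqr. simpl.
  pose proof (one_minus_cos_lower _ Hy) as H1.
  replace (fst z + - fst w) with (fst z - fst w) by ring.
  replace (snd z + - snd w) with (snd z - snd w) by ring.
  set (x := fst z - fst w) in *. set (y := snd z - snd w) in *.
  replace (exp (fst z)) with (exp (fst w) * exp x)
    by (rewrite <- exp_plus; f_equal; unfold x; ring).
  apply Rabs_le_between in Hx.
  (* Together with the constant $2/5$ this gives $8e^x(1-\cos y)\ge\frac{16}{15}y^2$, which is what
     [H3] needs. *)
  assert (Hex : / 3 <= exp x).
  { pose proof (exp_ineq1_le (- x)). pose proof exp_le_3.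
    assert (exp x * exp (- x) = 1) by (rewrite <- exp_plus, <- exp_0; f_equal; ring).
    assert (exp (- x) <= 3).
    { apply Rle_trans with (exp 1); [|lra].
      destruct (Req_dec (- x) 1) as [->|]; [lra|left; apply exp_increasing; lra]. }
    pose proof (exp_pos x). nra. }
  assert (H2 : x * x <= 4 * ((exp x - 1) * (exp x - 1))).
  { pose proof (exp_ineq1_le x). pose proof (exp_ineq1_le (- x)). pose proof (exp_pos x).
    assert (exp x * exp (- x) = 1) by (rewrite <- exp_plus, <- exp_0; f_equal; ring).
    destruct (Rle_dec 0 x); [nra|].
    assert (exp x * (1 - x) <= 1) by nra.
    assert (exp x <= 1 + x / 2) by nra. nra. }
  assert (H3 : y * y <= 8 * exp x * (1 - cos y)).
  { assert (0 <= 1 - cos y) by (pose proof (COS_bound y); lra).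
    assert (/ 3 * (1 - cos y) <= exp x * (1 - cos y)) by (apply Rmult_le_compat_r; lra).
    lra. }
  set (e := exp (fst w)) in *.
  assert (0 <= e * e) by nra.
  replace (4 * ((e * exp x - e) * (e * exp x - e) + 2 * (e * exp x) * e * (1 - cos y))) with
    (e * e * (4 * ((exp x - 1) * (exp x - 1)) + 8 * exp x * (1 - cos y))) by ring.
  apply Rmult_le_compat_l; lra.
Qed.

Lemma circle_angle x y : x * x + y * y = 1 -> exists t, cos t = x /\ sin t = y.
Proof.
  intros H. assert (-1 <= x <= 1) by nra.
  assert (Hs : sqrt (1 - x²) = Rabs y).
  { replace (1 - x²) with (y²) by (unfold Rsqr; lra). apply sqrt_Rsqr_abs. }
  destruct (Rle_dec 0 y).
  - exists (acos x). split; [now apply cos_acos|]. rewrite sin_acos, Hs by auto.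
    now apply Rabs_pos_eq.
  - exists (- acos x). split; [rewrite cos_neg; now apply cos_acos|].
    rewrite sin_neg, sin_acos, Hs by auto. rewrite Rabs_left; lra.
Qed.

(** The length [7] is an integer above $2\pi$; it becomes the height of the boxes. *)
Lemma angle_in_window t v : exists t', v <= t' <= v + 7 /\ cos t' = cos t /\ sin t' = sin t.
Proof.
  pose proof PI_RGT_0. pose proof PI_4.
  assert (HP : 2 * PI < 7).
  { pose proof PI_ineq 2 as [_ Hp]. cbv [tg_alt sum_f_R0 PI_tg pow] in Hp. simpl in Hp. lra. }
  set (m := up ((v - t) / (2 * PI))).
  pose proof (archimed ((v - t) / (2 * PI))) as [H1 H2]. fold m in H1, H2.
  exists (t + IZR m * (2 * PI)).
  assert (E : (v - t) / (2 * PI) * (2 * PI) = v - t) by (field; lra).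
  split; [nra|].
  destruct (Z_le_dec 0 m) as [Hm|Hm].
  - rewrite <- (Z2Nat.id m) by auto. rewrite <- INR_IZR_INZ.
    replace (t + INR (Z.to_nat m) * (2 * PI)) with (t + 2 * INR (Z.to_nat m) * PI) by ring.
    split; [apply cos_period|apply sin_period].
  - set (k := Z.to_nat (- m)).
    assert (IZR m = - INR k) as ->.
    { unfold k. rewrite INR_IZR_INZ, Z2Nat.id by lia. rewrite opp_IZR. ring. }
    rewrite <- (cos_period (t + _) k), <- (sin_period (t + _) k).
    split; f_equal; ring.
Qed.

(** The modulus forces the real part, while the imaginary part can be placed in any window of length
    [7]. Hence a box of that height is mapped onto a full annulus. *)
Lemma Elam_preimage lam w v : lam <> RtoC 0 -> w <> RtoC 0 ->
  exists z, Elam lam z = w /\ fst z = ln (Cmod w / Cmod lam) /\ v <= snd z <= v + 7.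
Proof.
  intros Hl Hw. set (u := Cdiv w lam).
  assert (Hu : u <> RtoC 0).
  { intros Hu. apply Hw. replace w with (Cmult u lam); [rewrite Hu; ring|].
    unfold u. field. exact Hl. }
  assert (Hm : 0 < Cmod u) by (now apply Cmod_gt_0).
  destruct (circle_angle (fst u / Cmod u) (snd u / Cmod u)) as (t & Hc & Hs).
  { replace (fst u / Cmod u * (fst u / Cmod u) + snd u / Cmod u * (snd u / Cmod u))
      with ((fst u * fst u + snd u * snd u) / (Cmod u * Cmod u)) by (field; lra).
    rewrite <- Cmod_sqr. field; lra. }
  destruct (angle_in_window t v) as (t' & Ht & Hc' & Hs').
  exists (ln (Cmod u), t'). split; [|split; [|exact Ht]].
  - unfold Elam. replace (cexp (ln (Cmod u), t')) with u; [unfold u; field; exact Hl|].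
    unfold cexp; simpl. rewrite exp_ln by auto. rewrite Hc', Hs', Hc, Hs.
    destruct u as [u1 u2]; simpl in *. f_equal; field; lra.
  - simpl. f_equal. unfold u. now rewrite Cmod_div.
Qed.

(** * Grid codes of orbits *)

(* In names, X stands for the moduli [x_n], W for the widths [min(Delta_(n+1), x_n)] and L for a
   logarithm. *)
Definition Xv (lam : nat -> C) (k : nat) (u : R) : R := Cmod (lam k) * exp u.

Definition Wv (lam : nat -> C) (a b : nat -> R) (k : nat) (u : R) : R :=
  Rmin (Delta_n a b (S k)) (Xv lam k u).

(* The lists below are reversed: the head [u] of a list of length [n] is the real part of the
   [n - 1]-st iterate, up to a bounded error, and so determines the modulus at time [n]. *)
Fixpoint LX (lam : nat -> C) (l : list R) : R :=
  match l with
  | [] => 0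
  | u :: t => ln (Xv lam (S (length t)) u) + LX lam t
  end.

Fixpoint LW (lam : nat -> C) (a b : nat -> R) (l : list R) : R :=
  match l with
  | [] => 0
  | u :: t => ln (Wv lam a b (S (length t)) u) + LW lam a b t
  end.

(** Counterpart of [Wv] for a sequence of moduli instead of real parts. *)
Definition lw (a b x : nat -> R) (k : nat) : R := Rmin (Delta_n a b (S k)) (x k).

Lemma prod1_pos x n : (forall k, (1 <= k)%nat -> 0 < x k) -> 0 < prod1 x n.
Proof.
  intros H. induction n; simpl; [lra|]. apply Rmult_lt_0_compat; auto. apply H; lia.
Qed.

Lemma ln_prod1_S x n : (forall k, (1 <= k)%nat -> 0 < x k) ->
  ln (prod1 x (S n)) = ln (prod1 x n) + ln (x (S n)).
Proof. intros H. simpl. rewrite ln_mult; auto; [now apply prod1_pos|apply H; lia]. Qed.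

Lemma ln_le_compat x y : 0 < x -> x <= y -> ln x <= ln y.
Proof. intros Hx [H| ->]; [left; now apply ln_increasing|lra]. Qed.

Lemma exp_le_compat x y : x <= y -> exp x <= exp y.
Proof. intros [H| ->]; [left; now apply exp_increasing|lra]. Qed.

Lemma ln_prod1_le x y n : (forall k, (1 <= k)%nat -> 0 < x k <= y k) ->
  ln (prod1 x n) <= ln (prod1 y n).
Proof.
  intros H. induction n; [simpl; lra|].
  rewrite !ln_prod1_S by (intros k Hk; specialize (H k Hk); lra).
  assert (ln (x (S n)) <= ln (y (S n))) by (apply ln_le_compat; apply H; lia). lra.
Qed.

(* Hypothesis (b) of the theorem, in logarithmic form. *)
Definition superlinear (a : nat -> R) : Prop :=
  forall K, exists n0, forall n, (n0 <= n)%nat -> K * INR n <= ln (prod1 a n).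

Lemma superlinear_of_lim a : (forall n, (1 <= n)%nat -> 0 < a n) ->
  is_lim_seq (fun n => Rpower (prod1 a n) (/ INR n)) p_infty -> superlinear a.
Proof.
  intros Ha H K. apply is_lim_seq_spec in H. destruct (H (exp K)) as [n0 Hn0].
  exists (S n0). intros n Hn. specialize (Hn0 n ltac:(lia)).
  unfold Rpower in Hn0. apply exp_lt_inv in Hn0.
  assert (0 < INR n) by (apply lt_0_INR; lia).
  apply (Rmult_lt_compat_r (INR n)) in Hn0; auto.
  replace (/ INR n * ln (prod1 a n) * INR n) with (ln (prod1 a n)) in Hn0 by (field; lra). lra.
Qed.

(** Accumulated constants appear as $e^{Kn+B}$ and are paid for by a small power of $a_1\cdots
    a_{n-1}$, with a geometric factor left for summing over levels. The index is $n-1$ because the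
    weight of a code of length $n$ involves the moduli up to time $n-1$. *)
Lemma superlinear_decay a : superlinear a -> forall K B e eta, 0 < e -> 0 < eta ->
  exists m, forall n, (m <= n)%nat ->
    exp (K * INR n + B - e * ln (prod1 a (n - 1))) <= eta / 2 * (/ 2) ^ n.
Proof.
  intros H K B e eta He Heta.
  destruct (H ((Rabs K + ln 2 + 1) / e)) as [n0 Hn0].
  destruct (nfloor_ex (Rabs (B + Rabs K + 1 + ln 2 - ln (eta / 2)))) as [n1 Hn1]; [apply Rabs_pos|].
  exists (n0 + n1 + 2)%nat. intros n Hn.
  specialize (Hn0 (n - 1)%nat ltac:(lia)).
  apply (Rmult_le_compat_l e) in Hn0; [|lra].
  rewrite minus_INR in Hn0 by lia. simpl INR in Hn0.
  replace (e * ((Rabs K + ln 2 + 1) / e * (INR n - 1))) with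
    ((Rabs K + ln 2 + 1) * (INR n - 1)) in Hn0 by (field; lra).
  assert (Hn' : INR n1 + 1 <= INR n).
  { rewrite <- S_INR. apply le_INR. lia. }
  pose proof (Rle_abs (B + Rabs K + 1 + ln 2 - ln (eta / 2))).
  pose proof (Rle_abs K). pose proof (pos_INR n).
  assert (K * INR n <= Rabs K * INR n) by (apply Rmult_le_compat_r; lra).
  apply Rle_trans with (exp (ln (eta / 2) - INR n * ln 2)).
  - apply exp_le_compat. lra.
  - unfold Rminus. rewrite exp_plus, exp_ln by lra.
    rewrite <- Rpower_pow by lra. unfold Rpower. rewrite ln_Rinv by lra.
    right. f_equal. f_equal. ring.
Qed.

(** * Grids of arbitrary mesh and countability of codes *)

Lemma Int_part_bounds r : IZR (Int_part r) <= r < IZR (Int_part r) + 1.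
Proof. pose proof (base_Int_part r). lra. Qed.

Definition grid (rho : R) (z : C) : Z * Z := (Int_part (fst z / rho), Int_part (snd z / rho)).

Lemma Int_part_eq_close rho x y : 0 < rho -> Int_part (x / rho) = Int_part (y / rho) ->
  Rabs (x - y) < rho.
Proof.
  intros Hr H. pose proof (Int_part_bounds (x / rho)). pose proof (Int_part_bounds (y / rho)).
  rewrite H in H0. assert (Rabs (x / rho - y / rho) < 1) by (apply Rabs_lt_between; lra).
  replace (x - y) with (rho * (x / rho - y / rho)) by (field; lra).
  rewrite Rabs_mult, (Rabs_pos_eq rho) by lra. nra.
Qed.

Lemma grid_eq_close rho z y : 0 < rho -> grid rho z = grid rho y ->
  Rabs (fst z - fst y) < rho /\ Rabs (snd z - snd y) < rho.
Proof.
  intros Hr H. inversion H. split; now apply Int_part_eq_close.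
Qed.

Lemma Int_part_spread rho A x y : 0 < rho -> Rabs (x - y) <= A ->
  IZR (Int_part (x / rho)) - IZR (Int_part (y / rho)) <= A / rho + 1.
Proof.
  intros Hr H. pose proof (Int_part_bounds (x / rho)). pose proof (Int_part_bounds (y / rho)).
  pose proof (Rle_abs (x - y)).
  assert ((x - y) / rho <= A / rho) by (apply Rmult_le_compat_r; [left; now apply Rinv_0_lt_compat|lra]).
  unfold Rdiv in *. lra.
Qed.

(** Only the two widths of [P] enter, so the bound applies to the set of all $n$-th iterates with a
    given code, whatever its shape. *)
Lemma grid_count (P : C -> Prop) (f : Z * Z -> R) rho A B v :
  0 < rho -> 0 <= A -> 0 <= B -> 0 <= v ->
  (forall z y, P z -> P y -> Rabs (fst z - fst y) <= A /\ Rabs (snd z - snd y) <= B) ->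
  (forall e, (exists z, P z /\ grid rho z = e) -> f e <= v) ->
  (forall e, ~ (exists z, P z /\ grid rho z = e) -> f e <= 0) ->
  SB f (v * (2 * (B / rho + 1) + 1) * (2 * (A / rho + 1) + 1)).
Proof.
  intros Hr HA HB Hv HP Hf Hf0.
  assert (0 <= A / rho) by (apply Rmult_le_pos; auto; left; now apply Rinv_0_lt_compat).
  assert (0 <= B / rho) by (apply Rmult_le_pos; auto; left; now apply Rinv_0_lt_compat).
  set (v' := v * (2 * (B / rho + 1) + 1)).
  assert (0 <= v') by (apply Rmult_le_pos; lra).
  set (PI := fun i => exists z, P z /\ Int_part (fst z / rho) = i).
  apply SB_pair with (fun i => if decide (PI i) then v' else 0).
  - intros i. destruct decide as [Hi|Hi].
    + apply SB_Z_interval with (fun j => exists z, P z /\ Int_part (snd z / rho) = j); auto; [lra| | |].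
      * intros j j' (z & Hz & <-) (y & Hy & <-). apply Int_part_spread; auto.
        now apply HP.
      * intros j _. destruct (decide (exists z, P z /\ grid rho z = (i, j))).
        -- now apply Hf.
        -- apply Rle_trans with 0; auto.
      * intros j Hj. apply Hf0. intros (z & Hz & E). apply Hj. exists z. split; auto.
        now inversion E.
    + apply SB_le with (fun _ : Z => 0) 0; [|lra|now apply SB_zero; [|lra]].
      intros j. apply Hf0. intros (z & Hz & E). apply Hi. exists z; split; auto. now inversion E.
  - apply SB_Z_interval with PI; auto; [lra| | |].
    + intros j j' (z & Hz & <-) (y & Hy & <-). apply Int_part_spread; auto. now apply HP.
    + intros i Hi. destruct decide; [lra|contradiction].
    + intros i Hi. destruct decide; [contradiction|lra].
Qed.

Lemma countable_Z : exists e : Z -> nat, forall x y, e x = e y -> x = y.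
Proof.
  exists (fun z => Cantor.to_nat (Z.to_nat z, Z.to_nat (- z))). intros x y H.
  apply Cantor.to_nat_inj in H. inversion H. lia.
Qed.

Lemma countable_prod {A B} :
  (exists e : A -> nat, forall x y, e x = e y -> x = y) ->
  (exists e : B -> nat, forall x y, e x = e y -> x = y) ->
  exists e : A * B -> nat, forall x y, e x = e y -> x = y.
Proof.
  intros [e He] [e' He']. exists (fun p => Cantor.to_nat (e (fst p), e' (snd p))).
  intros [x1 x2] [y1 y2] H. apply Cantor.to_nat_inj in H. inversion H. f_equal; auto.
Qed.

Lemma countable_list {A} :
  (exists e : A -> nat, forall x y, e x = e y -> x = y) ->
  exists e : list A -> nat, forall x y, e x = e y -> x = y.
Proof.
  intros [e He].
  exists (fold_right (fun x s => S (Cantor.to_nat (e x, s))) O).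
  induction x as [|x l IH]; intros [|y l'] H; try reflexivity; try discriminate.
  cbn [fold_right] in H. apply eq_add_S in H. apply Cantor.to_nat_inj in H. inversion H. f_equal; auto.
Qed.

Lemma countable_nat : exists e : nat -> nat, forall x y, e x = e y -> x = y.
Proof. exists (fun x => x). auto. Qed.

(** The mesh [1] is the closeness required by [Elam_expand]. A code of length [n] records the
    iterates [0] to [n - 1], so its head fixes the modulus at time [n] up to a factor $e$. *)
Fixpoint rcode (lam : nat -> C) (z : C) (n : nat) : list (Z * Z) :=
  match n with
  | O => []
  | S m => grid 1 (Eiter lam m z) :: rcode lam z m
  end.

Definition re_parts (l : list (Z * Z)) : list R := map (fun c => IZR (fst c)) l.

Lemma length_rcode lam z n : length (rcode lam z n) = n.
Proof. induction n; simpl; auto. Qed.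

Lemma length_uu l : length (re_parts l) = length l.
Proof. apply length_map. Qed.

Definition hX lam (l : list R) : R := Xv lam (length l) (hd 0 l).
Definition hW lam a b (l : list R) : R := Wv lam a b (length l) (hd 0 l).

Lemma LX_tl lam l : l <> [] -> LX lam l = ln (hX lam l) + LX lam (tl l).
Proof. destruct l; [congruence|reflexivity]. Qed.

Lemma LW_tl lam a b l : l <> [] -> LW lam a b l = ln (hW lam a b l) + LW lam a b (tl l).
Proof. destruct l; [congruence|reflexivity]. Qed.

Lemma Xv_pos lam k u : lam k <> (0, 0) -> 0 < Xv lam k u.
Proof.
  intros H. apply Rmult_lt_0_compat; [|apply exp_pos]. apply Cmod_gt_0. exact H.
Qed.

(** Each common cell allows one application of [Elam_expand], at the cost of a factor [2]; the lower
    left corner of the cell underestimates the real part and hence the derivative. *)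
Lemma rcode_contraction lam z y n :
  (forall k, (1 <= k)%nat -> lam k <> (0, 0)) ->
  rcode lam z n = rcode lam y n ->
  Cmod (Cminus z y) <= exp (INR n * ln 2 - LX lam (re_parts (rcode lam z n))) *
     Cmod (Cminus (Eiter lam n z) (Eiter lam n y)).
Proof.
  intros Hl. induction n as [|n IH]; intros H.
  - simpl. replace (0 * ln 2 - 0) with 0 by ring. rewrite exp_0. lra.
  - simpl in H. injection H as H0 H1 H2. specialize (IH H2).
    eapply Rle_trans; [exact IH|].
    set (E := exp (INR n * ln 2 - LX lam (re_parts (rcode lam z n)))) in *.
    assert (HE : 0 < E) by apply exp_pos.
    assert (Hg : Rabs (fst (Eiter lam n z) - fst (Eiter lam n y)) < 1 /\
                 Rabs (snd (Eiter lam n z) - snd (Eiter lam n y)) < 1).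
    { apply grid_eq_close; [lra|]. unfold grid. now rewrite H0, H1. }
    destruct Hg as [Hg1 Hg2].
    pose proof (Elam_expand (lam (S n)) (Eiter lam n z) (Eiter lam n y)
      (Rlt_le _ _ Hg1) (Rlt_le _ _ Hg2)) as He.
    change (re_parts (rcode lam z (S n))) with
      (IZR (Int_part (fst (Eiter lam n z) / 1)) :: re_parts (rcode lam z n)).
    simpl LX. rewrite length_uu, length_rcode, S_INR.
    set (u := IZR (Int_part (fst (Eiter lam n z) / 1))) in *.
    assert (Hu : u <= fst (Eiter lam n y)).
    { unfold u. rewrite H0. pose proof (Int_part_bounds (fst (Eiter lam n y) / 1)). lra. }
    pose proof (Xv_pos lam (S n) u (Hl (S n) ltac:(lia))) as HX.
    replace ((INR n + 1) * ln 2 - (ln (Xv lam (S n) u) + LX lam (re_parts (rcode lam z n)))) with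
      ((INR n * ln 2 - LX lam (re_parts (rcode lam z n))) + ln 2 + - ln (Xv lam (S n) u)) by ring.
    rewrite !exp_plus, exp_Ropp, !exp_ln by lra. fold E.
    change (Eiter lam (S n) z) with (Elam (lam (S n)) (Eiter lam n z)).
    change (Eiter lam (S n) y) with (Elam (lam (S n)) (Eiter lam n y)).
    set (D := Cmod (Cminus (Eiter lam n z) (Eiter lam n y))) in *.
    set (D' := Cmod (Cminus (Elam (lam (S n)) (Eiter lam n z)) (Elam (lam (S n)) (Eiter lam n y)))) in *.
    assert (Xv lam (S n) u * D <= 2 * D').
    { eapply Rle_trans; [|exact He]. apply Rmult_le_compat_r; [apply Cmod_ge_0|].
      apply Rmult_le_compat_l; [apply Cmod_ge_0|]. now apply exp_le_compat. }
    rewrite !Rmult_assoc. apply Rmult_le_compat_l; [lra|].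
    apply Rmult_le_reg_l with (Xv lam (S n) u); auto.
    replace (Xv lam (S n) u * (2 * (/ Xv lam (S n) u * D'))) with (2 * D') by (field; lra). exact H.
Qed.

(** * Upper bounds *)

Lemma Rmin_scale_le d x y c : 0 < d -> 0 < x -> 1 <= c -> x <= y <= c * x ->
  Rmin d x <= Rmin d y <= c * Rmin d x.
Proof.
  intros Hd Hx Hc Hy. unfold Rmin. destruct (Rle_dec d x), (Rle_dec d y); nra.
Qed.

Lemma ln_3_le_2 : ln 3 <= 2.
Proof.
  rewrite <- (ln_exp 2). apply ln_le_compat; [lra|].
  pose proof (exp_ineq1_le 2). lra.
Qed.

Lemma ln_close_of_le x y : 0 < x -> x <= y <= 3 * x -> Rabs (ln y - ln x) <= 2.
Proof.
  intros Hx Hy. pose proof ln_3_le_2.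
  assert (ln x <= ln y) by (apply ln_le_compat; lra).
  assert (ln y <= ln (3 * x)) by (apply ln_le_compat; lra).
  rewrite ln_mult in H1 by lra. apply Rabs_le. lra.
Qed.

(** Fixing the initial code fixes the moduli up to time [N] within constant factors. Countably many
    pieces exhaust the set, so each can be treated alone. *)
Definition piece (lam : nat -> C) (a b : nat -> R) (N : nat) (p : list (Z * Z)) (z : C) : Prop :=
  (forall k, (N <= k)%nat -> a k <= Cmod (Eiter lam k z) <= b k) /\ rcode lam z N = p.

(** A point of [Iab] obeys the constraints only from some time on, whereas $\phi_n$ and $\psi_n$ are
    evaluated on the full product of intervals. The moduli up to [N'] are therefore replaced by the
    admissible values [a k]. *)
Definition xz (lam : nat -> C) (a : nat -> R) (N' : nat) (z : C) (k : nat) : R :=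
  if (k <=? N')%nat then a k else Cmod (Eiter lam k z).

Lemma Rmult_le_abs_r t x y B : Rabs (x - y) <= B -> t * x <= t * y + Rabs t * B.
Proof.
  intros H. replace (t * x) with (t * y + t * (x - y)) by ring.
  apply Rplus_le_compat_l. eapply Rle_trans; [apply Rle_abs|]. rewrite Rabs_mult.
  apply Rmult_le_compat_l; [apply Rabs_pos|auto].
Qed.

Lemma least_nat (P : nat -> Prop) : (exists n, P n) -> exists n, P n /\ forall k, (k < n)%nat -> ~ P k.
Proof.
  intros [n Hn]. revert Hn. induction n as [n IH] using (well_founded_induction lt_wf). intros Hn.
  destruct (classic (exists k, (k < n)%nat /\ P k)) as [(k & Hk & Pk)|H].
  - now apply (IH k).
  - exists n. split; auto. intros k Hk Pk. apply H. now exists k.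
Qed.

Lemma finite_max (f : nat -> R) m : exists M, forall n, (n <= m)%nat -> f n <= M.
Proof.
  induction m as [|m [M HM]].
  - exists (f 0%nat). intros n Hn. replace n with 0%nat by lia. lra.
  - exists (Rmax M (f (S m))). intros n Hn. destruct (Nat.eq_dec n (S m)) as [->|].
    + apply Rmax_r.
    + eapply Rle_trans; [apply HM; lia|apply Rmax_l].
Qed.

Lemma Ps0_null_of t (F : C -> Prop) :
  (forall e, 0 < e -> exists n, forall x r, is_packing (/ INR (S n)) F x r ->
     SB (fun i => rpow (2 * r i) t) e) -> Ps0 t F = Finite 0.
Proof.
  intros H. unfold Ps0. rewrite Inf_eq_glb. apply Rbar_is_glb_unique. split.
  - intros v [n ->]. apply Ps_delta_nonneg. left. apply Rinv_0_lt_compat, lt_0_INR. lia.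
  - intros v Hv. assert (Hle : forall e, 0 < e -> Rbar_le v (Finite e)).
    { intros e He. destruct (H e He) as [n Hn].
      eapply Rbar_le_trans; [apply Hv; now exists n|].
      apply Rbar_lub_least. intros w (x & r & Hp & ->). apply nnsum_SB. exact (Hn x r Hp). }
    destruct v as [v| |]; simpl in *; auto.
    + apply le_epsilon. intros e He. rewrite Rplus_0_l. auto.
    + apply (Hle 1). lra.
Qed.

(** * Weighted counting of codes inside one piece *)

Section Upper.
Variables (lam : nat -> C) (a b : nat -> R) (c0 : R) (N' : nat) (p : list (Z * Z)).
Hypothesis hlam : forall n, (1 <= n)%nat -> lam n <> (0, 0).
Hypothesis hab : forall n, (1 <= n)%nat -> 0 < a n < b n.
Hypothesis hc0 : 0 < c0.
Hypothesis hD : forall n, (1 <= n)%nat -> c0 <= Delta_n a b n.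
Hypothesis hN : forall k, (S N' <= k)%nat -> 3 <= a k.
Hypothesis hb : superlinear a.

Notation F := (piece lam a b (S N') p).
Notation X l := (hX lam (re_parts l)).
Notation W l := (hW lam a b (re_parts l)).
Notation code z n := (rcode lam z n).

(** The floor loses at most [1] in the real part, hence a factor $e\le3$ in the next modulus. *)
Lemma code_head z n : F z -> (S N' <= n)%nat ->
  X (code z n) <= Cmod (Eiter lam n z) <= 3 * X (code z n).
Proof.
  intros Hz Hn. destruct n as [|n]; [lia|].
  unfold hX. rewrite length_uu, length_rcode.
  change (hd 0 (re_parts (code z (S n)))) with (IZR (Int_part (fst (Eiter lam n z) / 1))).
  change (Eiter lam (S n) z) with (Elam (lam (S n)) (Eiter lam n z)).
  rewrite Cmod_Elam. unfold Xv. pose proof (Int_part_bounds (fst (Eiter lam n z) / 1)).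
  set (u := IZR (Int_part (fst (Eiter lam n z) / 1))) in *.
  pose proof (Cmod_ge_0 (lam (S n))).
  assert (exp u <= exp (fst (Eiter lam n z))) by (apply exp_le_compat; lra).
  assert (exp (fst (Eiter lam n z)) <= exp (u + 1)) by (apply exp_le_compat; lra).
  rewrite exp_plus in H2. pose proof exp_le_3. pose proof (exp_pos u).
  assert (exp (fst (Eiter lam n z)) <= 3 * exp u) by nra.
  split; [apply Rmult_le_compat_l; lra|].
  replace (3 * (Cmod (lam (S n)) * exp u)) with (Cmod (lam (S n)) * (3 * exp u)) by ring.
  apply Rmult_le_compat_l; lra.
Qed.

Lemma code_X_ge1 z n : F z -> (S N' <= n)%nat -> 1 <= X (code z n).
Proof.
  intros Hz Hn. pose proof (code_head z n Hz Hn). destruct Hz as [Hz _].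
  pose proof (Hz n Hn). pose proof (hN n Hn). lra.
Qed.

Lemma code_W_bounds z n : F z -> (S N' <= n)%nat ->
  Rmin c0 1 <= W (code z n) <= X (code z n).
Proof.
  intros Hz Hn. pose proof (code_X_ge1 z n Hz Hn). unfold hW, Wv. fold (X (code z n)).
  split; [|apply Rmin_r]. apply Rmin_glb.
  - eapply Rle_trans; [apply Rmin_l|apply hD; lia].
  - eapply Rle_trans; [apply Rmin_r|auto].
Qed.

Lemma code_W_pos z n : F z -> (S N' <= n)%nat -> 0 < W (code z n).
Proof.
  intros Hz Hn. destruct (code_W_bounds z n Hz Hn) as [H _].
  eapply Rlt_le_trans; [|exact H]. apply Rmin_pos; lra.
Qed.

(** The next modulus is $|\lambda_{k+1}|e^{\mathrm{Re}}$ and lies in $[a_{k+1},b_{k+1}]$. Only time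
    [k + 1] is used, so [k = N'] is allowed. *)
Lemma piece_re_spread z y k : F z -> F y -> (N' <= k)%nat ->
  Rabs (fst (Eiter lam k z) - fst (Eiter lam k y)) <= Delta_n a b (S k).
Proof.
  assert (H : forall z y, F z -> F y -> (N' <= k)%nat ->
    fst (Eiter lam k z) - fst (Eiter lam k y) <= Delta_n a b (S k)).
  { clear z y. intros z y [Hz _] [Hy _] Hk.
    specialize (Hz (S k) ltac:(lia)). specialize (Hy (S k) ltac:(lia)).
    simpl Eiter in Hz, Hy. rewrite Cmod_Elam in Hz, Hy.
    pose proof (hab (S k) ltac:(lia)).
    assert (0 < Cmod (lam (S k))) by (apply Cmod_gt_0, hlam; lia).
    unfold Delta_n. rewrite <- (ln_exp (fst _ - _)). apply ln_le_compat; [apply exp_pos|].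
    unfold Rminus. rewrite exp_plus, exp_Ropp.
    pose proof (exp_pos (fst (Eiter lam k z))). pose proof (exp_pos (fst (Eiter lam k y))).
    set (e1 := exp (fst (Eiter lam k z))) in *. set (e2 := exp (fst (Eiter lam k y))) in *.
    set (L := Cmod (lam (S k))) in *.
    replace (e1 * / e2) with ((L * e1) / (L * e2)) by (field; lra).
    unfold Rdiv. apply Rmult_le_compat; try lra.
    - left; apply Rinv_0_lt_compat, Rmult_lt_0_compat; auto.
    - apply Rinv_le_contravar; lra. }
  intros Hz Hy Hk. apply Rabs_le. pose proof (H z y Hz Hy Hk). pose proof (H y z Hy Hz Hk). lra.
Qed.

(** Equal codes bound both moduli by $3X$ and so each coordinate difference by $6X$; horizontally
    the strip width $\Delta_{n+1}$ competes, which produces [W]. *)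
Lemma code_spread z y n : F z -> F y -> (S N' <= n)%nat -> code z n = code y n ->
  Rabs (fst (Eiter lam n z) - fst (Eiter lam n y)) <= 6 * W (code z n) /\
  Rabs (snd (Eiter lam n z) - snd (Eiter lam n y)) <= 6 * X (code z n).
Proof.
  intros Hz Hy Hn E. pose proof (code_head z n Hz Hn) as H1.
  pose proof (code_head y n Hy Hn) as H2. rewrite <- E in H2.
  pose proof (code_X_ge1 z n Hz Hn).
  pose proof (Rabs_fst_le (Eiter lam n z)). pose proof (Rabs_fst_le (Eiter lam n y)).
  pose proof (Rabs_snd_le (Eiter lam n z)). pose proof (Rabs_snd_le (Eiter lam n y)).
  pose proof (piece_re_spread z y n Hz Hy ltac:(lia)) as H6.
  assert (Ht : forall u v, Rabs (u - v) <= Rabs u + Rabs v).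
  { intros u v. unfold Rminus. rewrite <- (Rabs_Ropp v). apply Rabs_triang. }
  pose proof (Ht (fst (Eiter lam n z)) (fst (Eiter lam n y))).
  pose proof (Ht (snd (Eiter lam n z)) (snd (Eiter lam n y))).
  split; [|lra].
  assert (E2 : W (code z n) = Rmin (Delta_n a b (S n)) (X (code z n))).
  { unfold hW, Wv, hX. now rewrite length_uu, length_rcode. }
  pose proof (Rabs_pos (fst (Eiter lam n z) - fst (Eiter lam n y))).
  rewrite E2. unfold Rmin. destruct Rle_dec; lra.
Qed.

(* The next iterate of a point with given code lies in a rectangle of size about [W * X]. *)
Lemma fiber_count l n rho v (f : Z * Z -> R) : 0 < rho -> 0 <= v -> (S N' <= n)%nat ->
  (exists z, F z /\ code z n = l) ->
  (forall g, (exists z, F z /\ code z n = l /\ grid rho (Eiter lam n z) = g) -> f g <= v) ->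
  (forall g, ~ (exists z, F z /\ code z n = l /\ grid rho (Eiter lam n z) = g) -> f g <= 0) ->
  SB f (v * (2 * (6 * X l / rho + 1) + 1) * (2 * (6 * W l / rho + 1) + 1)).
Proof.
  intros Hr Hv Hn (z0 & Hz0 & Hl) Hf Hf0.
  pose proof (code_X_ge1 z0 n Hz0 Hn). pose proof (code_W_pos z0 n Hz0 Hn). rewrite Hl in *.
  apply grid_count with (fun w => exists z, F z /\ code z n = l /\ w = Eiter lam n z); try lra.
  - intros w y (z & Hz & Hc & ->) (z' & Hz' & Hc' & ->).
    pose proof (code_spread z z' n Hz Hz' Hn ltac:(congruence)) as Hs. now rewrite Hc in Hs.
  - intros g (w & (z & Hz & Hc & ->) & Hg). apply Hf. now exists z.
  - intros g Hg. apply Hf0. intros (z & Hz & Hc & E). apply Hg. exists (Eiter lam n z).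
    split; [now exists z|exact E].
Qed.

Lemma xz_in_box z k : F z -> (1 <= k)%nat -> a k <= xz lam a N' z k <= b k.
Proof.
  intros [Hz _] Hk. unfold xz. destruct (Nat.leb_spec k N').
  - pose proof (hab k Hk). lra.
  - apply Hz. lia.
Qed.

Lemma lw_pos x k : (1 <= k)%nat -> a k <= x k -> 0 < lw a b x k.
Proof.
  intros Hk Hx. pose proof (hab k Hk). pose proof (hD (S k) ltac:(lia)).
  apply Rmin_pos; lra.
Qed.

Lemma xz_close z n : F z -> (S N' <= n)%nat ->
  Rabs (ln (xz lam a N' z n) - ln (X (code z n))) <= 2 /\
  Rabs (ln (lw a b (xz lam a N' z) n) - ln (W (code z n))) <= 2.
Proof.
  intros Hz Hn. pose proof (code_head z n Hz Hn) as H1. pose proof (code_X_ge1 z n Hz Hn) as H2.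
  assert (E : xz lam a N' z n = Cmod (Eiter lam n z)).
  { unfold xz. destruct (Nat.leb_spec n N'); [lia|reflexivity]. }
  assert (E2 : W (code z n) = Rmin (Delta_n a b (S n)) (X (code z n))).
  { unfold hW, Wv, hX. now rewrite length_uu, length_rcode. }
  unfold lw. rewrite E. split.
  - apply ln_close_of_le; lra.
  - apply ln_close_of_le; [now apply code_W_pos|]. rewrite E2. apply Rmin_scale_le; try lra.
    pose proof (hD (S n) ltac:(lia)). lra.
Qed.

Lemma re_parts_rcode_S z n : re_parts (code z (S n)) <> [] /\ tl (re_parts (code z (S n))) = re_parts (code z n).
Proof. split; [discriminate|reflexivity]. Qed.

(** Each time beyond [N'] adds an error of at most [2], by [xz_close]. Up to [N'] the sequence
    consists of dummies and the code is prescribed by [p], so the discrepancy there is a constant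
    common to all points. *)
Lemma code_compare : exists B, 0 <= B /\ forall z n, F z -> (N' <= n)%nat ->
  Rabs (ln (prod1 (xz lam a N' z) n) - LX lam (re_parts (code z n))) <= B + 2 * INR n /\
  Rabs (ln (prod1 (lw a b (xz lam a N' z)) n) - LW lam a b (re_parts (code z n))) <= B + 2 * INR n.
Proof.
  set (B1 := Rabs (ln (prod1 a N') - LX lam (re_parts (tl p)))).
  set (B2 := Rabs (ln (prod1 (lw a b a) N') - LW lam a b (re_parts (tl p)))).
  assert (0 <= B1) by apply Rabs_pos. assert (0 <= B2) by apply Rabs_pos.
  exists (B1 + B2). split; [lra|]. intros z n Hz.
  assert (Hx : forall k, (1 <= k)%nat -> 0 < xz lam a N' z k).
  { intros k Hk. pose proof (xz_in_box z k Hz Hk). pose proof (hab k Hk). lra. }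
  assert (Hw : forall k, (1 <= k)%nat -> 0 < lw a b (xz lam a N' z) k).
  { intros k Hk. apply lw_pos; auto. now apply xz_in_box. }
  induction n as [|n IH]; intros Hn; [replace N' with 0%nat in * by lia|].
  - simpl. rewrite !ln_1, Rminus_0_r, Rabs_R0. lra.
  - destruct (Nat.eq_dec (S n) N') as [E|E].
    + assert (Hp : tl p = code z N') by (destruct Hz as [_ <-]; reflexivity).
      rewrite E, <- Hp.
      assert (E1 : forall m, (m <= N')%nat -> prod1 (xz lam a N' z) m = prod1 a m).
      { induction m; intros Hm; simpl; auto. rewrite IHm by lia. f_equal.
        unfold xz. destruct (Nat.leb_spec (S m) N'); [auto|lia]. }
      assert (E2 : forall m, (m <= N')%nat -> prod1 (lw a b (xz lam a N' z)) m = prod1 (lw a b a) m).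
      { induction m; intros Hm; simpl; auto. rewrite IHm by lia. f_equal. unfold lw. f_equal.
        unfold xz. destruct (Nat.leb_spec (S m) N'); [auto|lia]. }
      rewrite E1, E2 by lia. fold B1 B2. pose proof (pos_INR N'). lra.
    + destruct (IH ltac:(lia)) as [I1 I2].
      destruct (xz_close z (S n) Hz ltac:(lia)) as [J1 J2].
      rewrite !ln_prod1_S by auto. rewrite LX_tl, LW_tl by apply re_parts_rcode_S.
      destruct (re_parts_rcode_S z n) as [_ ->]. rewrite S_INR.
      apply Rabs_le_between in I1, I2, J1, J2.
      split; apply Rabs_le; lra.
Qed.

Lemma LX_lower : exists B, forall z n, F z -> (N' <= n)%nat ->
  ln (prod1 a n) - 2 * INR n - B <= LX lam (re_parts (code z n)).
Proof.
  destruct code_compare as (B & HB & H). exists B. intros z n Hz Hn.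
  destruct (H z n Hz Hn) as [H1 _].
  assert (ln (prod1 a n) <= ln (prod1 (xz lam a N' z) n)).
  { apply ln_prod1_le. intros k Hk. pose proof (xz_in_box z k Hz Hk). pose proof (hab k Hk). lra. }
  apply Rabs_le_between in H1. lra.
Qed.

(** Reciprocal of $\prod_{k<n}x_kw_k$, the order of the number of codes of length $n$. The tail is
    taken because the modulus fixed by the head governs the choice of the next cell, not yet
    made. *)
Definition code_weight (n : nat) (l : list (Z * Z)) : R :=
  if decide (exists z, F z /\ code z n = l)
  then exp (- (LX lam (tl (re_parts l)) + LW lam a b (tl (re_parts l)))) else 0.

Lemma code_weight_nonneg n l : 0 <= code_weight n l.
Proof. unfold code_weight. destruct decide; [left; apply exp_pos|lra]. Qed.

(* Given the code of the first [n] iterates, there are at most about [X * W] possibilities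
   for the next cell, so the weights below are, up to a factor [K], subprobabilities. *)
Lemma code_weight_sum : exists K B, 0 <= K /\ forall n, (S N' <= n)%nat -> SB (code_weight n) (exp (K * INR n + B)).
Proof.
  set (c1 := Rmin c0 1). assert (Hc1 : 0 < c1) by (apply Rmin_pos; lra).
  (* For unit cells [fiber_count] gives the factors $12X+3$ and $12W+3$; as $X\ge1$ and $W\ge c_1$,
     these are at most $15X$ and $(12+3/c_1)W$. *)
  set (K0 := 15 * (12 + 3 / c1)).
  assert (H3c : 0 < 3 / c1) by (apply Rdiv_lt_0_compat; lra).
  assert (HK0 : 1 <= K0) by (unfold K0; lra).
  exists (ln K0), (- (LX lam (tl (re_parts p)) + LW lam a b (tl (re_parts p)))).
  assert (HlnK : 0 <= ln K0) by (rewrite <- ln_1; apply ln_le_compat; lra).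
  split; [exact HlnK|].
  intros n Hn. induction n as [|n IH]; [lia|].
  destruct (Nat.eq_dec n N') as [E|E].
  (* At length [N' + 1] the only code occurring in the piece is [p]. *)
  - subst n. intros l Hl.
    apply Rle_trans with (lsum (code_weight (S N')) [p]).
    + assert (Hz : forall l', l' <> p -> code_weight (S N') l' = 0).
      { intros l' Hl'. unfold code_weight. destruct decide as [(z & Hz & Hc)|]; auto.
        destruct Hz as [_ Hz]. congruence. }
      rewrite (lsum_filter _ (fun l' => if eq_decide l' p then true else false)).
      rewrite (lsum_ext _ (fun _ => 0) (filter (fun x => negb _) l)).
      2:{ intros x Hx. apply filter_In in Hx. apply Hz. destruct (eq_decide x p); simpl in Hx; intuition congruence. }
      rewrite lsum_const, Rmult_0_l, Rplus_0_r. apply lsum_incl.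
      * apply code_weight_nonneg.
      * now apply NoDup_filter.
      * intros x Hx. apply filter_In in Hx. destruct (eq_decide x p); [left; auto|intuition congruence].
    + simpl. rewrite Rplus_0_r. unfold code_weight. destruct decide.
      * apply exp_le_compat. pose proof (pos_INR (S N')). pose proof (Rmult_le_pos _ _ HlnK H).
        change (match N' with 0%nat => 1 | S _ => INR N' + 1 end) with (INR (S N')). lra.
      * left; apply exp_pos.
  - specialize (IH ltac:(lia)).
    set (g := fun tc : list (Z * Z) * (Z * Z) => code_weight (S n) (snd tc :: fst tc)).
    apply SB_inj with g (fun l => (tl l, hd (0, 0)%Z l)) (fun l => l <> []).
    + intros; apply code_weight_nonneg.
    + intros [|x l] [|y l'] Hx Hy; simpl; congruence.
    + intros l Hl. unfold code_weight. destruct decide as [(z & Hz & Hc)|]; [|lra].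
      exfalso. apply Hl. simpl in Hc. intros ->. discriminate.
    + intros [|x l] Hx; [congruence|]. unfold g; simpl. lra.
    + apply SB_pair with (fun t => K0 * code_weight n t).
      2:{ apply SB_le with (fun t => K0 * code_weight n t) (K0 * exp (ln K0 * INR n + - (LX lam (tl (re_parts p)) + LW lam a b (tl (re_parts p))))).
          - intros; lra.
          - rewrite S_INR. replace (ln K0 * (INR n + 1) + - (LX lam (tl (re_parts p)) + LW lam a b (tl (re_parts p))))
              with (ln K0 + (ln K0 * INR n + - (LX lam (tl (re_parts p)) + LW lam a b (tl (re_parts p))))) by ring.
            rewrite (exp_plus (ln K0)), exp_ln by lra. lra.
          - apply SB_scal; [lra|exact IH]. }
      intros t. unfold g; simpl fst; simpl snd.
      destruct (decide (exists z, F z /\ code z n = t)) as [(z0 & Hz0 & Ht)|Hno].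
      * set (v := exp (- (LX lam (re_parts t) + LW lam a b (re_parts t)))).
        pose proof (code_X_ge1 z0 n Hz0 ltac:(lia)) as HX1.
        pose proof (code_W_bounds z0 n Hz0 ltac:(lia)) as HWb.
        pose proof (code_W_pos z0 n Hz0 ltac:(lia)) as HW0. rewrite Ht in *. fold c1 in HWb.
        apply SB_le with (fun c => code_weight (S n) (c :: t))
          (v * (2 * (6 * X t / 1 + 1) + 1) * (2 * (6 * W t / 1 + 1) + 1)).
        -- intros; lra.
        -- unfold code_weight. destruct decide as [_|Hno]; [|exfalso; eauto].
           assert (Hne : re_parts t <> []).
           { rewrite <- Ht. destruct n; [lia|]. apply re_parts_rcode_S. }
           assert (Ev : exp (- (LX lam (tl (re_parts t)) + LW lam a b (tl (re_parts t)))) = v * (X t * W t)).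
           { unfold v. rewrite (LX_tl lam (re_parts t)), (LW_tl lam a b (re_parts t)) by auto.
             rewrite <- (exp_ln (X t)) at 2 by lra. rewrite <- (exp_ln (W t)) at 2 by lra.
             rewrite <- !exp_plus. f_equal. ring. }
           rewrite Ev. assert (0 < v) by apply exp_pos.
           replace (K0 * (v * (X t * W t))) with (v * (15 * X t * ((12 + 3 / c1) * W t))) by (unfold K0; ring).
           rewrite Rmult_assoc. apply Rmult_le_compat_l; [lra|].
           apply Rmult_le_compat; try lra.
           assert (3 <= 3 / c1 * W t).
           { replace 3 with (3 / c1 * c1) at 1 by (field; lra).
             apply Rmult_le_compat_l; lra. }
           lra.
        -- apply fiber_count with n; try lra; [left; apply exp_pos|lia|now exists z0| |].
           ++ intros e _. unfold code_weight. destruct decide; [right; reflexivity|left; apply exp_pos].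
           ++ intros e He. unfold code_weight. destruct decide as [(z & Hz & Hc)|]; [|lra].
              exfalso. apply He. simpl in Hc. injection Hc as H0 H1. exists z. auto.
      * apply SB_le with (fun _ : Z * Z => 0) 0.
        -- intros c. unfold code_weight. destruct decide as [(z & Hz & Hc)|]; [|lra].
           exfalso. apply Hno. exists z. simpl in Hc. injection Hc as H0 H1. auto.
        -- apply Rmult_le_pos; [lra|apply code_weight_nonneg].
        -- apply SB_zero; [auto|lra].
Qed.

(** Multiplying out the fraction needs a positive denominator, which holds for large $n$ since
    $\log(a_1\cdots a_{n-1})>0$ and $w_n\le x_n$. Passing from moduli to codes costs an error linear
    in $n$. *)
Lemma phi_lt_code tau : exists K B m, forall z n, F z -> (m <= n)%nat -> (S N' <= n)%nat ->
  phi_n a b (xz lam a N' z) n < tau ->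
  LW lam a b (tl (re_parts (code z n))) <=
  tau * (LX lam (re_parts (code z n)) - ln (W (code z n))) + K * INR n + B.
Proof.
  destruct (code_compare) as (B2 & HB2 & Hcmp).
  destruct (hb 1) as [m Hm].
  exists (2 * Rabs tau + 2), ((Rabs tau + 1) * (B2 + 2)), (m + 2)%nat.
  intros z n Hz Hmn Hn Hphi. destruct n as [|n]; [lia|].
  assert (Hbox : forall k, (1 <= k)%nat -> a k <= xz lam a N' z k <= b k).
  { intros k Hk. now apply xz_in_box. }
  assert (Hx : forall k, (1 <= k)%nat -> 0 < xz lam a N' z k).
  { intros k Hk. specialize (Hbox k Hk). pose proof (hab k Hk). lra. }
  destruct (Hcmp z (S n) Hz ltac:(lia)) as [H1 _].
  destruct (Hcmp z n Hz ltac:(lia)) as [_ H2].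
  destruct (xz_close z (S n) Hz Hn) as [_ H3].
  assert (Hl : lw a b (xz lam a N' z) (S n) <= xz lam a N' z (S n)) by apply Rmin_r.
  assert (Hl0 : 0 < lw a b (xz lam a N' z) (S n)).
  { apply lw_pos; [lia|apply Hbox; lia]. }
  apply ln_le_compat in Hl; auto.
  pose proof (ln_prod1_S _ n Hx) as E.
  assert (Hge : ln (prod1 a n) <= ln (prod1 (xz lam a N' z) n)).
  { apply ln_prod1_le. intros k Hk. pose proof (Hbox k Hk). pose proof (hab k Hk). lra. }
  specialize (Hm n ltac:(lia)).
  assert (1 <= INR n) by (apply (le_INR 1); lia).
  unfold phi_n in Hphi. replace (S n - 1)%nat with n in Hphi by lia.
  fold (lw a b (xz lam a N' z)) in Hphi.
  change (Rmin (Delta_n a b (S (S n))) (xz lam a N' z (S n))) with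
    (lw a b (xz lam a N' z) (S n)) in Hphi.
  change (fun k : nat => Rmin (Delta_n a b (S k)) (xz lam a N' z k)) with
    (lw a b (xz lam a N' z)) in Hphi.
  set (den := ln (prod1 (xz lam a N' z) (S n)) - ln (lw a b (xz lam a N' z) (S n))) in *.
  assert (Hden : 0 < den) by (unfold den; lra).
  apply (Rmult_lt_compat_r den) in Hphi; auto.
  unfold Rdiv in Hphi. rewrite Rmult_assoc, Rinv_l, Rmult_1_r in Hphi by lra.
  destruct (re_parts_rcode_S z n) as [_ ->].
  pose proof (Rmult_le_abs_r tau den (LX lam (re_parts (code z (S n))) - ln (W (code z (S n))))
    (B2 + 2 * INR (S n) + 2)) as H4.
  assert (Rabs (den - (LX lam (re_parts (code z (S n))) - ln (W (code z (S n))))) <= B2 + 2 * INR (S n) + 2).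
  { apply Rabs_le_between in H1, H3. unfold den. apply Rabs_le. lra. }
  specialize (H4 H0). apply Rabs_le_between in H2. rewrite S_INR in *. 
  pose proof (Rabs_pos tau). nra.
Qed.

(** Each point picks a level where $\phi_n$ is small, and the $n$-th iterates with a given code are
    cut into squares of side [W]. About $X/W$ squares occur, with pullbacks of diameter about
    $w_n/(x_1\cdots x_n)$. At exponent $t$ the smallness of $\phi_n$ bounds their total cost by the
    weight of the code times a summable factor. *)
Lemma piece_Hs_null t eps :
  0 < eps -> (forall z, F z -> forall m, exists n, (m <= n)%nat /\
    phi_n a b (xz lam a N' z) n < t - 1 - eps) ->
  Hs t F = Finite 0.
Proof.
  intros Heps Hphi.
  destruct (code_weight_sum) as (K & B1 & HK & HG).
  destruct (phi_lt_code (t - 1 - eps)) as (K2 & B2 & m1 & Hcode).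
  destruct (LX_lower) as (B3 & HLX).
  apply Hs_null. intros n0 e He.
  set (d := / INR (S n0)). assert (Hd : 0 < d) by (apply Rinv_0_lt_compat, lt_0_INR; lia).
  set (Kt := K2 + Rabs t * ln 2 + 2 * eps).
  set (Bt := ln 225 + Rabs t * ln 2 + B2 + eps * (Rabs B3 + 2)).
  destruct (superlinear_decay a hb (Kt + K) (Bt + B1) eps e Heps He) as [m2 Hm2].
  destruct (superlinear_decay a hb (ln 2 + 2) (ln 2 + Rabs B3) 1 d ltac:(lra) Hd) as [m3 Hm3].
  set (m := (m1 + m2 + m3 + S N')%nat).
  set (T := ((nat * list (Z * Z)) * (Z * Z))%type).
  set (Q := fun (q : T) z => F z /\ (m <= fst (fst q))%nat /\
    code z (fst (fst q)) = snd (fst q) /\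
    phi_n a b (xz lam a N' z) (fst (fst q)) < t - 1 - eps /\
    grid (W (snd (fst q))) (Eiter lam (fst (fst q)) z) = snd q).
  (* Logarithm of the diameter bound: a square of side [W] has diameter at most [2 * W], and its
     pullback gains the factor $2^n/(x_1\cdots x_n)$. *)
  set (ex := fun nl : nat * list (Z * Z) =>
    INR (fst nl) * ln 2 + ln 2 + ln (W (snd nl)) - LX lam (re_parts (snd nl))).
  (* Indices realised by no point get radius [0], so only realised codes are paid for. *)
  set (r := fun q : T => if decide (exists z, Q q z)
                         then exp (ex (fst q)) else 0).
  set (H := fun n => if (m <=? n)%nat then exp (Kt * INR n + Bt - eps * ln (prod1 a (n - 1))) else 0).
  assert (HH : forall n, 0 <= H n).
  { intros n. unfold H. destruct (m <=? n)%nat; [left; apply exp_pos|lra]. }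
  destruct (countable_prod (countable_prod countable_nat (countable_list (countable_prod countable_Z countable_Z)))
     (countable_prod countable_Z countable_Z)) as [enc Henc].
  assert (Hreal : forall z n, F z -> (m <= n)%nat ->
     LX lam (re_parts (code z n)) = ln (X (code z n)) + LX lam (tl (re_parts (code z n))) /\
     ln (W (code z n)) <= ln (X (code z n)) /\
     ln (prod1 a (n - 1)) - 2 * INR n - Rabs B3 - 2 <= LX lam (tl (re_parts (code z n))) /\
     ln (prod1 a (n - 1)) - 2 * INR n - Rabs B3 <= LX lam (tl (re_parts (code z n)))).
  { intros z n Hz Hn. destruct n as [|n]; [lia|].
    destruct (re_parts_rcode_S z n) as [Hne Htl]. split; [now apply LX_tl|].
    pose proof (code_W_bounds z (S n) Hz ltac:(lia)).
    pose proof (code_W_pos z (S n) Hz ltac:(lia)).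
    split; [apply ln_le_compat; lra|]. rewrite Htl. replace (S n - 1)%nat with n by lia.
    pose proof (HLX z n Hz ltac:(lia)). pose proof (Rle_abs B3). rewrite S_INR. lra. }
  apply (Hs_delta_cover (T := T) enc Q r); auto.
  - lra.
  - intros z Hz. destruct (Hphi z Hz m) as (n & Hn & Hph).
    exists ((n, code z n), grid (W (code z n)) (Eiter lam n z)). unfold Q; simpl. auto.
  - intros q. unfold r. destruct decide as [[z Hq]|Hno].
    + split.
      * split; [left; apply exp_pos|]. destruct q as [[n l] g].
        destruct Hq as (Hz & Hn & Hl & _). simpl in *. unfold ex; simpl.
        subst l. destruct (Hreal z n Hz Hn) as (E1 & E2 & _ & E3).
        apply Rle_trans with (exp ((ln 2 + 2) * INR n + (ln 2 + Rabs B3) - 1 * ln (prod1 a (n - 1)))).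
        -- apply exp_le_compat. lra.
        -- eapply Rle_trans; [apply Hm3; lia|].
           assert ((/ 2) ^ n <= 1) by (rewrite <- (pow1 n); apply pow_incr; lra).
           assert (0 < (/ 2) ^ n) by (apply pow_lt; lra). nra.
      * intros y w Hy Hw. destruct q as [[n l] g].
        destruct Hy as (Hy & Hn & Hl & _ & Hg). destruct Hw as (Hw & _ & Hl' & _ & Hg').
        simpl in *. subst l. 
        pose proof (rcode_contraction lam y w n hlam (eq_sym Hl')) as Hc.
        pose proof (code_W_pos y n Hy ltac:(lia)) as HW.
        destruct (grid_eq_close _ _ _ HW (eq_trans Hg (eq_sym Hg'))) as [G1 G2].
        pose proof (Cmod_le_sum (Cminus (Eiter lam n y) (Eiter lam n w))) as Hs.
        unfold ex; simpl fst; simpl snd.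
        replace (INR n * ln 2 + ln 2 + ln (W (code y n)) - LX lam (re_parts (code y n))) with
          ((INR n * ln 2 - LX lam (re_parts (code y n))) + (ln 2 + ln (W (code y n)))) by ring.
        rewrite exp_plus, (exp_plus (ln 2)), !exp_ln by lra.
        eapply Rle_trans; [exact Hc|]. apply Rmult_le_compat_l; [left; apply exp_pos|].
        simpl in Hs. unfold Rminus in *. lra.
    + split; [lra|]. intros y w Hy. exfalso. apply Hno. now exists y.
  - apply SB_pair with (fun nl => H (fst nl) * code_weight (fst nl) (snd nl)).
    + intros [n l]. simpl fst; simpl snd.
      destruct (decide (exists z, F z /\ (m <= n)%nat /\ code z n = l /\
        phi_n a b (xz lam a N' z) n < t - 1 - eps)) as [(z0 & Hz0 & Hn & Hl & Hph)|Hno].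
      * pose proof (code_X_ge1 z0 n Hz0 ltac:(lia)) as HX.
        pose proof (code_W_bounds z0 n Hz0 ltac:(lia)) as HWX.
        pose proof (code_W_pos z0 n Hz0 ltac:(lia)) as HW.
        destruct (Hreal z0 n Hz0 Hn) as (E1 & E2 & E3 & _).
        pose proof (Hcode z0 n Hz0 ltac:(lia) ltac:(lia) Hph) as HLW.
        rewrite Hl in *.
        set (v := exp (t * ex (n, l))).
        assert (Hv : 0 < v) by apply exp_pos.
        apply SB_le with (fun g => rpow (r ((n, l), g)) t)
          (v * (2 * (6 * X l / W l + 1) + 1) * (2 * (6 * W l / W l + 1) + 1)).
        -- intros; lra.
        -- assert (HXW : 1 <= X l / W l).
           { apply Rmult_le_reg_r with (W l); auto. unfold Rdiv.
             rewrite Rmult_assoc, Rinv_l by lra. lra. }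
           replace (6 * W l / W l) with 6 by (field; lra).
           replace (6 * X l / W l) with (6 * (X l / W l)) by (field; lra).
           (* On squares of side [W] the counting factors are $12X/W+3\le15X/W$ and $15$. *)
           apply Rle_trans with (225 * (X l / W l) * v); [nra|].
           unfold H. replace (m <=? n)%nat with true by (symmetry; apply Nat.leb_le; auto).
           unfold code_weight. destruct decide as [_|Hn2]; [|exfalso; eauto].
           rewrite <- exp_plus.
           replace (225 * (X l / W l) * v) with
             (exp (ln 225 + ln (X l) + - ln (W l) + t * ex (n, l))).
           2:{ rewrite !exp_plus, exp_Ropp, !exp_ln by lra. unfold v. field. lra. }
           apply exp_le_compat. unfold ex, Kt, Bt; simpl fst; simpl snd.
           rewrite E1 in *.
           pose proof (Rle_abs t) as At. pose proof (pos_INR n) as Pn.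
           assert (Hln2 : 0 < ln 2) by (rewrite <- ln_1; apply ln_increasing; lra).
           assert (P1 : t * (INR n * ln 2) <= Rabs t * (INR n * ln 2)) by (apply Rmult_le_compat_r; nra).
           assert (P2 : t * ln 2 <= Rabs t * ln 2) by (apply Rmult_le_compat_r; lra).
           assert (P3 : eps * (ln (prod1 a (n - 1)) - 2 * INR n - Rabs B3 - 2) <=
             eps * LX lam (tl (re_parts l))) by (apply Rmult_le_compat_l; lra).
           assert (P4 : eps * ln (W l) <= eps * ln (X l)) by (apply Rmult_le_compat_l; lra).
           lra.
        -- apply fiber_count with n; try lra; [lia|now exists z0| |].
           ++ intros g _. unfold r. destruct decide.
              ** simpl fst. rewrite rpow_pos, ln_exp by apply exp_pos. unfold v. lra.
              ** rewrite rpow_0. lra.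
           ++ intros g Hg. unfold r. destruct decide as [(z & Hz)|].
              ** exfalso. apply Hg. destruct Hz as (Hz & _ & Hc & _ & Hg'). exists z. auto.
              ** rewrite rpow_0. lra.
      * apply SB_le with (fun _ : Z * Z => 0) 0.
        -- intros g. unfold r. destruct decide as [(z & Hz)|].
           ++ exfalso. apply Hno. destruct Hz as (Hz & Hm & Hc & Hp & _). exists z. auto.
           ++ rewrite rpow_0. lra.
        -- apply Rmult_le_pos; [auto|apply code_weight_nonneg].
        -- apply SB_zero; [auto|lra].
    + apply SB_nat_pair; auto. intros n. unfold H. simpl fst; simpl snd. destruct (Nat.leb_spec m n).
      * eapply SB_le; [intros; apply Rle_refl| |apply SB_scal; [left; apply exp_pos|apply HG; lia]].
        rewrite <- exp_plus. eapply Rle_trans; [|apply (Hm2 n); lia].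
        apply exp_le_compat. lra.
      * apply SB_zero; [intros; ring|]. apply Rmult_le_pos; [lra|apply pow_le; lra].
Qed.

(* A packing ball of radius [r] around [z] is charged to the first level [n] at which the cell of
   [z] has size at most [r], and to the dyadic scale [rho] in the plane of the [n]-th iterate which
   corresponds to [r].  Disjoint balls get distinct codes. *)
Lemma piece_Ps0_null (S0 : C -> Prop) t eps K2 B2 m0 :
  0 < eps -> 1 < t -> t <= 2 + eps -> 0 <= K2 -> (forall z, S0 z -> F z) ->
  (forall z n, S0 z -> (m0 <= n)%nat -> (N' <= n)%nat ->
    LW lam a b (re_parts (code z n)) <= (t - 1 - eps) * LX lam (re_parts (code z n)) + K2 * INR n + B2) ->
  Ps0 t S0 = Finite 0.
Proof.
  intros Heps Ht1 Ht2 HK2 HSF Hcode.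
  destruct code_weight_sum as (K & B1 & HK & HG).
  destruct LX_lower as (B3 & HLX).
  destruct code_compare as (B4 & HB4 & Hcmp).
  (* Decay rate in the dyadic depth [j]: the terms bounded in [IA] and [IB] carry the factors
     $2^{-j(t-1)}$ and $2^{-j\epsilon}$. *)
  set (kap := Rmin (t - 1) eps). assert (Hkap : 0 < kap) by (apply Rmin_pos; lra).
  assert (Hln2 : 0 < ln 2) by (rewrite <- ln_1; apply ln_increasing; lra).
  set (q0 := exp (- (kap * ln 2))).
  assert (Hq0 : 0 < q0 < 1).
  { split; [apply exp_pos|]. unfold q0. rewrite <- exp_0. apply exp_increasing.
    assert (0 < kap * ln 2) by (apply Rmult_lt_0_compat; lra). lra. }
  apply Ps0_null_of. intros e He.
  set (Kt := t * ln 2 + K2 + 2 * eps).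
  set (Bt := ln 1458 + t * ln 4 + B2 + eps * Rabs B3).
  destruct (superlinear_decay a hb (Kt + K) (Bt + B1 - ln (1 - q0)) eps e Heps He) as [m2 Hm2].
  set (m := (S (m0 + m2 + S N'))%nat).
  (* Up to level [m] all sizes [D] in the piece are at least $e^{-M}$, uniformly by means of [b].
     Balls smaller than $e^{-M}$ are thus charged to levels beyond [m]. *)
  destruct (finite_max (fun n => ln (prod1 b n) + B4 + 2 * INR n) m) as [M HM].
  destruct (archimed_cor1 (exp (- M)) (exp_pos _)) as (n0 & Hn0 & Hn0').
  exists (n0 - 1)%nat. replace (S (n0 - 1)) with n0 by lia.
  intros x r [Hp1 Hp2].
  set (T := (((nat * list (Z * Z)) * nat) * (Z * Z))%type).
  set (rho := fun (l : list (Z * Z)) (j : nat) => X l * (/ 2) ^ (S j)).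
  set (D := fun (n : nat) (l : list (Z * Z)) => exp (INR n * ln 2 - LX lam (re_parts l))).
  set (Q := fun (q : T) z => let '(((n, l), j), g) := q in
    S0 z /\ (m <= n)%nat /\ code z n = l /\ 1 <= rho l j /\ grid (rho l j / 2) (Eiter lam n z) = g).
  (* A ball charged to this index has $r\le2D\rho$, so its diameter $2r$ is at most $4D\rho$. *)
  set (f := fun q : T => let '(((n, l), j), g) := q in
    if decide (exists z, Q q z)
    then rpow (4 * D n l * rho l j) t else 0).
  set (H := fun n => if (m <=? n)%nat then exp (Kt * INR n + Bt - eps * ln (prod1 a (n - 1))) else 0).
  assert (HH : forall n, 0 <= H n).
  { intros n. unfold H. destruct (m <=? n)%nat; [left; apply exp_pos|lra]. }
  assert (Hrholn : forall l j, 0 < X l -> ln (rho l j) = ln (X l) - INR (S j) * ln 2).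
  { intros l j HX. unfold rho. rewrite ln_mult, ln_pow, ln_Rinv; try lra.
    apply pow_lt; lra. }
  assert (Hf : SB f e).
  { apply SB_pair with (fun nlj => H (fst (fst nlj)) * code_weight (fst (fst nlj)) (snd (fst nlj)) * q0 ^ (snd nlj)).
    - intros [[n l] j]. simpl fst; simpl snd.
      destruct (decide (exists z, S0 z /\ (m <= n)%nat /\ code z n = l /\ 1 <= rho l j))
        as [(z0 & Hs0 & Hn & Hl & Hr1)|Hno].
      + pose proof (HSF z0 Hs0) as Hz0.
        pose proof (code_X_ge1 z0 n Hz0 ltac:(lia)) as HX.
        pose proof (code_W_bounds z0 n Hz0 ltac:(lia)) as HWX.
        pose proof (code_W_pos z0 n Hz0 ltac:(lia)) as HW.
        destruct n as [|n]; [lia|].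
        destruct (re_parts_rcode_S z0 n) as [Hne Htl].
        pose proof (LX_tl lam _ Hne) as E1. pose proof (LW_tl lam a b _ Hne) as E2.
        pose proof (Hcode z0 (S n) Hs0 ltac:(lia) ltac:(lia)) as C1.
        pose proof (Hcode z0 n Hs0 ltac:(lia) ltac:(lia)) as C2.
        pose proof (HLX z0 n Hz0 ltac:(lia)) as L3.
        rewrite <- Htl in C2, L3. rewrite Hl in *.
        pose proof (Hrholn l j ltac:(lra)) as Hrl.
        set (lrho := ln (rho l j)) in *.
        set (v := exp (t * (ln 4 + (INR (S n) * ln 2 - LX lam (re_parts l)) + lrho))).
        assert (Hv : 0 < v) by apply exp_pos.
        assert (Hrho : rho l j = exp lrho) by (unfold lrho; rewrite exp_ln; lra).
        assert (HrX : rho l j <= X l).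
        { unfold rho. rewrite <- (Rmult_1_r (X l)) at 2. apply Rmult_le_compat_l; [lra|].
          rewrite <- (pow1 (S j)). apply pow_incr; lra. }
        assert (Hr0 : 0 <= lrho) by (unfold lrho; rewrite <- ln_1; apply ln_le_compat; lra).
        apply SB_le with (fun g => f (((S n, l), j), g))
          (v * (2 * (6 * X l / (rho l j / 2) + 1) + 1) * (2 * (6 * W l / (rho l j / 2) + 1) + 1)).
        * intros; lra.
        * assert (HXr : 1 <= X l / rho l j).
          { apply Rmult_le_reg_r with (rho l j); [lra|]. unfold Rdiv.
            rewrite Rmult_assoc, Rinv_l by lra. lra. }
          assert (HWr : 0 <= W l / rho l j).
          { apply Rmult_le_pos; [lra|]. left; apply Rinv_0_lt_compat; lra. }
          replace (6 * W l / (rho l j / 2)) with (12 * (W l / rho l j)) by (field; lra).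
          replace (6 * X l / (rho l j / 2)) with (12 * (X l / rho l j)) by (field; lra).
          (* Mesh $\rho/2$ gives the factors $24X/\rho+3\le27X/\rho$ and
             $24W/\rho+3\le27(W/\rho+1)$. The second splits the cost according to whether $\rho$
             exceeds [W] or not. *)
          apply Rle_trans with (729 * (v * (X l / rho l j) + v * (X l / rho l j) * (W l / rho l j))).
          { set (A1 := X l / rho l j) in *. set (A2 := W l / rho l j) in *.
            replace (729 * (v * A1 + v * A1 * A2)) with (v * (27 * A1) * (27 * (A2 + 1))) by ring.
            apply Rmult_le_compat; try lra; [apply Rmult_le_pos; lra|].
            apply Rmult_le_compat_l; lra. }
          assert (EA : v * (X l / rho l j) = exp (ln (X l) + - lrho +
             t * (ln 4 + (INR (S n) * ln 2 - LX lam (re_parts l)) + lrho))).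
          { rewrite !exp_plus, exp_Ropp, exp_ln by lra. rewrite <- Hrho. unfold v. field. lra. }
          assert (EB : v * (X l / rho l j) * (W l / rho l j) = exp (ln (X l) + - lrho +
             t * (ln 4 + (INR (S n) * ln 2 - LX lam (re_parts l)) + lrho) + (ln (W l) + - lrho))).
          { rewrite exp_plus, <- EA, exp_plus, exp_Ropp, exp_ln by lra. rewrite <- Hrho. field. lra. }
          set (R0 := exp (Kt * INR (S n) + (Bt - ln 1458) - eps * ln (prod1 a n)
             - (LX lam (tl (re_parts l)) + LW lam a b (tl (re_parts l))) - kap * ln 2 * INR j)).
          assert (HRHS : H (S n) * code_weight (S n) l * q0 ^ j = 1458 * R0).
          { unfold H. replace (m <=? S n)%nat with true by (symmetry; apply Nat.leb_le; auto).
            unfold code_weight. destruct decide as [_|Hn2]; [|exfalso; eauto].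
            replace (S n - 1)%nat with n by lia.
            rewrite <- (Rpower_pow j q0) by lra. unfold Rpower, q0. rewrite ln_exp.
            rewrite <- (exp_ln 1458) at 1 by lra. unfold R0. rewrite <- !exp_plus. f_equal. ring. }
          rewrite HRHS.
          pose proof (pos_INR n) as Pn. pose proof (pos_INR j) as Pj.
          rewrite !S_INR in *.
          assert (P3 : eps * (ln (prod1 a n) - 2 * INR n - B3) <= eps * LX lam (tl (re_parts l)))
            by (apply Rmult_le_compat_l; lra).
          assert (P3' : eps * B3 <= eps * Rabs B3) by (apply Rmult_le_compat_l; [lra|apply Rle_abs]).
          assert (kap <= t - 1) by apply Rmin_l. assert (kap <= eps) by apply Rmin_r.
          assert (P5 : kap * (ln 2 * INR j) <= (t - 1) * (ln 2 * (INR j + 1))).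
          { apply Rmult_le_compat; try lra; try (apply Rmult_le_pos; lra);
            apply Rmult_le_compat_l; lra. }
          assert (P6 : kap * (ln 2 * INR j) <= eps * (ln 2 * (INR j + 1))).
          { apply Rmult_le_compat; try lra; try (apply Rmult_le_pos; lra);
            apply Rmult_le_compat_l; lra. }
          assert (IA : v * (X l / rho l j) <= R0).
          { rewrite EA. apply exp_le_compat. unfold Kt, Bt. rewrite ?S_INR, E1.
            assert (EX : ln (X l) = lrho + (INR j + 1) * ln 2) by lra.
            rewrite EX. lra. }
          assert (IB : v * (X l / rho l j) * (W l / rho l j) <= R0).
          { rewrite EB. apply exp_le_compat. unfold Kt, Bt. rewrite ?S_INR. rewrite E1, E2 in *.
            assert (EX : ln (X l) = lrho + (INR j + 1) * ln 2) by lra.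
            assert (P7 : (t - 2) * lrho <= eps * lrho) by (apply Rmult_le_compat_r; lra).
            rewrite EX in *. lra. }
          lra.
        * apply fiber_count with (S n); try lra; [lia|now exists z0| |].
          -- intros g _. unfold f. destruct decide; [|lra].
             rewrite rpow_pos.
             2:{ apply Rmult_lt_0_compat; [|lra]. apply Rmult_lt_0_compat; [lra|apply exp_pos]. }
             rewrite !ln_mult; try lra; try apply exp_pos.
             2:{ apply Rmult_lt_0_compat; [lra|apply exp_pos]. }
             unfold D. rewrite ln_exp. fold lrho. unfold v. lra.
          -- intros g Hg. unfold f. destruct decide as [(z & Hz)|]; [|lra].
             exfalso. apply Hg. destruct Hz as (Hz & _ & Hc & _ & Hg'). exists z. auto.
      + apply SB_le with (fun _ : Z * Z => 0) 0.
        * intros g. unfold f. destruct decide as [(z & Hz)|]; [|lra].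
          exfalso. apply Hno. destruct Hz as (Hz & Hm & Hc & Hp & _). exists z. auto.
        * apply Rmult_le_pos; [apply Rmult_le_pos; [auto|apply code_weight_nonneg]|apply pow_le; lra].
        * apply SB_zero; [auto|lra].
    - apply SB_pair with (fun nl => / (1 - q0) * (H (fst nl) * code_weight (fst nl) (snd nl))).
      + intros [n l]. simpl fst; simpl snd. rewrite (Rmult_comm (/ _)).
        apply (SB_geom (fun j => H n * code_weight n l * q0 ^ j)); [|lra|intros; lra].
        apply Rmult_le_pos; [auto|apply code_weight_nonneg].
      + apply SB_nat_pair; auto. intros n. unfold H. simpl fst; simpl snd. destruct (Nat.leb_spec m n).
        * eapply SB_le; [intros; apply Rle_refl| |apply SB_scal; [left; apply Rinv_0_lt_compat; lra|];
            apply SB_scal; [left; apply exp_pos|apply HG; lia]].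
          rewrite <- exp_plus. eapply Rle_trans; [|apply (Hm2 n); lia].
          rewrite <- (exp_ln (/ (1 - q0))) by (apply Rinv_0_lt_compat; lra).
          rewrite ln_Rinv by lra. rewrite <- exp_plus. apply exp_le_compat. lra.
        * apply SB_zero; [intros; ring|]. apply Rmult_le_pos; [lra|apply pow_le; lra]. }
  assert (Hch : forall i, exists q : T, 0 < r i -> Q q (x i) /\
    let '(((n, l), j), g) := q in D n l * rho l j <= r i <= 2 * (D n l * rho l j)).
  { intros i. destruct (Rlt_dec 0 (r i)) as [Hri|Hri].
    2:{ exists (((0%nat, nil), 0%nat), (0, 0)%Z). intros; lra. }
    destruct (Hp1 i) as [[_ Hrd] Hxi]. specialize (Hxi Hri).
    pose proof (HSF _ Hxi) as HFi.
    destruct (least_nat (fun n => (N' <= n)%nat /\ 2 * D n (code (x i) n) <= r i)) as (n & [Hn1 Hn2] & Hmin).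
    { destruct (superlinear_decay a hb (2 + ln 2) (Rabs B3 + ln 2) 1 (r i) ltac:(lra) Hri) as [m3 Hm3].
      exists (m3 + N')%nat. split; [lia|].
      specialize (Hm3 (S (m3 + N')) ltac:(lia)).
      replace (S (m3 + N') - 1)%nat with (m3 + N')%nat in Hm3 by lia.
      pose proof (HLX (x i) (m3 + N')%nat HFi ltac:(lia)). pose proof (Rle_abs B3).
      unfold D. rewrite <- (exp_ln 2) at 1 by lra. rewrite <- exp_plus.
      eapply Rle_trans; [|eapply Rle_trans; [exact Hm3|]].
      - apply exp_le_compat. rewrite S_INR. lra.
      - assert ((/ 2) ^ S (m3 + N') <= 1) by (rewrite <- (pow1 (S (m3 + N'))); apply pow_incr; lra). nra. }
    assert (Hnm : (m < n)%nat).
    { apply Nat.nle_gt. intros Hle. specialize (HM n Hle). simpl in HM.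
      destruct (Hcmp (x i) n HFi Hn1) as [Hc _]. apply Rabs_le_between in Hc.
      assert (ln (prod1 (xz lam a N' (x i)) n) <= ln (prod1 b n)).
      { apply ln_prod1_le. intros k Hk. pose proof (xz_in_box _ _ HFi Hk). pose proof (hab k Hk). lra. }
      assert (exp (- M) <= D n (code (x i) n)).
      { unfold D. apply exp_le_compat. pose proof (pos_INR n).
        assert (0 <= INR n * ln 2) by (apply Rmult_le_pos; lra). lra. }
      pose proof (exp_pos (- M)). lra. }
    destruct n as [|n]; [lia|].
    assert (Hr2 : r i < 2 * D n (code (x i) n)).
    { apply Rnot_le_lt. intros Hle. apply (Hmin n); [lia|]. split; [lia|exact Hle]. }
    set (l := code (x i) (S n)) in *.
    pose proof (code_X_ge1 (x i) (S n) HFi ltac:(lia)) as HX. fold l in HX.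
    (* Minimality of the level gives $r<2D_n$, which equals $D_{n+1}X$; so the scales $X2^{-j-1}$ of
       level $n+1$ suffice to reach $r$. *)
    assert (HDD : 2 * D n (code (x i) n) = D (S n) l * X l).
    { unfold D. destruct (re_parts_rcode_S (x i) n) as [Hne Htl]. fold l in Hne, Htl.
      rewrite (LX_tl lam _ Hne), Htl. rewrite <- (exp_ln 2) at 1 by lra. rewrite <- (exp_ln (X l)) at 2 by lra.
      rewrite <- !exp_plus. f_equal. rewrite S_INR. ring. }
    assert (HD : 0 < D (S n) l) by apply exp_pos.
    destruct (least_nat (fun j => D (S n) l * rho l j <= r i)) as (j & Hj & Hjmin).
    { destruct (pow_lt_1_zero (/ 2) ltac:(rewrite Rabs_pos_eq; lra) (r i / (D (S n) l * X l))) as [j Hj].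
      { apply Rdiv_lt_0_compat; [auto|]. apply Rmult_lt_0_compat; lra. }
      exists j. specialize (Hj (S j) ltac:(lia)).
      rewrite Rabs_pos_eq in Hj by (apply pow_le; lra). unfold rho.
      assert (0 < D (S n) l * X l) by (apply Rmult_lt_0_compat; lra).
      apply (Rmult_lt_compat_l (D (S n) l * X l)) in Hj; auto.
      replace (D (S n) l * X l * (r i / (D (S n) l * X l))) with (r i) in Hj by (field; lra). lra. }
    assert (Hj2 : r i <= 2 * (D (S n) l * rho l j)).
    { destruct j as [|j].
      - unfold rho. rewrite pow_1.
        replace (2 * (D (S n) l * (X l * / 2))) with (D (S n) l * X l) by field. lra.
      - assert (~ D (S n) l * rho l j <= r i) by (apply Hjmin; lia).
        replace (2 * (D (S n) l * rho l (S j))) with (D (S n) l * rho l j); [lra|].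
        unfold rho. rewrite <- (tech_pow_Rmult _ (S j)). field. }
    exists (((S n, l), j), grid (rho l j / 2) (Eiter lam (S n) (x i))). intros _.
    split; [|split; [exact Hj|exact Hj2]].
    split; [exact Hxi|]. split; [lia|]. split; [reflexivity|]. split; [|reflexivity].
    apply Rmult_le_reg_l with (2 * D (S n) l); [lra|]. lra. }
  apply choice in Hch. destruct Hch as [q Hq].
  apply SB_inj with f q (fun i => 0 < r i); auto.
  - intros [[[n l] j] g]. unfold f. destruct decide; [apply rpow_nonneg|lra].
  - intros i i' Hi Hi' E. destruct (Nat.eq_dec i i') as [|Hne]; auto. exfalso.
    destruct (Hq i Hi) as [Q1 Q2]. destruct (Hq i' Hi') as [Q3 _]. rewrite E in Q1, Q2.
    destruct (q i') as [[[n l] j] g].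
    destruct Q1 as (S1 & Hn & C1 & R1 & G1). destruct Q3 as (S3 & _ & C3 & _ & G3).
    (* Two balls with the same code would share the centre of the second: the $n$-th iterates of the
       centres differ by at most $\rho$, and $D\rho\le r$. *)
    apply (Hp2 i i' Hne Hi Hi' (x i')). unfold cball. split.
    + destruct (grid_eq_close (rho l j / 2) (Eiter lam n (x i')) (Eiter lam n (x i)) ltac:(lra) (eq_trans G3 (eq_sym G1))) as [K1 K3].
      pose proof (rcode_contraction lam (x i') (x i) n hlam (eq_trans C3 (eq_sym C1))) as Hc.
      rewrite C3 in Hc. eapply Rle_trans; [exact Hc|].
      eapply Rle_trans; [|apply Q2]. apply Rmult_le_compat_l; [left; apply exp_pos|].
      pose proof (Cmod_le_sum (Cminus (Eiter lam n (x i')) (Eiter lam n (x i)))) as Hs.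
      simpl in Hs. unfold Rminus in *. lra.
    + replace (Cminus (x i') (x i')) with (RtoC 0) by ring. rewrite Cmod_0. lra.
  - intros i Hi. replace (r i) with 0; [rewrite Rmult_0_r, rpow_0; lra|].
    destruct (Hp1 i) as [[H0 _] _]. lra.
  - intros i Hi. destruct (Hq i Hi) as [Q1 Q2]. unfold f.
    destruct (q i) as [[[n l] j] g].
    destruct decide as [_|Hno]; [|exfalso; eauto].
    assert (HD : 0 < D n l) by apply exp_pos.
    destruct Q1 as (S1 & Hn & C1 & R1 & G1).
    assert (0 < D n l * rho l j) by (apply Rmult_lt_0_compat; lra).
    rewrite !rpow_pos by lra. apply exp_le_compat. apply Rmult_le_compat_l; [lra|].
    apply ln_le_compat; lra.
Qed.

Lemma psi_le_code tau : exists K2 B2, 0 <= K2 /\ forall z n, F z -> (N' <= n)%nat ->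
  ln (prod1 (lw a b (xz lam a N' z)) n) <= tau * ln (prod1 (xz lam a N' z) n) ->
  LW lam a b (re_parts (code z n)) <= tau * LX lam (re_parts (code z n)) + K2 * INR n + B2.
Proof.
  destruct code_compare as (B & HB & Hcmp). pose proof (Rabs_pos tau).
  exists (2 * Rabs tau + 2), ((Rabs tau + 1) * B). split; [lra|]. intros z n Hz Hn Hle.
  destruct (Hcmp z n Hz Hn) as [H1 H2].
  pose proof (Rmult_le_abs_r tau _ _ _ H1). apply Rabs_le_between in H2. lra.
Qed.

End Upper.

(** * Finitely branching trees *)

(** Prefixes are reversed so that extending a node is a [cons] and its parent is [tl]. *)
Fixpoint pfx {A : Type} (c : nat -> A) (n : nat) : list A :=
  match n with O => [] | S m => c m :: pfx c m end.

Lemma length_pfx {A} (c : nat -> A) n : length (pfx c n) = n.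
Proof. induction n; simpl; auto. Qed.

Lemma code_of_nodes {A} (a0 : A) (N : nat -> list A) :
  N O = [] -> (forall j, exists x, N (S j) = x :: N j) -> exists c, forall j, pfx c j = N j.
Proof.
  intros H0 HS. exists (fun j => hd a0 (N (S j))). induction j as [|j IH]; simpl; auto.
  destruct (HS j) as [x Hx]. rewrite IH, Hx. reflexivity.
Qed.

Section Tree.
Variables (A : Type) (a0 : A) (ch : list A -> list A).

Inductive reach (t : list A) : list A -> Prop :=
| reach_refl : reach t t
| reach_step s c : reach t s -> In c (ch s) -> reach t (c :: s).

Definition is_path (t : list A) (c : nat -> A) : Prop :=
  pfx c (length t) = t /\ forall n, (length t <= n)%nat -> In (c n) (ch (pfx c n)).

Lemma reach_trans t s u : reach t s -> reach s u -> reach t u.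
Proof. intros H1 H2. induction H2; auto. now constructor. Qed.

Lemma reach_length t s : reach t s -> (length t <= length s)%nat.
Proof. induction 1; simpl; lia. Qed.

Lemma reach_same_length t s : reach t s -> length t = length s -> t = s.
Proof. destruct 1; auto. intros E. apply reach_length in H. simpl in E. lia. Qed.

Lemma reach_pfx t c n : is_path t c -> (length t <= n)%nat -> reach t (pfx c n).
Proof.
  intros [H1 H2] Hn. induction n as [|n IH].
  - destruct t; [constructor|simpl in Hn; lia].
  - destruct (Nat.eq_dec (length t) (S n)) as [<-|].
    + rewrite H1. constructor.
    + simpl. constructor; [apply IH; lia|apply H2; lia].
Qed.

Lemma reach_skipn t s k : reach t s -> (length t <= k <= length s)%nat ->
  reach t (skipn (length s - k) s) /\ reach (skipn (length s - k) s) s.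
Proof.
  induction 1 as [|s c Hs IH Hc]; intros Hk.
  - replace (length t - k)%nat with 0%nat by lia. simpl. split; constructor.
  - simpl length in *. destruct (Nat.eq_dec k (S (length s))) as [->|].
    + replace (S (length s) - S (length s))%nat with 0%nat by lia. simpl.
      split; constructor; auto.
    + replace (S (length s) - k)%nat with (S (length s - k)) by lia. simpl.
      destruct (IH ltac:(lia)). split; auto. now constructor.
Qed.

Lemma reach_eq_skipn t s : reach t s -> skipn (length s - length t) s = t.
Proof.
  induction 1 as [|s c Hs IH Hc].
  - replace (length t - length t)%nat with 0%nat by lia. reflexivity.
  - apply reach_length in Hs. simpl length.
    replace (S (length s) - length t)%nat with (S (length s - length t)) by lia. auto.
Qed.

Lemma is_path_trans t s c : reach t s -> is_path s c -> is_path t c.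
Proof.
  induction 1 as [|s x Hs IH Hx]; auto. intros [H1 H2]. apply IH.
  simpl in H1. injection H1 as H0 H1. split; auto.
  intros n Hn. destruct (Nat.eq_dec n (length s)) as [->|].
  - rewrite H0, H1. auto.
  - apply H2. simpl. lia.
Qed.

Lemma skipn_S_cons (s : list A) k : (k < length s)%nat ->
  exists x, skipn (length s - S k) s = x :: skipn (length s - k) s.
Proof.
  intros Hk. destruct (skipn (length s - S k) s) as [|x u] eqn:E.
  - apply (f_equal (@length A)) in E. rewrite length_skipn in E. simpl in E. lia.
  - exists x. f_equal. replace (length s - k)%nat with (1 + (length s - S k))%nat by lia.
    rewrite <- skipn_skipn, E. reflexivity.
Qed.

(** Members of a descending chain agree on common lengths, so the ancestor [N j] of length [j] does
    not depend on the member it is cut from; these ancestors are the prefixes of one path. *)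
Lemma path_of_chain t (s : nat -> list A) :
  reach t (s O) -> (forall i, reach (s i) (s (S i))) -> (forall i, (i <= length (s i))%nat) ->
  exists c, is_path t c /\ forall i, pfx c (length (s i)) = s i.
Proof.
  intros H0 HS Hlen.
  assert (Hmono : forall j i, reach (s i) (s (i + j)%nat)).
  { induction j; intros i; [rewrite Nat.add_0_r; constructor|].
    replace (i + S j)%nat with (S (i + j)) by lia. eapply reach_trans; [apply IHj|apply HS]. }
  set (N := fun j => skipn (length (s j) - j) (s j)).
  assert (HN : forall i j, (j <= length (s i))%nat -> N j = skipn (length (s i) - j) (s i)).
  { assert (Hcut : forall (u v : list A) k, reach u v -> (k <= length u)%nat ->
        skipn (length u - k) u = skipn (length v - k) v).
    { intros u v k Hr Hk. pose proof (reach_length _ _ Hr).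
      rewrite <- (reach_eq_skipn _ _ Hr) at 2. rewrite skipn_skipn.
      f_equal. lia. }
    intros i j Hj. unfold N. destruct (Nat.le_gt_cases i j).
    - symmetry. apply Hcut; auto. pose proof (Hmono (j - i)%nat i) as Hm.
      now replace (i + (j - i))%nat with j in Hm by lia.
    - apply Hcut; auto. pose proof (Hmono (i - j)%nat j) as Hm.
      now replace (j + (i - j))%nat with i in Hm by lia. }
  destruct (code_of_nodes a0 N) as [c Hc].
  - unfold N. rewrite Nat.sub_0_r. apply skipn_all.
  - intros j. rewrite (HN (S j) (S j)), (HN (S j) j); auto.
    2:{ pose proof (Hlen (S j)). lia. }
    apply skipn_S_cons. pose proof (Hlen (S j)). lia.
  - exists c.
    assert (Hs : forall i, pfx c (length (s i)) = s i).
    { intros i. rewrite Hc, (HN i) by auto. rewrite Nat.sub_diag. reflexivity. }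
    split; auto. split.
    + rewrite Hc, (HN O) by (now apply reach_length). now apply reach_eq_skipn.
    + intros n Hn.
      assert (Hr : reach t (pfx c (S n))).
      { rewrite Hc. unfold N. apply reach_skipn.
        - eapply reach_trans; [exact H0|]. apply (Hmono (S n) O).
        - specialize (Hlen (S n)). lia. }
      simpl in Hr. inversion Hr as [E|]; auto.
      apply (f_equal (@length A)) in E. simpl in E. rewrite length_pfx in E. lia.
Qed.

(** By contraposition of the inductive clause a bad node has a bad child; choosing such children
    forever gives a path that never becomes good. *)
Lemma bar_induction t (Good : list A -> Prop) :
  (forall s, reach t s -> (forall c, In c (ch s) -> Good (c :: s)) -> Good s) ->
  (forall c, is_path t c -> exists n, (length t <= n)%nat /\ Good (pfx c n)) ->
  Good t.
Proof.
  intros Hind Hpath. apply NNPP. intros Hbad.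
  assert (Hch : forall s, exists c, reach t s -> ~ Good s -> In c (ch s) /\ ~ Good (c :: s)).
  { intros s. destruct (classic (reach t s /\ ~ Good s)) as [[H1 H2]|Hn].
    - apply NNPP. intros Hno. apply H2, Hind; auto. intros c Hc. apply NNPP. intros Hg.
      apply Hno. exists c. auto.
    - exists a0. intros; exfalso; tauto. }
  apply choice in Hch. destruct Hch as [f Hf].
  set (nd := fix nd n := match n with O => t | S m => f (nd m) :: nd m end).
  assert (Hnd : forall n, reach t (nd n) /\ ~ Good (nd n) /\ length (nd n) = (length t + n)%nat).
  { induction n as [|n IH].
    - simpl. split; [constructor|split; [auto|lia]].
    - destruct IH as (I1 & I2 & I3). simpl. destruct (Hf _ I1 I2). repeat split; auto; [now constructor|lia]. }
  destruct (path_of_chain t nd) as (c & Hc1 & Hc2).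
  - constructor.
  - intros i. simpl. constructor; [constructor|]. destruct (Hnd i) as (I1 & I2 & _). now apply Hf.
  - intros i. destruct (Hnd i) as (_ & _ & ->). lia.
  - destruct (Hpath c Hc1) as (n & Hn & Hg). destruct (Hnd (n - length t)%nat) as (_ & I2 & I3).
    apply I2. rewrite <- Hc2, I3. now replace (length t + (n - length t))%nat with n by lia.
Qed.

(** The conditions [Q i] are met in turn while descending. One extra step before each descent makes
    the lengths grow, so that the chain determines an infinite path. *)
Lemma baire_path t (Q : nat -> list A -> Prop) :
  (forall s, reach t s -> ch s <> []) ->
  (forall i s, reach t s -> exists s', reach s s' /\ Q i s') ->
  exists c, is_path t c /\ forall i, exists n, (length t <= n)%nat /\ Q i (pfx c n).
Proof.
  intros Hne HQ.
  assert (Hch : forall is_ : nat * list A, exists s', reach t (snd is_) ->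
     reach (snd is_) s' /\ (length (snd is_) < length s')%nat /\ Q (fst is_) s').
  { intros [i s]. simpl. destruct (classic (reach t s)) as [Hr|]; [|exists s; tauto].
    pose proof (Hne s Hr) as Hs. destruct (ch s) as [|x l] eqn:E; [congruence|].
    destruct (HQ i (x :: s)) as (s' & H1 & H2).
    { constructor; auto. rewrite E. now left. }
    exists s'. intros _. split; [|split; auto].
    - eapply reach_trans; [|exact H1]. constructor; [constructor|]. rewrite E. now left.
    - apply reach_length in H1. simpl in H1. lia. }
  apply choice in Hch. destruct Hch as [f Hf].
  set (nd := fix nd n := match n with O => t | S m => f (m, nd m) end).
  assert (Hnd : forall n, reach t (nd n) /\ (n <= length (nd n))%nat).
  { induction n as [|n [I1 I2]]; simpl; [split; [constructor|lia]|].
    destruct (Hf (n, nd n) I1) as (J1 & J2 & _). simpl in *. split; [|lia].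
    eapply reach_trans; eauto. }
  destruct (path_of_chain t nd) as (c & Hc1 & Hc2).
  - constructor.
  - intros i. apply (Hf (i, nd i)). apply Hnd.
  - intros i. apply Hnd.
  - exists c. split; auto. intros i. exists (length (nd (S i))). split.
    + apply reach_length, Hnd.
    + rewrite Hc2. apply (Hf (i, nd i)). apply Hnd.
Qed.

(** * Mass split equally among children, and covers by cells *)

Definition wt (s : list A) : R := / INR (Nat.max 1 (length (ch s))).

Fixpoint mass (s : list A) : R :=
  match s with [] => 1 | _ :: t => mass t * wt t end.

Lemma wt_bounds s : 0 < wt s <= 1.
Proof.
  assert (1 <= INR (Nat.max 1 (length (ch s)))) by (apply (le_INR 1); lia).
  unfold wt. split; [apply Rinv_0_lt_compat; lra|].
  rewrite <- Rinv_1. apply Rinv_le_contravar; lra.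
Qed.

Lemma mass_pos s : 0 < mass s.
Proof. induction s; simpl; [lra|]. apply Rmult_lt_0_compat; auto. apply wt_bounds. Qed.

Lemma mass_antitone s u : reach s u -> mass u <= mass s.
Proof.
  induction 1 as [|u c H IH Hc]; [lra|]. simpl. pose proof (wt_bounds u). pose proof (mass_pos u). nra.
Qed.

Lemma lsum_mass_children s : lsum (fun c => mass (c :: s)) (ch s) <= mass s /\
  (ch s <> [] -> lsum (fun c => mass (c :: s)) (ch s) = mass s).
Proof.
  simpl. rewrite lsum_const. unfold wt. destruct (ch s) as [|x l] eqn:E.
  - split; [|congruence]. pose proof (mass_pos s). simpl. lra.
  - replace (Nat.max 1 (length (x :: l))) with (length (x :: l)) by (simpl; lia).
    assert (0 < INR (length (x :: l))) by (apply lt_0_INR; simpl; lia).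
    assert (Ee : mass s * / INR (length (x :: l)) * INR (length (x :: l)) = mass s) by (field; lra).
    split; [lra|auto].
Qed.

Lemma lsum_one_nonzero {B} (f : B -> R) l b v :
  NoDup l -> 0 <= v -> f b <= v -> (forall x, In x l -> x <> b -> f x <= 0) -> lsum f l <= v.
Proof.
  intros Hl Hv Hb H. induction l as [|x l IH]; simpl; [lra|].
  inversion Hl as [|? ? Hx Hl']; subst. destruct (eq_decide x b) as [->|Hne].
  - assert (lsum f l <= 0); [|lra]. replace 0 with (lsum (fun _ : B => 0) l) by (rewrite lsum_const; ring).
    apply lsum_le. intros y Hy. apply H; [now right|]. intros ->. contradiction.
  - assert (f x <= 0) by (apply H; [now left|auto]).
    assert (lsum f l <= v) by (apply IH; auto; intros; apply H; auto; now right). lra.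
Qed.

(* [flow u] is the mass function of the measure restricted to the cell [u]. *)
Definition flow (u s : list A) : R :=
  if decide (reach s u) then mass u
  else if decide (reach u s) then mass s else 0.

Lemma flow_nonneg u s : 0 <= flow u s.
Proof.
  unfold flow. destruct decide; [left; apply mass_pos|].
  destruct decide; [left; apply mass_pos|lra].
Qed.

Lemma flow_le u s : flow u s <= mass u.
Proof.
  unfold flow. destruct decide; [lra|].
  destruct decide; [now apply mass_antitone|left; apply mass_pos].
Qed.

(** Three positions: if [s] is a proper ancestor of [u], exactly one child carries the mass of [u];
    if [s] lies in [u], its mass splits among the children; otherwise everything vanishes. *)
Lemma flow_children u s : NoDup (ch s) -> lsum (fun c => flow u (c :: s)) (ch s) <= flow u s.
Proof.
  intros Hnd. unfold flow at 2.
  destruct (decide (reach s u)) as [H|H].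
  - destruct (Nat.eq_dec (length s) (length u)) as [E|E].
    + pose proof (reach_same_length _ _ H E); subst u.
      apply Rle_trans with (lsum (fun c => mass (c :: s)) (ch s)); [|apply lsum_mass_children].
      apply lsum_le. intros c Hc. unfold flow. destruct decide as [Hr|Hr].
      * apply reach_length in Hr. simpl in Hr. lia.
      * destruct decide; [lra|left; apply mass_pos].
    + assert (Hc : exists c, reach (c :: s) u).
      { pose proof (reach_length _ _ H).
        destruct (reach_skipn s u (S (length s)) H ltac:(lia)) as [H1 H2].
        destruct (skipn_S_cons u (length s) ltac:(lia)) as [x Hx].
        rewrite (reach_eq_skipn _ _ H) in Hx. rewrite Hx in H2. now exists x. }
      destruct Hc as [c0 Hc0]. apply lsum_one_nonzero with c0; auto.
      * left; apply mass_pos.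
      * apply flow_le.
      * intros c Hc Hne. unfold flow. destruct decide as [Hr|Hr].
        -- exfalso. apply Hne. apply reach_eq_skipn in Hr, Hc0.
           simpl length in Hr, Hc0. congruence.
        -- destruct decide as [Hr'|]; [|lra].
           exfalso. apply Hr. pose proof (reach_length _ _ Hr') as L1.
           pose proof (reach_length _ _ Hc0) as L2. simpl in L1, L2.
           rewrite (reach_same_length _ _ Hr') by (simpl; lia). constructor.
  - destruct (decide (reach u s)) as [H'|H'].
    + apply Rle_trans with (lsum (fun c => mass (c :: s)) (ch s)); [|apply lsum_mass_children].
      apply lsum_le. intros c Hc. unfold flow. destruct decide as [Hr|Hr].
      * apply reach_length in Hr. apply reach_length in H'. simpl in Hr. lia.
      * destruct decide; [lra|left; apply mass_pos].
    + replace 0 with (lsum (fun _ : A => 0) (ch s)) by (rewrite lsum_const; ring).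
      apply lsum_le. intros c Hc. unfold flow. destruct decide as [Hr|Hr].
      * exfalso. apply H. eapply reach_trans; [|exact Hr]. constructor; [constructor|auto].
      * destruct decide as [Hr'|]; [|lra]. exfalso.
        inversion Hr'; subst; [|contradiction]. apply Hr. constructor.
Qed.

(** Bar induction plays the part of compactness: a cover of all paths yields a finite list of active
    cells whose flows at [t] already account for the mass of [t]. *)
Lemma mass_cover {T : Type} (cell : T -> list A) (act : T -> Prop) t B :
  (forall s, reach t s -> NoDup (ch s) /\ ch s <> []) ->
  (forall c, is_path t c -> exists i n, act i /\ (length t <= n)%nat /\ pfx c n = cell i) ->
  SB (fun i => if decide (act i) then mass (cell i) else 0) B ->
  mass t <= B.
Proof.
  intros Hch Hcov HB.
  assert (HG : exists l : list T, NoDup l /\ (forall i, In i l -> act i) /\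
     mass t <= lsum (fun i => flow (cell i) t) l).
  { apply (bar_induction t (fun s => exists l : list T, NoDup l /\ (forall i, In i l -> act i) /\
     mass s <= lsum (fun i => flow (cell i) s) l)).
    - intros s Hs Hgood. destruct (Hch s Hs) as [Hnd Hne].
      (* The lists of the finitely many children are merged without repetition, since [B] pays for
         each index once. *)
      assert (Hall : forall L, incl L (ch s) -> exists l : list T, NoDup l /\ (forall i, In i l -> act i) /\
        forall c, In c L -> mass (c :: s) <= lsum (fun i => flow (cell i) (c :: s)) l).
      { induction L as [|c L IH]; intros HL.
        - exists []. repeat split; [constructor| |]; intros ? [].
        - destruct IH as (l & L1 & L2 & L3); [intros x Hx; apply HL; now right|].
          destruct (Hgood c) as (l' & M1 & M2 & M3); [apply HL; now left|].
          exists (nodup eq_decide (l ++ l')). split; [apply NoDup_nodup|]. split.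
          + intros i Hi. apply nodup_In, in_app_iff in Hi. destruct Hi; auto.
          + intros x [<-|Hx].
            * eapply Rle_trans; [exact M3|]. apply lsum_incl; auto; [intros; apply flow_nonneg|].
              intros i Hi. apply nodup_In, in_app_iff. auto.
            * eapply Rle_trans; [apply L3; auto|]. apply lsum_incl; auto; [intros; apply flow_nonneg|].
              intros i Hi. apply nodup_In, in_app_iff. auto. }
      destruct (Hall (ch s) (incl_refl _)) as (l & L1 & L2 & L3).
      exists l. split; [auto|split; [auto|]].
      rewrite <- (proj2 (lsum_mass_children s) Hne).
      apply Rle_trans with (lsum (fun c => lsum (fun i => flow (cell i) (c :: s)) l) (ch s)).
      + apply lsum_le; auto.
      + rewrite lsum_swap. apply lsum_le. intros i _. now apply flow_children.
    - intros c Hc. destruct (Hcov c Hc) as (i & n & Hi & Hn & E). exists n. split; auto.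
      exists [i]. split; [repeat constructor; simpl; tauto|]. split; [intros j [<-|[]]; auto|].
      simpl. rewrite Rplus_0_r, E. unfold flow. destruct decide as [|Hno]; [lra|].
      exfalso. apply Hno. constructor. }
  destruct HG as (l & L1 & L2 & L3). eapply Rle_trans; [exact L3|].
  eapply Rle_trans; [|apply (HB l L1)]. apply lsum_le. intros i Hi.
  destruct decide as [|Hno]; [apply flow_le|exfalso; auto].
Qed.

End Tree.

(** * Lower bounds *)

Lemma NoDup_list_prod {A B} (l : list A) (l' : list B) :
  NoDup l -> NoDup l' -> NoDup (list_prod l l').
Proof.
  intros Hl Hl'. induction Hl as [|x l Hx Hl IH]; simpl; [constructor|].
  apply NoDup_app; auto.
  - apply NoDup_map_NoDup_ForallPairs; auto. intros y y' _ _ E. now injection E.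
  - intros [x' y] H H'. apply in_map_iff in H. destruct H as (y' & E & _).
    apply in_prod_iff in H'. injection E as -> _. tauto.
Qed.

(** * Iterates on discs, accumulation points and finite packings *)

Lemma orbit_bounded lam G n : exists M, forall z, Cmod z <= G -> Cmod (Eiter lam n z) <= M.
Proof.
  induction n as [|n [M HM]]; [exists G; auto|].
  exists (Cmod (lam (S n)) * exp M). intros z Hz. simpl Eiter. rewrite Cmod_Elam.
  apply Rmult_le_compat_l; [apply Cmod_ge_0|]. apply exp_le_compat.
  eapply Rle_trans; [apply Rle_abs|]. eapply Rle_trans; [apply Rabs_fst_le|auto].
Qed.

Lemma Eiter_lip lam G n : exists L, 0 < L /\ forall z w, Cmod z <= G -> Cmod w <= G ->
  Cmod (Cminus (Eiter lam n z) (Eiter lam n w)) <= L * Cmod (Cminus z w).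
Proof.
  induction n as [|n (L & HL & IH)].
  - exists 1. split; [lra|]. intros; simpl; lra.
  - destruct (orbit_bounded lam G n) as [M HM].
    pose proof (Cmod_ge_0 (lam (S n))) as Hl. pose proof (exp_pos M) as HeM.
    assert (H0 : 0 <= 2 * Cmod (lam (S n)) * exp M) by nra.
    exists (2 * Cmod (lam (S n)) * exp M * L + 1). split; [nra|].
    intros z w Hz Hw. simpl Eiter. pose proof (Cmod_ge_0 (Cminus z w)).
    assert (Hf : forall x, Cmod x <= G -> fst (Eiter lam n x) <= M).
    { intros x Hx. eapply Rle_trans; [apply Rle_abs|]. eapply Rle_trans; [apply Rabs_fst_le|auto]. }
    eapply Rle_trans; [apply (Elam_lip _ _ _ M); auto|].
    eapply Rle_trans; [apply Rmult_le_compat_l; [exact H0|apply IH; auto]|]. lra.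
Qed.

(** The radius [G] is uniform over the annulus. An imaginary part in $[1,8]$ keeps the preimage away
    from $0$, so the induction continues with lower modulus [1]. *)
Lemma Eiter_preimage lam n : (forall n, (1 <= n)%nat -> lam n <> (0, 0)) ->
  forall m M, 0 < m -> exists G, forall w, m <= Cmod w <= M ->
  exists z, Cmod z <= G /\ Eiter lam n z = w.
Proof.
  intros Hl. induction n as [|n IH]; intros m M Hm.
  - exists M. intros w Hw. exists w. split; [lra|reflexivity].
  - assert (Hl' : 0 < Cmod (lam (S n))) by (apply Cmod_gt_0, Hl; lia).
    destruct (IH 1 (Rabs (ln (m / Cmod (lam (S n)))) + Rabs (ln (M / Cmod (lam (S n)))) + 8)) as [G HG]; [lra|].
    exists G. intros w Hw.
    destruct (Elam_preimage (lam (S n)) w 1) as (y & Hy & Hf & Hs).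
    { apply Hl; lia. }
    { intros ->. rewrite Cmod_0 in Hw. lra. }
    destruct (HG y) as (z & Hz & Ez).
    + split.
      * eapply Rle_trans; [|apply Rabs_snd_le]. rewrite Rabs_pos_eq; lra.
      * eapply Rle_trans; [apply Cmod_le_sum|]. rewrite Hf.
        rewrite (Rabs_pos_eq (snd y)) by lra.
        assert (ln (m / Cmod (lam (S n))) <= ln (Cmod w / Cmod (lam (S n))) <= ln (M / Cmod (lam (S n)))).
        { split; apply ln_le_compat; try (apply Rdiv_lt_0_compat; lra);
            apply Rmult_le_compat_r; try lra; left; now apply Rinv_0_lt_compat. }
        pose proof (Rle_abs (ln (M / Cmod (lam (S n))))).
        pose proof (Rle_abs (- ln (m / Cmod (lam (S n))))). rewrite Rabs_Ropp in H1.
        pose proof (Rabs_pos (ln (m / Cmod (lam (S n))))).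
        pose proof (Rabs_pos (ln (M / Cmod (lam (S n))))).
        assert (Rabs (ln (Cmod w / Cmod (lam (S n)))) <=
          Rabs (ln (m / Cmod (lam (S n)))) + Rabs (ln (M / Cmod (lam (S n))))); [|lra].
        apply Rabs_le. lra.
    + exists z. split; auto. simpl. now rewrite Ez.
Qed.

Lemma cluster_R (u : nat -> R) M : (forall n, Rabs (u n) <= M) ->
  exists l, forall e m, 0 < e -> exists n, (m <= n)%nat /\ Rabs (u n - l) < e.
Proof.
  intros H. destruct (Bolzano_Weierstrass u (fun x => - M <= x <= M)) as [l Hl].
  - apply compact_P3.
  - intros n. specialize (H n). now apply Rabs_le_between.
  - exists l. intros e m He. apply (Hl (fun x => Rabs (x - l) < e) m).
    exists (mkposreal e He). intros x Hx. exact Hx.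
Qed.

Lemma cluster_C (u : nat -> C) M : (forall n, Cmod (u n) <= M) ->
  exists l, forall e m, 0 < e -> exists n, (m <= n)%nat /\ Cmod (Cminus (u n) l) < e.
Proof.
  intros H. destruct (cluster_R (fun n => fst (u n)) M) as [l1 H1].
  { intros n. eapply Rle_trans; [apply Rabs_fst_le|auto]. }
  assert (Hs : forall k, exists n, (k <= n)%nat /\ Rabs (fst (u n) - l1) < / INR (S k)).
  { intros k. apply H1. apply Rinv_0_lt_compat, lt_0_INR. lia. }
  apply choice in Hs. destruct Hs as [f Hf].
  destruct (cluster_R (fun n => snd (u (f n))) M) as [l2 H2].
  { intros n. eapply Rle_trans; [apply Rabs_snd_le|auto]. }
  exists (l1, l2). intros e m He.
  destruct (archimed_cor1 (e / 2)) as (n0 & Hn0 & Hn0'); [lra|].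
  destruct (H2 (e / 2) (m + n0)%nat) as (k & Hk & Hk2); [lra|].
  destruct (Hf k) as [F1 F2]. exists (f k). split; [lia|].
  eapply Rle_lt_trans; [apply Cmod_le_sum|]. simpl.
  assert (/ INR (S k) <= / INR n0).
  { apply Rinv_le_contravar; [apply lt_0_INR; lia|apply le_INR; lia]. }
  unfold Rminus in *. lra.
Qed.

Lemma SB_separated (P : R -> Prop) (f : R -> R) d c v :
  0 < d -> 0 <= v -> 0 <= c ->
  (forall x y, P x -> P y -> (x = y \/ d <= Rabs (x - y)) /\ Rabs (x - y) <= c) ->
  (forall x, P x -> f x <= v) -> (forall x, ~ P x -> f x <= 0) ->
  SB f (v * (2 * (c / d + 1) + 1)).
Proof.
  intros Hd Hv Hc HP Hf Hf0.
  set (Q := fun m => exists x, P x /\ Int_part (x / d) = m).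
  apply SB_inj with (fun m => if decide (Q m) then v else 0)
    (fun x => Int_part (x / d)) P; auto.
  - intros m. destruct decide; lra.
  - intros x y Hx Hy E. destruct (HP x y Hx Hy) as [[->|H] _]; auto.
    apply Int_part_eq_close in E; auto. lra.
  - intros x Hx. destruct decide as [|Hno]; auto.
    exfalso. apply Hno. now exists x.
  - assert (0 <= c / d) by (apply Rmult_le_pos; auto; left; now apply Rinv_0_lt_compat).
    apply SB_Z_interval with Q; auto; [lra| | |].
    + intros m m' (x & Hx & <-) (y & Hy & <-). apply Int_part_spread; auto. now apply HP.
    + intros m Hm. destruct decide; [lra|contradiction].
    + intros m Hm. destruct decide; [contradiction|lra].
Qed.

Lemma superlinear_bounded a : superlinear a -> forall K e, 0 < e ->
  exists M, forall n, K * INR n - e * ln (prod1 a (n - 1)) <= M.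
Proof.
  intros H K e He. destruct (superlinear_decay a H K 0 e 2 He ltac:(lra)) as [m Hm].
  destruct (finite_max (fun n => K * INR n - e * ln (prod1 a (n - 1))) m) as [M HM].
  exists (Rmax M 0). intros n. destruct (Nat.le_gt_cases n m) as [Hn|Hn].
  - eapply Rle_trans; [apply (HM n Hn)|apply Rmax_l].
  - eapply Rle_trans; [|apply Rmax_r]. specialize (Hm n ltac:(lia)).
    apply Rnot_lt_le. intros Hlt. apply exp_increasing in Hlt. rewrite exp_0 in Hlt.
    rewrite Rplus_0_r in Hm.
    assert ((/ 2) ^ n <= 1) by (rewrite <- (pow1 n); apply pow_incr; lra). lra.
Qed.

Lemma SB_of_list {T} (f : T -> R) (l : list T) (g : T -> R) :
  (forall x, 0 <= f x) -> (forall x, In x l -> g x <= f x) -> (forall x, ~ In x l -> g x <= 0) ->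
  SB g (lsum f l).
Proof.
  intros Hf Hg Hg0 l' Hl'.
  set (p := fun x => if decide (In x l) then true else false).
  assert (Hp : forall x, p x = true <-> In x l).
  { intros x; unfold p; destruct (decide (In x l)); split; congruence || tauto. }
  rewrite (lsum_filter g p).
  assert (lsum g (filter (fun x => negb (p x)) l') <= 0).
  { replace 0 with (lsum (fun _ : T => 0) (filter (fun x => negb (p x)) l'))
      by (rewrite lsum_const; ring).
    apply lsum_le. intros x Hx. apply filter_In in Hx. apply Hg0.
    rewrite <- Hp. destruct (p x); simpl in Hx; [intuition congruence|congruence]. }
  assert (lsum g (filter p l') <= lsum f l); [|lra].
  apply Rle_trans with (lsum f (filter p l')).
  - apply lsum_le. intros x Hx. apply filter_In in Hx. apply Hg, Hp. tauto.
  - apply lsum_incl; auto; [now apply NoDup_filter|].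
    intros x Hx. apply filter_In in Hx. apply Hp. tauto.
Qed.

Lemma pfx_le {A} (c c' : nat -> A) n : pfx c n = pfx c' n -> forall k, (k <= n)%nat -> pfx c k = pfx c' k.
Proof.
  induction n as [|n IH]; intros H k Hk; [now replace k with 0%nat by lia|].
  destruct (Nat.eq_dec k (S n)) as [->|]; auto. simpl in H. injection H as _ H. apply IH; auto. lia.
Qed.

Lemma ForallOrdPairs_app {T} (P : T -> T -> Prop) l1 l2 :
  ForallOrdPairs P l1 -> ForallOrdPairs P l2 -> (forall x y, In x l1 -> In y l2 -> P x y) ->
  ForallOrdPairs P (l1 ++ l2).
Proof.
  intros H1 H2 H. induction H1 as [|x l1 Hx H1 IH]; simpl; auto. constructor.
  - apply Forall_app. split; auto. apply Forall_forall. intros y Hy. apply H; auto. now left.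
  - apply IH. intros y z Hy Hz. apply H; auto. now right.
Qed.

Lemma ForallOrdPairs_nth {T} (P : T -> T -> Prop) l d : ForallOrdPairs P l ->
  forall i j, (i < j < length l)%nat -> P (nth i l d) (nth j l d).
Proof.
  induction 1 as [|x l Hx H IH]; intros i j Hij; simpl in *; [lia|].
  destruct j as [|j]; [lia|]. destruct i as [|i].
  - rewrite Forall_forall in Hx. apply Hx, nth_In. lia.
  - apply IH. lia.
Qed.

Lemma lsum_nth {T} (f : T -> R) (l : list T) d :
  lsum (fun i => f (nth i l d)) (seq 0 (length l)) = lsum f l.
Proof.
  induction l as [|x l IH]; [reflexivity|].
  change (f x + lsum (fun i => f (nth i (x :: l) d)) (seq 1 (length l)) = f x + lsum f l).
  rewrite <- seq_shift, lsum_map. f_equal. exact IH.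
Qed.

(** Beyond the list the default [z0] supplies radius [0]. Centres farther apart than the sum of the
    radii give disjoint closed balls. *)
Lemma Ps_delta_ge_list s d M (F : C -> Prop) (l : list (C * R)) : 0 <= d ->
  (forall p, In p l -> 0 < snd p <= d /\ F (fst p)) ->
  ForallOrdPairs (fun p p' => snd p + snd p' < Cmod (Cminus (fst p) (fst p'))) l ->
  M <= lsum (fun p => rpow (2 * snd p) s) l -> Rbar_le (Finite M) (Ps_delta s d F).
Proof.
  intros Hd0 Hl Hfar HM. set (z0 := (RtoC 0, 0) : C * R).
  eapply Rbar_le_trans; [|apply Rbar_lub_ub].
  2:{ exists (fun i => fst (nth i l z0)), (fun i => snd (nth i l z0)). split; [|reflexivity].
      assert (Hout : forall i, (length l <= i)%nat -> snd (nth i l z0) = 0).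
      { intros i Hi. rewrite nth_overflow by auto. reflexivity. }
      split.
      - intros i. destruct (Nat.lt_ge_cases i (length l)) as [Hi|Hi].
        + destruct (Hl (nth i l z0)); [now apply nth_In|]. split; [lra|auto].
        + rewrite Hout by auto. split; lra.
      - assert (Hlt : forall i j, (i < j)%nat -> 0 < snd (nth j l z0) -> forall z,
          ~ (cball (fst (nth i l z0)) (snd (nth i l z0)) z /\ cball (fst (nth j l z0)) (snd (nth j l z0)) z)).
        { intros i j Hij Hj z [H1 H2]. unfold cball in H1, H2.
          assert (j < length l)%nat by (apply Nat.nle_gt; intros Hle; rewrite Hout in Hj by auto; lra).
          pose proof (ForallOrdPairs_nth _ l z0 Hfar i j ltac:(lia)) as H3. simpl in H3.
          pose proof (Cmod_dist_triang (fst (nth i l z0)) z (fst (nth j l z0))).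
          rewrite (Cmod_dist_sym (fst (nth i l z0)) z) in H0. lra. }
        intros i j Hne Hi Hj z [H1 H2]. destruct (Nat.lt_total i j) as [H|[H|H]]; [|contradiction|].
        + apply (Hlt i j H Hj z). auto.
        + apply (Hlt j i H Hi z). auto. }
  unfold nnsum. eapply Rbar_le_trans.
  2:{ apply (Sup_seq_minor_le (fun n => Finite (sum_f_R0 (fun i => rpow (2 * snd (nth i l z0)) s) n))
        (sum_f_R0 (fun i => rpow (2 * snd (nth i l z0)) s) (length l)) (length l)).
      apply Rbar_le_refl. }
  simpl. eapply Rle_trans; [exact HM|]. rewrite <- (lsum_nth (fun p => rpow (2 * snd p) s) l z0), sum_f_R0_lsum.
  apply lsum_incl.
  - intros; apply rpow_nonneg.
  - apply seq_NoDup.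
  - intros i Hi. apply in_seq in Hi. apply in_seq. lia.
Qed.

Lemma Ps0_nonneg s F : Rbar_le (Finite 0) (Ps0 s F).
Proof.
  unfold Ps0. rewrite Inf_eq_glb. apply Rbar_glb_greatest. intros v [n ->].
  apply Ps_delta_nonneg. left. apply Rinv_0_lt_compat, lt_0_INR. lia.
Qed.

Lemma Ps0_infinite_of s F : (forall d M, 0 < d -> Rbar_le (Finite M) (Ps_delta s d F)) ->
  Ps0 s F = p_infty.
Proof.
  intros H. apply Rbar_le_antisym; [now destruct (Ps0 s F)|].
  unfold Ps0. rewrite Inf_eq_glb. apply Rbar_glb_greatest. intros v [n ->].
  pose proof (fun M => H (/ INR (S n)) M ltac:(apply Rinv_0_lt_compat, lt_0_INR; lia)) as HM.
  destruct (Ps_delta s (/ INR (S n)) F) as [v| |]; simpl in *; auto.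
  specialize (HM (v + 1)). lra.
Qed.

(** Nonnegativity excludes a sum of opposite infinities, to which [Rbar_plus] assigns a conventional
    finite value. *)
Lemma rbar_sum_infinite (f : nat -> Rbar) i : (forall j, Rbar_le (Finite 0) (f j)) ->
  f i = p_infty -> rbar_sum f = p_infty.
Proof.
  intros Hf Hi.
  assert (H : forall n, Rbar_le (Finite 0) (rbar_psum f n) /\ ((i <= n)%nat -> rbar_psum f n = p_infty)).
  { induction n as [|n [I1 I2]].
    - split; [apply Hf|]. intros Hi0. assert (i = 0%nat) by lia. subst i. exact Hi.
    - simpl. pose proof (Hf (S n)) as Hn. split.
      + destruct (rbar_psum f n), (f (S n)); simpl in *; auto; lra.
      + intros H. destruct (Nat.eq_dec i (S n)) as [<-|].
        * rewrite Hi. destruct (rbar_psum f n); simpl in *; auto; contradiction.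
        * rewrite I2 by lia. destruct (f (S n)); simpl in *; auto; contradiction. }
  apply Rbar_le_antisym; [now destruct (rbar_sum f)|].
  rewrite <- (proj2 (H i) (le_n i)). unfold rbar_sum. rewrite Rbar_sup_eq_lub.
  apply Rbar_lub_ub. now exists i.
Qed.

Lemma Rbar_lt_between x y : Rbar_lt x y -> exists r : R, Rbar_lt x (Finite r) /\ Rbar_lt (Finite r) y.
Proof.
  destruct x as [x| |], y as [y| |]; simpl; intros H; try contradiction.
  - exists ((x + y) / 2). lra.
  - exists (x + 1). split; [lra|exact I].
  - exists (y - 1). split; [exact I|lra].
  - exists 0. auto.
Qed.

Lemma LimInf_gt u x : Rbar_lt (Finite x) (LimInf_seq u) ->
  exists N, forall n, (N <= n)%nat -> x < u n.
Proof.
  unfold LimInf_seq. destruct (ex_LimInf_seq u) as [[l| |] Hl]; simpl; intros H; try contradiction.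
  - destruct (Hl (mkposreal (l - x) ltac:(lra))) as [_ [N HN]]. exists N. intros n Hn.
    specialize (HN n Hn). simpl in HN. lra.
  - apply Hl.
Qed.

Lemma LimInf_lt u x : Rbar_lt (LimInf_seq u) (Finite x) ->
  forall N, exists n, (N <= n)%nat /\ u n < x.
Proof.
  unfold LimInf_seq. destruct (ex_LimInf_seq u) as [[l| |] Hl]; simpl; intros H; try contradiction.
  - destruct (Hl (mkposreal (x - l) ltac:(lra))) as [Hi _]. intros N. destruct (Hi N) as (n & Hn & Hu).
    exists n. simpl in Hu. split; [auto|lra].
  - intros N. apply (Hl x N).
Qed.

Lemma LimSup_gt u x : Rbar_lt (Finite x) (LimSup_seq u) ->
  forall N, exists n, (N <= n)%nat /\ x < u n.
Proof.
  unfold LimSup_seq. destruct (ex_LimSup_seq u) as [[l| |] Hl]; simpl; intros H; try contradiction.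
  - destruct (Hl (mkposreal (l - x) ltac:(lra))) as [Hi _]. intros N. destruct (Hi N) as (n & Hn & Hu).
    exists n. simpl in Hu. split; [auto|lra].
  - intros N. apply (Hl x N).
Qed.

Lemma LimSup_lt u x : Rbar_lt (LimSup_seq u) (Finite x) ->
  exists N, forall n, (N <= n)%nat -> u n < x.
Proof.
  unfold LimSup_seq. destruct (ex_LimSup_seq u) as [[l| |] Hl]; simpl; intros H; try contradiction.
  - destruct (Hl (mkposreal (x - l) ltac:(lra))) as [_ [N HN]]. exists N. intros n Hn.
    specialize (HN n Hn). simpl in HN. lra.
  - apply Hl.
Qed.

Lemma countable_surj {T : Type} (t0 : T) :
  (exists e : T -> nat, forall x y, e x = e y -> x = y) ->
  exists d : nat -> T, forall t, exists i, d i = t.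
Proof.
  intros [e He].
  assert (H : forall i, exists t, forall t', e t' = i -> t = t').
  { intros i. destruct (classic (exists t, e t = i)) as [[t Ht]|Hn].
    - exists t. intros t' Ht'. apply He. congruence.
    - exists t0. intros t' Ht'. exfalso. eauto. }
  apply choice in H. destruct H as [d Hd]. exists d. intros t. exists (e t). now apply Hd.
Qed.

Lemma prod1_log_lower y N c : 0 < c <= 1 -> (forall k, (1 <= k)%nat -> 0 < y k) ->
  (forall k, (N <= k)%nat -> c <= y k) ->
  exists B, forall n, INR n * ln c - B <= ln (prod1 y n).
Proof.
  intros Hc Hy Hyc.
  destruct (finite_max (fun n => INR n * ln c - ln (prod1 y n)) N) as [B HB].
  exists B. induction n as [|n IH].
  - specialize (HB 0%nat ltac:(lia)). lra.
  - destruct (Nat.le_gt_cases (S n) N) as [H|H].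
    + specialize (HB (S n) H). cbv beta in HB. lra.
    + rewrite ln_prod1_S, S_INR by auto.
      assert (ln c <= ln (y (S n))) by (apply ln_le_compat; [lra|apply Hyc; lia]). lra.
Qed.

(** * A priori range of $\phi_n$ and $\psi_n$ *)

Section Range.
Variables (a b : nat -> R) (D : R).
Hypothesis hab : forall n, (1 <= n)%nat -> 0 < a n < b n.
Hypothesis hD0 : 0 < D.
Hypothesis hD : forall n, (1 <= n)%nat -> D <= Delta_n a b n.
Hypothesis hb : superlinear a.

Lemma box_pos x : in_box a b x ->
  (forall k, (1 <= k)%nat -> 0 < x k) /\
  (forall k, (1 <= k)%nat -> 0 < lw a b x k <= x k) /\
  (forall n, ln (prod1 a n) <= ln (prod1 x n)) /\
  (forall n, ln (prod1 (lw a b a) n) <= ln (prod1 (lw a b x) n) <= ln (prod1 x n)).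
Proof.
  intros Hx.
  assert (H1 : forall k, (1 <= k)%nat -> 0 < x k).
  { intros k Hk. specialize (Hx k Hk). specialize (hab k Hk). lra. }
  assert (H2 : forall k, (1 <= k)%nat -> 0 < lw a b x k <= x k).
  { intros k Hk. specialize (H1 k Hk). pose proof (hD (S k) ltac:(lia)).
    split; [apply Rmin_pos; lra|apply Rmin_r]. }
  assert (H3 : forall k, (1 <= k)%nat -> 0 < lw a b a k <= lw a b x k).
  { intros k Hk. pose proof (hD (S k) ltac:(lia)). specialize (Hx k Hk). specialize (hab k Hk).
    split; [apply Rmin_pos; lra|]. apply Rle_min_compat_l. lra. }
  split; [auto|split; [auto|split]].
  - intros n. apply ln_prod1_le. intros k Hk. specialize (Hx k Hk). specialize (hab k Hk). lra.
  - intros n. split; apply ln_prod1_le; auto.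
Qed.

(** The numerators are at least $n\log c-B$ while the denominators outgrow every linear function;
    the upper bound is $w_k\le x_k$. It follows that the suprema of the theorem are at least $0$ and
    the infima at most $1$, which rules out the harmful infinite values. *)
Lemma phi_psi_range x N : (forall k, (N <= k)%nat -> 1 <= a k) -> in_box a b x -> forall d, 0 < d ->
  exists m, forall n, (m <= n)%nat ->
    - d <= phi_n a b x n <= 1 /\ - d <= psi_n a b x n <= 1.
Proof.
  intros HN Hx d Hd. destruct (box_pos x Hx) as (X1 & X2 & X3 & X4).
  assert (Ha : in_box a b a) by (intros k Hk; specialize (hab k Hk); lra).
  destruct (box_pos a Ha) as (_ & A2 & _).
  set (c := Rmin D 1). assert (Hc : 0 < c <= 1) by (split; [apply Rmin_pos; lra|apply Rmin_r]).
  destruct (prod1_log_lower (lw a b a) N c Hc) as [B HB].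
  { intros k Hk. apply A2. auto. }
  { intros k Hk. unfold lw. apply Rmin_glb.
    - eapply Rle_trans; [apply Rmin_l|apply hD; lia].
    - eapply Rle_trans; [apply Rmin_r|auto]. }
  assert (Hlc : ln c <= 0) by (rewrite <- ln_1; apply ln_le_compat; lra).
  destruct (hb ((- ln c + Rabs B) / d + 1)) as [m1 Hm1].
  exists (m1 + 2)%nat.
  (* $\phi_{n+1}$ and $\psi_n$ share the numerator over $n$ factors, and both denominators are at
     least $\log(x_1\cdots x_n)$. *)
  assert (Hkey : forall n, (m1 <= n)%nat -> (1 <= n)%nat -> 0 < ln (prod1 x n) /\
    forall den, ln (prod1 x n) <= den -> - d <= ln (prod1 (lw a b x) n) / den <= 1).
  { intros n Hn Hn1. specialize (Hm1 n Hn). specialize (HB n). specialize (X3 n). specialize (X4 n).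
    assert (H1n : 1 <= INR n) by (apply (le_INR 1); auto).
    pose proof (Rabs_pos B). pose proof (Rle_abs B).
    assert (Hq : 0 <= (- ln c + Rabs B) / d) by (apply Rdiv_le_0_compat; lra).
    assert (Hpos : 0 < ln (prod1 x n)) by nra.
    split; auto. intros den Hden.
    split; apply Rmult_le_reg_r with den; try lra; unfold Rdiv;
      rewrite (Rmult_assoc _ (/ den)), Rinv_l, Rmult_1_r by lra; [|lra].
    assert (Hd2 : (- ln c + Rabs B) * INR n <= d * den).
    { replace ((- ln c + Rabs B) * INR n) with (d * ((- ln c + Rabs B) / d * INR n)) by (field; lra).
      apply Rmult_le_compat_l; lra. }
    assert (Rabs B * 1 <= Rabs B * INR n) by (apply Rmult_le_compat_l; lra). lra. }
  intros n Hn. destruct n as [|n]; [lia|]. split.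
  - unfold phi_n. replace (S n - 1)%nat with n by lia.
    change (fun k : nat => Rmin (Delta_n a b (S k)) (x k)) with (lw a b x).
    change (Rmin (Delta_n a b (S (S n))) (x (S n))) with (lw a b x (S n)).
    apply Hkey; [lia|lia|]. rewrite ln_prod1_S by auto.
    destruct (X2 (S n) ltac:(lia)) as [W1 W2]. pose proof (ln_le_compat _ _ W1 W2). lra.
  - unfold psi_n. change (fun k : nat => Rmin (Delta_n a b (S k)) (x k)) with (lw a b x).
    apply Hkey; [lia|lia|lra].
Qed.

End Range.

Lemma Ps_null_union s F (Fi : nat -> C -> Prop) :
  (forall z, F z -> exists i, Fi i z) -> (forall i, Ps0 s (Fi i) = Finite 0) ->
  Ps s F = Finite 0.
Proof.
  intros HF Hi. apply Rbar_le_antisym.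
  - unfold Ps. eapply Rbar_le_trans; [apply Rbar_glb_lb; exists Fi; split; [exact HF|reflexivity]|].
    unfold rbar_sum. rewrite Rbar_sup_eq_lub. apply Rbar_lub_least. intros v [n ->].
    assert (E : rbar_psum (fun i => Ps0 s (Fi i)) n = Finite 0).
    { induction n; simpl; rewrite Hi; auto. rewrite IHn. simpl. f_equal. ring. }
    rewrite E. apply Rbar_le_refl.
  - apply Rbar_glb_greatest. intros v (Gi & _ & ->).
    eapply Rbar_le_trans; [apply (Ps0_nonneg s (Gi O))|].
    unfold rbar_sum. rewrite Rbar_sup_eq_lub. apply Rbar_lub_ub. now exists O.
Qed.

(** * The tree of boxes *)

Section LowerTree.
Variables (lam : nat -> C) (a b : nat -> R) (q D : R) (N : nat).

(** Width of all boxes: [2 * side <= D] leaves room for a box and a gap in every strip, and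
    [side <= 1/2] keeps the distortion per step below $2e^{side}\le e^2$. *)
Definition side : R := Rmin D 1 / 2.
(** The rectangle of children extends at most [kap * X] from $(p_0,v_0)$ in each direction; this
    must stay below half the thickness of the annulus of ratio $e^{side}$, which is about
    $X\,side/2$. *)
Definition kap : R := side / 8.
(** Real part at which $|\lambda_{k+1}e^z|=a_{k+1}$; the strip for the [k]-th iterate starts here
    and has width $\Delta_{k+1}$. *)
Definition strip_left (k : nat) : R := ln (a (S k) / Cmod (lam (S k))).
Definition nX (s : list (R * R)) : R := hX lam (map fst s).
Definition nW (s : list (R * R)) : R := hW lam a b (map fst s).
Definition Jlen (n : nat) (X : R) : R := Rmin (Delta_n a b (S n)) (kap * X).
(** Leftmost common point of the strip and $[-qa_n,qa_n]$, which meet by (a). Since its modulus is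
    at most [X], the vertical line through it crosses the annulus. *)
Definition p0 (n : nat) : R := Rmax (strip_left n) (- (q * a n)).
(** Left end of an interval of length [Jlen] that contains [p0]; it starts at [p0] unless it would
    then leave the strip on the right. *)
Definition Jlo (n : nat) (X : R) : R := Rmin (p0 n) (strip_left n + Delta_n a b (S n) - Jlen n X).
(** Makes $|p_0+iv_0|=e^{side/2}X$, the logarithmic middle of the annulus $X\le|z|\le e^{side}X$. *)
Definition v0 (n : nat) (X : R) : R := sqrt (exp side * (X * X) - p0 n * p0 n).
(** Columns are spaced by [2 * side] and rows by [20], so boxes of width [side] and height [7] stay
    at distance at least [side] from each other. *)
Definition ncol (n : nat) (X : R) : nat := Z.to_nat (Int_part (Jlen n X / (2 * side))).
Definition nrow (X : R) : nat := Z.to_nat (Int_part (kap * X / 20)).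

(* A node is the reversed list of lower left corners of the boxes visited so far.  Boxes have
   height 7 > 2 pi, so that the image of a box under [Elam] contains a full annulus; the children
   lie in a rectangle around the point [(p0, v0)] of that annulus, where [p0] is in the next strip. *)
Definition ch (s : list (R * R)) : list (R * R) :=
  let n := length s in let X := nX s in
  map (fun ij => (Jlo n X + 2 * side * INR (fst ij), v0 n X + 20 * INR (snd ij)))
      (list_prod (seq 0 (ncol n X)) (seq 0 (nrow X))).

(* Dummy entries, chosen such that the modulus at time [k] is [a k] for [k <= n]. *)
Fixpoint root_node (n : nat) : list (R * R) :=
  match n with O => [] | S m => (strip_left m, 0) :: root_node m end.

Definition cell (c : R * R) (z : C) : Prop :=
  fst c <= fst z <= fst c + side /\ snd c <= snd z <= snd c + 7.

Hypothesis hlam : forall n, (1 <= n)%nat -> lam n <> (0, 0).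
Hypothesis hab : forall n, (1 <= n)%nat -> 0 < a n < b n.
Hypothesis hq : 0 < q < 1.
Hypothesis hD0 : 0 < D.
Hypothesis hD : forall n, (1 <= n)%nat -> D <= Delta_n a b n.
Hypothesis hN : (1 <= N)%nat.
Hypothesis hstrip : forall n, (N <= n)%nat ->
  a (S n) <= Cmod (lam (S n)) * exp (q * a n) /\
  Cmod (lam (S n)) * exp (- (q * a n)) <= b (S n).
Hypothesis hbig : forall n, (N <= n)%nat -> 160 / side <= a n.

Notation reach := (reach (R * R) ch).

Lemma side_bounds : 0 < side <= 1 / 2 /\ 2 * side <= D.
Proof.
  unfold side. pose proof (Rmin_l D 1). pose proof (Rmin_r D 1).
  assert (0 < Rmin D 1) by (apply Rmin_pos; lra). lra.
Qed.

Lemma length_droot n : length (root_node n) = n.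
Proof. induction n; simpl; auto. Qed.

Lemma Cmod_lam_pos n : (1 <= n)%nat -> 0 < Cmod (lam n).
Proof. intros Hn. apply Cmod_gt_0. now apply hlam. Qed.

Lemma Xv_sst k : Xv lam (S k) (strip_left k) = a (S k).
Proof.
  pose proof (Cmod_lam_pos (S k) ltac:(lia)). pose proof (hab (S k) ltac:(lia)).
  unfold Xv, strip_left. rewrite exp_ln by (apply Rdiv_lt_0_compat; lra). field. lra.
Qed.

Lemma Xv_sst_Delta k : Xv lam (S k) (strip_left k + Delta_n a b (S k)) = b (S k).
Proof.
  pose proof (Xv_sst k) as E. unfold Xv in *. rewrite exp_plus, <- Rmult_assoc, E.
  pose proof (hab (S k) ltac:(lia)). unfold Delta_n.
  rewrite exp_ln by (apply Rdiv_lt_0_compat; lra). field. lra.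
Qed.

Lemma Xv_le k u v : u <= v -> Xv lam k u <= Xv lam k v.
Proof. intros H. apply Rmult_le_compat_l; [apply Cmod_ge_0|now apply exp_le_compat]. Qed.

Lemma Xv_plus k u v : Xv lam k (u + v) = exp v * Xv lam k u.
Proof. unfold Xv. rewrite exp_plus. ring. Qed.

Lemma Int_part_nat r : 1 <= r -> (1 <= Z.to_nat (Int_part r))%nat /\
  r / 2 <= INR (Z.to_nat (Int_part r)) <= r.
Proof.
  intros Hr. pose proof (Int_part_bounds r).
  assert (1 <= Int_part r)%Z.
  { assert (0 < Int_part r)%Z by (apply lt_IZR; lra). lia. }
  rewrite INR_IZR_INZ, Z2Nat.id by lia. split; [lia|].
  apply IZR_le in H0. lra.
Qed.

(** Geometry of one step. The threshold $160/side$ enters as $kap\,X\ge20$, which here leaves room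
    for a column and in [ch_length] for a row. *)
Lemma strip_point n X : (N <= n)%nat -> a n <= X ->
  strip_left n <= p0 n <= strip_left n + Delta_n a b (S n) /\ Rabs (p0 n) <= X /\
  0 < Jlen n X <= Delta_n a b (S n) /\ Jlen n X <= kap * X /\ 2 * side <= Jlen n X /\
  strip_left n <= Jlo n X /\ Jlo n X <= p0 n <= Jlo n X + Jlen n X /\
  Jlo n X + Jlen n X <= strip_left n + Delta_n a b (S n).
Proof.
  intros Hn HX. destruct (hstrip n Hn) as [Ha Hb].
  pose proof (Cmod_lam_pos (S n) ltac:(lia)) as Hl. pose proof (hab (S n) ltac:(lia)) as Hab.
  pose proof (hab n ltac:(lia)) as Hab'. pose proof (hD (S n) ltac:(lia)) as HD'.
  pose proof side_bounds as [Hh1 Hh2]. pose proof (hbig n Hn) as Hbg.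
  set (Dl := Delta_n a b (S n)) in *.
  assert (Hs1 : strip_left n <= q * a n).
  { unfold strip_left. rewrite <- (ln_exp (q * a n)). apply ln_le_compat; [apply Rdiv_lt_0_compat; lra|].
    apply Rmult_le_reg_r with (Cmod (lam (S n))); auto. unfold Rdiv.
    rewrite Rmult_assoc, Rinv_l by lra. lra. }
  assert (Hs2 : - (q * a n) <= strip_left n + Dl).
  { assert (E : strip_left n + Dl = ln (b (S n) / Cmod (lam (S n)))).
    { unfold strip_left, Dl, Delta_n. rewrite <- ln_mult by (apply Rdiv_lt_0_compat; lra).
      f_equal. field. lra. }
    rewrite E. rewrite <- (ln_exp (- (q * a n))). apply ln_le_compat; [apply exp_pos|].
    apply Rmult_le_reg_r with (Cmod (lam (S n))); auto. unfold Rdiv.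
    rewrite Rmult_assoc, Rinv_l by lra. lra. }
  assert (HkX : 20 <= kap * X).
  { unfold kap. replace 20 with (side / 8 * (160 / side)) by (field; lra).
    apply Rmult_le_compat_l; lra. }
  assert (HqX : 0 <= q * a n <= X) by nra.
  unfold Jlo. unfold Jlen. fold Dl. unfold p0.
  assert (HL : 0 < Rmin Dl (kap * X) <= Dl /\ Rmin Dl (kap * X) <= kap * X /\ 2 * side <= Rmin Dl (kap * X)).
  { pose proof (Rmin_l Dl (kap * X)). pose proof (Rmin_r Dl (kap * X)).
    assert (2 * side <= Rmin Dl (kap * X)) by (apply Rmin_glb; lra). lra. }
  set (L := Rmin Dl (kap * X)) in *.
  assert (Hp : strip_left n <= Rmax (strip_left n) (- (q * a n)) <= strip_left n + Dl /\
    - (q * a n) <= Rmax (strip_left n) (- (q * a n)) <= q * a n).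
  { pose proof (Rmax_l (strip_left n) (- (q * a n))). pose proof (Rmax_r (strip_left n) (- (q * a n))).
    assert (Rmax (strip_left n) (- (q * a n)) <= strip_left n + Dl) by (apply Rmax_lub; lra).
    assert (Rmax (strip_left n) (- (q * a n)) <= q * a n) by (apply Rmax_lub; lra). lra. }
  set (P := Rmax (strip_left n) (- (q * a n))) in *.
  pose proof (Rmin_l P (strip_left n + Dl - L)). pose proof (Rmin_r P (strip_left n + Dl - L)).
  assert (strip_left n <= Rmin P (strip_left n + Dl - L)) by (apply Rmin_glb; lra).
  assert (P - L <= Rmin P (strip_left n + Dl - L)) by (apply Rmin_glb; lra).
  assert (Rabs P <= X) by (apply Rabs_le; lra).
  repeat split; lra.
Qed.

Lemma ch_In s c : In c (ch s) <-> exists i j, (i < ncol (length s) (nX s))%nat /\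
  (j < nrow (nX s))%nat /\
  c = (Jlo (length s) (nX s) + 2 * side * INR i, v0 (length s) (nX s) + 20 * INR j).
Proof.
  unfold ch. rewrite in_map_iff. split.
  - intros ([i j] & <- & H). apply in_prod_iff in H. rewrite !in_seq in H.
    exists i, j. simpl. repeat split; lia.
  - intros (i & j & Hi & Hj & ->). exists (i, j). split; auto.
    apply in_prod_iff. rewrite !in_seq. lia.
Qed.

Lemma ch_location s c : (N <= length s)%nat -> a (length s) <= nX s -> In c (ch s) ->
  Jlo (length s) (nX s) <= fst c /\ fst c + side <= Jlo (length s) (nX s) + Jlen (length s) (nX s) /\
  v0 (length s) (nX s) <= snd c /\ snd c + 7 <= v0 (length s) (nX s) + kap * nX s.
Proof.
  intros Hn HX Hc. apply ch_In in Hc. destruct Hc as (i & j & Hi & Hj & ->). simpl.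
  pose proof side_bounds as [Hh1 Hh2].
  destruct (strip_point _ _ Hn HX) as (_ & _ & HL & HLk & HL2 & _).
  pose proof (hbig _ Hn) as Hbg.
  set (n := length s) in *. set (X := nX s) in *.
  assert (HkX : 20 <= kap * X).
  { unfold kap. replace 20 with (side / 8 * (160 / side)) by (field; lra).
    apply Rmult_le_compat_l; lra. }
  destruct (Int_part_nat (Jlen n X / (2 * side))) as (_ & _ & C2).
  { apply Rmult_le_reg_r with (2 * side); [lra|]. unfold Rdiv. rewrite Rmult_assoc, Rinv_l by lra. lra. }
  destruct (Int_part_nat (kap * X / 20)) as (_ & _ & R2); [lra|].
  fold (ncol n X) in C2. fold (nrow X) in R2.
  apply Rmult_le_compat_r with (r := 2 * side) in C2; [|lra].
  replace (Jlen n X / (2 * side) * (2 * side)) with (Jlen n X) in C2 by (field; lra).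
  assert (INR i + 1 <= INR (ncol n X)) by (rewrite <- S_INR; apply le_INR; lia).
  assert (INR j + 1 <= INR (nrow X)) by (rewrite <- S_INR; apply le_INR; lia).
  pose proof (pos_INR i). pose proof (pos_INR j).
  assert ((INR i + 1) * (2 * side) <= INR (ncol n X) * (2 * side)) by (apply Rmult_le_compat_r; lra).
  assert (0 <= 2 * side * INR i) by (apply Rmult_le_pos; lra).
  repeat split; lra.
Qed.

Lemma nX_child s c : nX (c :: s) = Xv lam (S (length s)) (fst c).
Proof. unfold nX, hX. simpl. now rewrite length_map. Qed.

Lemma nX_droot n : nX (root_node (S n)) = a (S n).
Proof. simpl. rewrite nX_child, length_droot. apply Xv_sst. Qed.

(** [nX s] is the modulus on the image of the left edge of the head box, whose image is the annulus
    of ratio $e^{side}$ above it. The invariant places this entire annulus in the prescribed one. *)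
Lemma node_X s : reach (root_node N) s ->
  (N <= length s)%nat /\ a (length s) <= nX s /\ exp side * nX s <= b (length s).
Proof.
  pose proof side_bounds as [Hh1 Hh2].
  induction 1 as [|s c Hs IH Hc].
  - rewrite length_droot. split; [lia|].
    assert (HN : exists n, N = S n) by (exists (N - 1)%nat; lia). destruct HN as [n HN].
    rewrite HN, nX_droot. split; [lra|]. rewrite <- (Xv_sst n), <- Xv_plus, <- (Xv_sst_Delta n).
    apply Xv_le. pose proof (hD (S n) ltac:(lia)). lra.
  - destruct IH as (I1 & I2 & I3). simpl length. split; [lia|].
    destruct (ch_location s c I1 I2 Hc) as (C1 & C2 & _).
    destruct (strip_point _ _ I1 I2) as (_ & _ & _ & _ & _ & J1 & _ & J3).
    rewrite nX_child. split.
    + rewrite <- (Xv_sst (length s)). apply Xv_le. lra.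
    + rewrite <- Xv_plus, <- (Xv_sst_Delta (length s)). apply Xv_le. lra.
Qed.

(** A point of a child is within $X\,side/2$ of $p_0+iv_0$, and $e^{side/2}\ge1+side/2$ leaves that
    much room on either side of the middle circle. *)
Lemma cell_annulus s c z : (N <= length s)%nat -> a (length s) <= nX s -> In c (ch s) ->
  cell c z -> nX s <= Cmod z <= exp side * nX s.
Proof.
  intros Hn HX Hc [Hz1 Hz2].
  destruct (ch_location s c Hn HX Hc) as (C1 & C2 & C3 & C4).
  destruct (strip_point _ _ Hn HX) as (_ & Hp & HL & HLk & _ & _ & J2 & _).
  pose proof side_bounds as [Hh1 Hh2]. pose proof (hab _ (Nat.le_trans _ _ _ hN Hn)) as Hab.
  set (n := length s) in *. set (X := nX s) in *.
  set (z0 := (p0 n, v0 n X) : C).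
  assert (He : 1 + side / 2 <= exp (side / 2)) by apply exp_ineq1_le.
  assert (Ee : exp side = exp (side / 2) * exp (side / 2)) by (rewrite <- exp_plus; f_equal; field).
  set (E := exp (side / 2)) in *.
  assert (Hz0 : Cmod z0 = E * X).
  { apply Rsqr_inj; [apply Cmod_ge_0|nra|]. unfold Rsqr. rewrite Cmod_sqr. simpl. unfold v0.
    rewrite sqrt_sqrt; [rewrite Ee; ring|].
    assert (p0 n * p0 n <= X * X).
    { apply Rabs_le_between in Hp. nra. }
    rewrite Ee. assert (1 <= E * E) by nra. assert (0 <= X * X) by nra. nra. }
  assert (Hd : Cmod (Cminus z z0) <= side / 2 * X).
  { eapply Rle_trans; [apply Cmod_le_sum|].
    assert (Rabs (fst (Cminus z z0)) <= kap * X) by (apply Rabs_le; simpl; lra).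
    assert (Rabs (snd (Cminus z z0)) <= kap * X) by (apply Rabs_le; simpl; lra).
    unfold kap in *. assert (0 <= side * X) by nra. lra. }
  assert (T1 : Cmod z <= Cmod (Cminus z z0) + Cmod z0).
  { replace z with (Cplus (Cminus z z0) z0) at 1 by ring. apply Cmod_triangle. }
  assert (T2 : Cmod z0 <= Cmod (Cminus z z0) + Cmod z).
  { rewrite Cmod_dist_sym. replace z0 with (Cplus (Cminus z0 z) z) at 1 by ring. apply Cmod_triangle. }
  rewrite Hz0 in *. rewrite Ee.
  assert ((1 + side / 2) * X <= E * X) by (apply Rmult_le_compat_r; lra).
  assert (E * (1 + side / 2) * X <= E * E * X).
  { apply Rmult_le_compat_r; [lra|]. apply Rmult_le_compat_l; lra. }
  assert (1 * (side / 2 * X) <= E * (side / 2 * X)) by (apply Rmult_le_compat_r; nra).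
  split; lra.
Qed.

Lemma ch_separated s c c' : In c (ch s) -> In c' (ch s) ->
  (fst c = fst c' \/ 2 * side <= Rabs (fst c - fst c')) /\
  (snd c = snd c' \/ 20 <= Rabs (snd c - snd c')).
Proof.
  intros Hc Hc'. apply ch_In in Hc, Hc'.
  destruct Hc as (i & j & _ & _ & ->), Hc' as (i' & j' & _ & _ & ->). simpl.
  pose proof side_bounds as [Hh1 Hh2].
  assert (H : forall k k', k = k' \/ 1 <= Rabs (INR k - INR k')).
  { intros k k'. destruct (Nat.lt_trichotomy k k') as [H|[H|H]]; auto; right.
    - rewrite Rabs_minus_sym. apply le_INR in H. rewrite S_INR in H.
      rewrite Rabs_pos_eq; lra.
    - apply le_INR in H. rewrite S_INR in H. rewrite Rabs_pos_eq; lra. }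
  split.
  - destruct (H i i') as [->|Hi]; [now left|right].
    replace (Jlo (length s) (nX s) + 2 * side * INR i - (Jlo (length s) (nX s) + 2 * side * INR i'))
      with (2 * side * (INR i - INR i')) by ring.
    rewrite Rabs_mult, (Rabs_pos_eq (2 * side)) by lra. nra.
  - destruct (H j j') as [->|Hi]; [now left|right].
    replace (v0 (length s) (nX s) + 20 * INR j - (v0 (length s) (nX s) + 20 * INR j'))
      with (20 * (INR j - INR j')) by ring.
    rewrite Rabs_mult, (Rabs_pos_eq 20) by lra. lra.
Qed.

Lemma cells_far s c c' z w : In c (ch s) -> In c' (ch s) -> c <> c' -> cell c z -> cell c' w ->
  side <= Cmod (Cminus z w).
Proof.
  intros Hc Hc' Hne [Z1 Z2] [W1 W2]. destruct (ch_separated s c c' Hc Hc') as [H1 H2].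
  pose proof side_bounds as [Hh1 Hh2].
  pose proof (Rabs_fst_le (Cminus z w)) as F1. pose proof (Rabs_snd_le (Cminus z w)) as F2.
  simpl in F1, F2.
  destruct c as [u v], c' as [u' v']; simpl in *.
  destruct H1 as [->|H1].
  - destruct H2 as [->|H2]; [congruence|]. eapply Rle_trans; [|exact F2].
    unfold Rabs in *. destruct (Rcase_abs (v - v')), (Rcase_abs (snd z + - snd w)); lra.
  - eapply Rle_trans; [|exact F1].
    unfold Rabs in *. destruct (Rcase_abs (u - u')), (Rcase_abs (fst z + - fst w)); lra.
Qed.

Lemma ch_NoDup s : NoDup (ch s).
Proof.
  pose proof side_bounds as [Hh1 Hh2].
  unfold ch. apply NoDup_map_NoDup_ForallPairs.
  - intros [i j] [i' j'] _ _ H. simpl in H. injection H as H1 H2.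
    f_equal; apply INR_eq; [|lra].
    apply Rmult_eq_reg_l with (2 * side); lra.
  - apply NoDup_list_prod; apply seq_NoDup.
Qed.

Lemma nW_eq s : nW s = Rmin (Delta_n a b (S (length s))) (nX s).
Proof. unfold nW, hW, Wv, nX, hX. now rewrite length_map. Qed.

(** Integer parts of numbers at least $1$ lose at most a factor $2$ each, and [Jlen] is at least
    [kap * nW]; this gives the constant. *)
Lemma ch_length s : (N <= length s)%nat -> a (length s) <= nX s ->
  kap * kap / (160 * side) * (nW s * nX s) <= INR (length (ch s)) /\ ch s <> [].
Proof.
  intros Hn HX. pose proof side_bounds as [Hh1 Hh2].
  destruct (strip_point _ _ Hn HX) as (_ & _ & HL & HLk & HL2 & _).
  pose proof (hbig _ Hn) as Hbg.
  assert (El : length (ch s) = (ncol (length s) (nX s) * nrow (nX s))%nat).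
  { unfold ch. rewrite length_map, length_prod, !length_seq. reflexivity. }
  rewrite nW_eq. set (n := length s) in *. set (X := nX s) in *.
  assert (HkX : 20 <= kap * X).
  { unfold kap. replace 20 with (side / 8 * (160 / side)) by (field; lra).
    apply Rmult_le_compat_l; lra. }
  destruct (Int_part_nat (Jlen n X / (2 * side))) as (C0 & C1 & _).
  { apply Rmult_le_reg_r with (2 * side); [lra|]. unfold Rdiv. rewrite Rmult_assoc, Rinv_l by lra. lra. }
  destruct (Int_part_nat (kap * X / 20)) as (R0 & R1 & _); [lra|].
  fold (ncol n X) in C0, C1. fold (nrow X) in R0, R1.
  split.
  - rewrite El, mult_INR.
    assert (Hk : 0 < kap <= 1) by (unfold kap; lra).
    assert (HXpos : 0 < X) by nra.
    assert (HLW : kap * Rmin (Delta_n a b (S n)) X <= Jlen n X).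
    { unfold Jlen. apply Rmin_glb.
      - pose proof (Rmin_l (Delta_n a b (S n)) X).
        assert (0 < Rmin (Delta_n a b (S n)) X) by (apply Rmin_pos; lra). nra.
      - apply Rmult_le_compat_l; [lra|apply Rmin_r]. }
    apply Rle_trans with (Jlen n X / (2 * side) / 2 * (kap * X / 20 / 2)).
    + replace (kap * kap / (160 * side) * (Rmin (Delta_n a b (S n)) X * X)) with
        ((kap * Rmin (Delta_n a b (S n)) X) * (kap * X) * / (160 * side)) by (field; lra).
      replace (Jlen n X / (2 * side) / 2 * (kap * X / 20 / 2)) with
        (Jlen n X * (kap * X) * / (160 * side)) by (field; lra).
      apply Rmult_le_compat_r; [left; apply Rinv_0_lt_compat; lra|].
      apply Rmult_le_compat_r; lra.
    + assert (0 <= Jlen n X / (2 * side)) by (apply Rlt_le, Rdiv_lt_0_compat; lra).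
      apply Rmult_le_compat; lra.
  - intros E. rewrite E in El. simpl in El. nia.
Qed.

Notation path c := (is_path (R * R) ch (root_node N) c).
Notation nLX s := (LX lam (map fst s)).
Notation nLW s := (LW lam a b (map fst s)).

(** The modulus at time [k] is read off the left edge of the box visited at time [k - 1]. *)
Definition xc (c : nat -> R * R) (k : nat) : R := Xv lam k (fst (c (k - 1)%nat)).

Lemma nX_pfx c k : nX (pfx c (S k)) = xc c (S k).
Proof.
  simpl. rewrite nX_child, length_pfx. unfold xc. now rewrite Nat.sub_succ, Nat.sub_0_r.
Qed.

Lemma pfx_droot c n : pfx c n = root_node n -> forall k, (k < n)%nat -> c k = (strip_left k, 0).
Proof.
  induction n as [|n IH]; intros H k Hk; [lia|]. simpl in H. injection H as H1 H2.
  destruct (Nat.eq_dec k n) as [->|]; auto. apply IH; auto. lia.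
Qed.

Lemma path_X c k : path c -> (1 <= k)%nat -> a k <= xc c k <= b k.
Proof.
  intros Hc Hk. destruct k as [|k]; [lia|].
  destruct (Nat.le_gt_cases N (S k)) as [H|H].
  - assert (Hr : reach (root_node N) (pfx c (S k))).
    { apply reach_pfx; auto. now rewrite length_droot. }
    destruct (node_X _ Hr) as (_ & H1 & H2). rewrite length_pfx, nX_pfx in *.
    split; auto. pose proof side_bounds as [Hh1 Hh2]. pose proof (exp_ineq1_le side).
    pose proof (hab (S k) Hk). nra.
  - destruct Hc as [Hc _]. rewrite length_droot in Hc. unfold xc.
    rewrite (pfx_droot c N Hc) by lia. simpl. rewrite Nat.sub_0_r, Xv_sst.
    pose proof (hab (S k) Hk). lra.
Qed.

Lemma path_lw_pos c k : path c -> (1 <= k)%nat -> 0 < lw a b (xc c) k.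
Proof.
  intros Hc Hk. pose proof (path_X c k Hc Hk). pose proof (hab k Hk). pose proof (hD (S k) ltac:(lia)).
  apply Rmin_pos; lra.
Qed.

Lemma path_LX c n : path c -> nLX (pfx c n) = ln (prod1 (xc c) n).
Proof.
  intros Hc. assert (Hp : forall k, (1 <= k)%nat -> 0 < xc c k).
  { intros k Hk. pose proof (path_X c k Hc Hk). pose proof (hab k Hk). lra. }
  induction n as [|n IH]; [simpl; now rewrite ln_1|].
  rewrite ln_prod1_S by auto. simpl. rewrite IH, length_map, length_pfx. unfold xc.
  replace (S n - 1)%nat with n by lia. ring.
Qed.

Lemma path_LW c n : path c -> nLW (pfx c n) = ln (prod1 (lw a b (xc c)) n).
Proof.
  intros Hc. induction n as [|n IH]; [simpl; now rewrite ln_1|].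
  rewrite ln_prod1_S by (intros; now apply path_lw_pos).
  simpl. rewrite IH, length_map, length_pfx. unfold lw, xc, Wv.
  replace (S n - 1)%nat with n by lia. ring.
Qed.

(** * Orbits that follow a path *)

Definition follows (c : nat -> R * R) (z : C) : Prop :=
  forall k, (N <= k)%nat -> cell (c k) (Eiter lam k z).

Lemma follows_annulus c z k : path c -> follows c z -> (N <= k)%nat ->
  nX (pfx c k) <= Cmod (Eiter lam k z) <= exp side * nX (pfx c k).
Proof.
  intros Hc Hz Hk.
  assert (Hr : reach (root_node N) (pfx c k)).
  { apply reach_pfx; auto. now rewrite length_droot. }
  destruct (node_X _ Hr) as (_ & H1 & H2). rewrite length_pfx in *.
  apply cell_annulus with (c k); rewrite ?length_pfx; auto.
  apply Hc. now rewrite length_droot.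
Qed.

Lemma follows_Iab c z : path c -> follows c z -> Iab lam a b z.
Proof.
  intros Hc Hz. exists N. intros k Hk. pose proof (follows_annulus c z k Hc Hz Hk).
  assert (Hr : reach (root_node N) (pfx c k)).
  { apply reach_pfx; auto. now rewrite length_droot. }
  destruct (node_X _ Hr) as (_ & H1 & H2). rewrite length_pfx in *. lra.
Qed.

Lemma two_exp_hh : 2 * exp side <= exp 2.
Proof.
  pose proof side_bounds as [Hh1 Hh2]. pose proof (exp_ineq1_le 1).
  replace 2 with (1 + 1) at 2 by ring. rewrite exp_plus.
  pose proof (exp_pos side). assert (exp side <= exp 1) by (apply exp_le_compat; lra). nra.
Qed.

(** Upper counterpart of [rcode_contraction]: on a box of width [side] one step expands by at most
    $2e^{side}\le e^2$ times the modulus belonging to its left edge. *)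
Lemma follows_lip c c' z w k : path c -> path c' -> follows c z -> follows c' w ->
  (N <= k)%nat -> pfx c k = pfx c' k ->
  Cmod (Cminus (Eiter lam k z) (Eiter lam k w)) <=
  exp (2 * INR k + nLX (pfx c k) - nLX (root_node N)) *
  Cmod (Cminus (Eiter lam N z) (Eiter lam N w)).
Proof.
  intros Hc Hc' Hz Hw Hk. induction k as [|k IH]; intros E; [lia|].
  destruct (Nat.eq_dec (S k) N) as [EN|EN].
  - rewrite EN. replace (pfx c N) with (root_node N).
    2:{ destruct Hc as [Hc _]. now rewrite length_droot in Hc. }
    rewrite <- (Rmult_1_l (Cmod _)) at 1. apply Rmult_le_compat_r; [apply Cmod_ge_0|].
    rewrite <- exp_0. apply exp_le_compat. pose proof (pos_INR N). lra.
  - simpl in E. injection E as E1 E2. specialize (IH ltac:(lia) E2).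
    destruct (Hz k ltac:(lia)) as [Z1 _]. destruct (Hw k ltac:(lia)) as [W1 _]. rewrite <- E1 in W1.
    simpl Eiter.
    eapply Rle_trans; [apply (Elam_lip _ _ _ (fst (c k) + side)); lra|].
    assert (HX : 0 < xc c (S k)).
    { pose proof (path_X c (S k) Hc ltac:(lia)). pose proof (hab (S k) ltac:(lia)). lra. }
    rewrite Rmult_assoc, Rmult_assoc, <- (Rmult_assoc (Cmod (lam (S k)))).
    fold (Xv lam (S k) (fst (c k) + side)). rewrite Xv_plus.
    change (map fst (pfx c (S k))) with (fst (c k) :: map fst (pfx c k)).
    simpl LX. rewrite length_map, length_pfx.
    assert (Ex : xc c (S k) = Xv lam (S k) (fst (c k))).
    { unfold xc. now replace (S k - 1)%nat with k by lia. }
    rewrite <- Ex, S_INR.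
    replace (2 * (INR k + 1) + (ln (xc c (S k)) + nLX (pfx c k)) - nLX (root_node N)) with
      (2 + ln (xc c (S k)) + (2 * INR k + nLX (pfx c k) - nLX (root_node N))) by ring.
    rewrite exp_plus, (exp_plus 2), exp_ln by auto.
    set (Dk := Cmod (Cminus (Eiter lam k z) (Eiter lam k w))) in *.
    set (DN := Cmod (Cminus (Eiter lam N z) (Eiter lam N w))) in *.
    pose proof two_exp_hh as H2.
    replace (2 * (exp side * xc c (S k) * Dk)) with (2 * exp side * xc c (S k) * Dk) by ring.
    rewrite (Rmult_assoc (exp 2 * xc c (S k))).
    apply Rmult_le_compat; auto.
    + pose proof (exp_pos side). nra.
    + apply Cmod_ge_0.
    + apply Rmult_le_compat_r; lra.
Qed.

(** A point of the [(N + j)]-th box is pulled back through the earlier boxes, since each box covers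
    the annulus containing the next one, and then to time [0] with a bound common to all paths. An
    accumulation point of these starting points follows the entire path because boxes are closed. *)
Lemma follows_exists : exists G, forall c, path c -> exists z, Cmod z <= G /\ follows c z.
Proof.
  pose proof (hab N hN) as HaN.
  destruct (Eiter_preimage lam N hlam (a N) (exp side * a N)) as [G HG]; [lra|].
  exists G. intros c Hc.
  assert (Hcr : forall k, (N <= k)%nat -> In (c k) (ch (pfx c k)) /\
     a k <= nX (pfx c k)).
  { intros k Hk. split.
    - apply Hc. now rewrite length_droot.
    - assert (Hr : reach (root_node N) (pfx c k)).
      { apply reach_pfx; auto. now rewrite length_droot. }
      destruct (node_X _ Hr) as (_ & H1 & H2). now rewrite length_pfx in *. }
  assert (Hann : forall k y, (N <= k)%nat -> cell (c k) y -> nX (pfx c k) <= Cmod y <= exp side * nX (pfx c k)).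
  { intros k y Hk Hy. destruct (Hcr k Hk). apply cell_annulus with (c k); rewrite ?length_pfx; auto. }
  assert (Hfin : forall j y, cell (c (N + j)%nat) y -> exists z, Cmod z <= G /\
    Eiter lam (N + j) z = y /\ forall k, (N <= k <= N + j)%nat -> cell (c k) (Eiter lam k z)).
  { induction j as [|j IH]; intros y Hy.
    - rewrite Nat.add_0_r in *. pose proof (Hann N y ltac:(lia) Hy) as Hy2.
      replace (nX (pfx c N)) with (a N) in Hy2.
      2:{ destruct Hc as [Hc _]. rewrite length_droot in Hc. rewrite Hc.
          assert (HN : exists n, N = S n) by (exists (N - 1)%nat; lia). destruct HN as [n HN].
          rewrite HN. symmetry. apply nX_droot. }
      destruct (HG y Hy2) as (z & Hz & Ez). exists z. split; auto. split; auto.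
      intros k Hk. replace k with N by lia. now rewrite Ez.
    - replace (N + S j)%nat with (S (N + j)) in * by lia.
      pose proof (Hann (S (N + j)) y ltac:(lia) Hy) as Hy2. rewrite nX_pfx in Hy2.
      pose proof (path_X c (S (N + j)) Hc ltac:(lia)) as HX. pose proof (hab (S (N + j)) ltac:(lia)) as Hab.
      pose proof (Cmod_lam_pos (S (N + j)) ltac:(lia)) as Hl.
      assert (Ex : xc c (S (N + j)) = Xv lam (S (N + j)) (fst (c (N + j)%nat))).
      { unfold xc. now replace (S (N + j) - 1)%nat with (N + j)%nat by lia. }
      destruct (Elam_preimage (lam (S (N + j))) y (snd (c (N + j)%nat))) as (y' & E & Hf & Hs).
      { apply hlam; lia. }
      { intros ->. rewrite Cmod_0 in Hy2. lra. }
      destruct (IH y') as (z & Hz & Ez & Hk).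
      + split; auto. rewrite Hf. rewrite Ex in Hy2. unfold Xv in Hy2.
        set (u := fst (c (N + j)%nat)) in *. set (L := Cmod (lam (S (N + j)))) in *.
        assert (Hu : exp u <= Cmod y / L <= exp side * exp u).
        { split; apply Rmult_le_reg_r with L; auto; unfold Rdiv;
          rewrite ?Rmult_assoc, ?Rinv_l by lra; lra. }
        rewrite <- exp_plus in Hu. pose proof (exp_pos u).
        split.
        * rewrite <- (ln_exp u). apply ln_le_compat; lra.
        * rewrite <- (ln_exp (u + side)), (Rplus_comm u). apply ln_le_compat; lra.
      + exists z. split; auto. split; [simpl; now rewrite Ez|].
        intros k Hk2. destruct (Nat.eq_dec k (S (N + j))) as [->|].
        * simpl. now rewrite Ez, E.
        * apply Hk. lia. }
  assert (Hseq : forall j, exists z, Cmod z <= G /\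
    forall k, (N <= k <= N + j)%nat -> cell (c k) (Eiter lam k z)).
  { intros j. pose proof side_bounds as [Hh1 Hh2].
    destruct (Hfin j (c (N + j)%nat)) as (z & H1 & _ & H2).
    - split; lra.
    - exists z. auto. }
  apply choice in Hseq. destruct Hseq as [u Hu].
  destruct (cluster_C u G) as [z Hz]; [intros n; apply Hu|].
  assert (HzG : Cmod z <= G).
  { apply le_epsilon. intros e He. destruct (Hz e 0%nat He) as (n & _ & Hn).
    destruct (Hu n) as [Hu1 _].
    assert (Cmod z <= Cmod (Cminus (u n) z) + Cmod (u n)).
    { rewrite Cmod_dist_sym. replace z with (Cplus (Cminus z (u n)) (u n)) at 1 by ring. apply Cmod_triangle. }
    lra. }
  exists z. split; auto. intros k Hk.
  destruct (Eiter_lip lam G k) as (L & HL & Hlip).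
  assert (Happ : forall e, 0 < e -> exists y, cell (c k) y /\ Cmod (Cminus y (Eiter lam k z)) <= e).
  { intros e He. destruct (Hz (e / L) (k - N)%nat) as (n & Hn & Hnz); [now apply Rdiv_lt_0_compat|].
    destruct (Hu n) as [Hu1 Hu2]. exists (Eiter lam k (u n)). split; [apply Hu2; lia|].
    eapply Rle_trans; [apply Hlip; auto|].
    apply Rle_trans with (L * (e / L)); [apply Rmult_le_compat_l; lra|]. right; field; lra. }
  assert (Hc' : forall e, 0 < e -> fst (c k) <= fst (Eiter lam k z) + e /\
     fst (Eiter lam k z) <= fst (c k) + side + e /\
     snd (c k) <= snd (Eiter lam k z) + e /\ snd (Eiter lam k z) <= snd (c k) + 7 + e).
  { intros e He. destruct (Happ e He) as (y & [Y1 Y2] & Hy).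
    pose proof (Rabs_fst_le (Cminus y (Eiter lam k z))) as F1.
    pose proof (Rabs_snd_le (Cminus y (Eiter lam k z))) as F2. simpl in F1, F2.
    pose proof (Rle_trans _ _ _ F1 Hy) as F1'. pose proof (Rle_trans _ _ _ F2 Hy) as F2'.
    apply Rabs_le_between in F1', F2'. lra. }
  repeat split; apply le_epsilon; intros e He; destruct (Hc' e He) as (H1 & H2 & H3 & H4); lra.
Qed.

Lemma nLX_tl s : reach (root_node N) s -> nLX s = ln (nX s) + nLX (tl s) /\
  nLW s = ln (nW s) + nLW (tl s).
Proof.
  intros H. destruct (node_X s H) as (Hl & _). destruct s as [|x s]; [simpl in Hl; lia|].
  split; reflexivity.
Qed.

(** * Masses of nodes and of balls *)

Notation mass := (mass (R * R) ch).

(** Every generation divides the mass by at least a constant times $w_kx_k$. The modulus read off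
    the head belongs to a division not yet made, hence the tails. *)
Lemma mass_bound : exists K B, 0 <= K /\ forall s, reach (root_node N) s ->
  ln (mass s) <= K * INR (length s) + B - (nLX (tl s) + nLW (tl s)).
Proof.
  pose proof side_bounds as [Hh1 Hh2].
  set (c1 := kap * kap / (160 * side)).
  assert (Hk : 0 < kap) by (unfold kap; lra).
  assert (Hc1 : 0 < c1) by (apply Rdiv_lt_0_compat; nra).
  exists (Rabs (ln c1)), (ln (mass (root_node N)) + (nLX (tl (root_node N)) + nLW (tl (root_node N)))).
  split; [apply Rabs_pos|]. intros s Hs.
  induction Hs as [|s c Hs IH Hc].
  - pose proof (Rmult_le_pos _ _ (Rabs_pos (ln c1)) (pos_INR (length (root_node N)))). lra.
  - destruct (node_X s Hs) as (N1 & N2 & _). destruct (ch_length s N1 N2) as [C1 C2].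
    destruct (nLX_tl s Hs) as [E1 E2]. simpl tl.
    change (mass (c :: s)) with (mass s * wt (R * R) ch s).
    pose proof (mass_pos (R * R) ch s) as Hm. pose proof (wt_bounds (R * R) ch s) as [Hw _].
    rewrite ln_mult by auto. change (length (c :: s)) with (S (length s)). rewrite S_INR.
    assert (HX : 0 < nX s) by (pose proof (hab (length s) ltac:(lia)); lra).
    assert (HW : 0 < nW s).
    { rewrite nW_eq. pose proof (hD (S (length s)) ltac:(lia)). apply Rmin_pos; lra. }
    assert (Hwt : ln (wt (R * R) ch s) <= - (ln c1 + (ln (nW s) + ln (nX s)))).
    { unfold wt. rewrite ln_Rinv by (apply lt_0_INR; lia). apply Ropp_le_contravar.
      rewrite <- !ln_mult; try auto; try (apply Rmult_lt_0_compat; auto).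
      apply ln_le_compat; [apply Rmult_lt_0_compat; auto; apply Rmult_lt_0_compat; auto|].
      fold c1 in C1. eapply Rle_trans; [exact C1|]. apply le_INR. lia. }
    pose proof (Rle_abs (- ln c1)). rewrite Rabs_Ropp in H. lra.
Qed.

Hypothesis hb : superlinear a.

Lemma nLX_tl_ge s : reach (root_node N) s -> ln (prod1 a (length s - 1)) <= nLX (tl s).
Proof.
  assert (Hpa : forall k, (1 <= k)%nat -> 0 < a k) by (intros; now apply hab).
  assert (Hd : forall n, nLX (root_node n) = ln (prod1 a n)).
  { induction n as [|n IH]; [simpl; now rewrite ln_1|]. rewrite ln_prod1_S by auto.
    simpl. rewrite length_map, length_droot, Xv_sst, IH. ring. }
  assert (Hge : forall s, reach (root_node N) s -> ln (prod1 a (length s)) <= nLX s).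
  { induction 1 as [|u c Hu IH Hc]; [rewrite length_droot, Hd; lra|].
    pose proof (reach_step _ _ _ _ _ Hu Hc) as Hr.
    destruct (node_X _ Hr) as (_ & H1 & _). destruct (nLX_tl _ Hr) as [E _]. rewrite E.
    change (length (c :: u)) with (S (length u)) in *. rewrite ln_prod1_S by auto.
    apply ln_le_compat in H1; [|apply hab; lia]. simpl tl. lra. }
  intros H. destruct H as [|u c Hu Hc].
  - assert (HN : exists n, N = S n) by (exists (N - 1)%nat; lia). destruct HN as [n HN].
    rewrite HN, length_droot. simpl tl. rewrite Hd. replace (S n - 1)%nat with n by lia. lra.
  - change (length (c :: u)) with (S (length u)). simpl tl.
    replace (S (length u) - 1)%nat with (length u) by lia. auto.
Qed.

(** Combines the bound between times [N] and [k] with a Lipschitz constant of the first [N]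
    iterates; the restriction to the disc of radius [G] makes [Lc] common to all paths. *)
Lemma follows_dist : exists G Lc, 0 < Lc /\
  (forall c, path c -> exists z, Cmod z <= G /\ follows c z) /\
  (forall c c' z w k, path c -> path c' -> follows c z -> follows c' w ->
     Cmod z <= G -> Cmod w <= G -> (N <= k)%nat -> pfx c k = pfx c' k ->
     Cmod (Cminus (Eiter lam k z) (Eiter lam k w)) <=
     Lc * exp (2 * INR k + nLX (pfx c k)) * Cmod (Cminus z w)).
Proof.
  destruct follows_exists as [G HG]. destruct (Eiter_lip lam G N) as (L & HL & Hlip).
  exists G, (L * exp (- nLX (root_node N))). split; [apply Rmult_lt_0_compat; [auto|apply exp_pos]|].
  split; auto. intros c c' z w k Hc Hc' Hz Hw Gz Gw Hk E.
  eapply Rle_trans; [apply (follows_lip c c'); auto|].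
  unfold Rminus. rewrite exp_plus.
  replace (L * exp (- nLX (root_node N)) * exp (2 * INR k + nLX (pfx c k)) * Cmod (Cminus z w)) with
    (exp (2 * INR k + nLX (pfx c k)) * exp (- nLX (root_node N)) * (L * Cmod (Cminus z w))) by ring.
  apply Rmult_le_compat_l; auto. left. apply Rmult_lt_0_compat; apply exp_pos.
Qed.

Lemma node_pos s : reach (root_node N) s -> 1 <= nX s /\ 0 < nW s <= nX s.
Proof.
  intros Hs. destruct (node_X s Hs) as (H1 & H2 & _). pose proof side_bounds as [Hh1 Hh2].
  pose proof (hbig _ H1). rewrite nW_eq. pose proof (hD (S (length s)) ltac:(lia)).
  assert (1 <= 160 / side).
  { apply Rmult_le_reg_r with side; [lra|]. unfold Rdiv. rewrite Rmult_assoc, Rinv_l by lra. lra. }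
  split; [lra|]. split; [apply Rmin_pos; lra|apply Rmin_r].
Qed.

(** A window of size $\rho$ meets at most a multiple of $\rho$ rows, and columns only across a width
    of order $\min(\rho,W)$, as all of them lie in an interval of length at most [nW]. *)
Lemma children_count s S0 rho : reach (root_node N) s -> NoDup S0 -> incl S0 (ch s) -> side <= rho ->
  (forall c c', In c S0 -> In c' S0 -> Rabs (fst c - fst c') <= rho + side /\ Rabs (snd c - snd c') <= rho + 7) ->
  INR (length S0) <= 25 / (side * side) * (rho * Rmin rho (nW s)).
Proof.
  intros Hs Hnd Hincl HR Hclose.
  destruct (node_X s Hs) as (Hn & HX & _). pose proof side_bounds as [Hh1 Hh2].
  destruct (strip_point _ _ Hn HX) as (_ & _ & HL & HLk & HL2 & _).
  destruct (node_pos s Hs) as [HX1 HW].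
  set (L := Jlen (length s) (nX s)) in *.
  assert (HLW : L <= nW s).
  { rewrite nW_eq. apply Rmin_glb; [lra|]. unfold kap in HLk. nra. }
  set (cu := Rmin (rho + side) L).
  assert (Hcu0 : 0 < cu) by (apply Rmin_pos; lra).
  assert (E : INR (length S0) = lsum (fun c => if decide (In c S0) then 1 else 0) S0).
  { rewrite (lsum_ext _ (fun _ => 1)); [rewrite lsum_const; ring|].
    intros x Hx. destruct decide; [auto|contradiction]. }
  rewrite E.
  set (vc := 1 * (2 * ((rho + 7) / 20 + 1) + 1)).
  assert (Hvc : 0 <= vc) by (unfold vc; lra).
  assert (HSB : SB (fun c => if decide (In c S0) then 1 else 0)
    (vc * (2 * (cu / (2 * side) + 1) + 1))).
  { set (Pu := fun u => exists v, In (u, v) S0).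
    apply SB_pair with (fun u => if decide (Pu u) then vc else 0).
    - intros u. destruct decide as [Hu|Hu].
      + apply SB_separated with (fun v => In (u, v) S0); try lra.
        * intros v v' Hv Hv'. split.
          -- destruct (ch_separated s _ _ (Hincl _ Hv) (Hincl _ Hv')) as [_ H]. exact H.
          -- destruct (Hclose _ _ Hv Hv') as [_ H]. exact H.
        * intros v Hv. destruct decide; lra.
        * intros v Hv. destruct decide; [contradiction|lra].
      + apply SB_zero; [|lra]. intros v. destruct decide as [H|]; auto.
        exfalso. apply Hu. now exists v.
    - apply SB_separated with Pu; try lra.
      + intros u u' (v & Hv) (v' & Hv'). split.
        * destruct (ch_separated s _ _ (Hincl _ Hv) (Hincl _ Hv')) as [H _]. exact H.
        * apply Rmin_glb.
          -- destruct (Hclose _ _ Hv Hv') as [H _]. exact H.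
          -- destruct (ch_location s _ Hn HX (Hincl _ Hv)) as (A1 & A2 & _).
             destruct (ch_location s _ Hn HX (Hincl _ Hv')) as (B1 & B2 & _).
             simpl in *. fold L in A2, B2. apply Rabs_le. lra.
      + intros u Hu. destruct decide; [lra|contradiction].
      + intros u Hu. destruct decide; [contradiction|lra]. }
  eapply Rle_trans; [apply (HSB S0 Hnd)|].
  assert (Hm : side <= Rmin rho (nW s)) by (apply Rmin_glb; lra).
  assert (Hih : 0 < / side) by (apply Rinv_0_lt_compat; lra).
  assert (Hi1 : side * / side = 1) by (apply Rinv_r; lra).
  assert (V1 : vc <= 5 * (rho * / side)).
  { assert (1 <= rho * / side) by (rewrite <- Hi1; apply Rmult_le_compat_r; lra).
    assert (rho <= rho * / side) by (rewrite <- (Rmult_1_r rho) at 1; apply Rmult_le_compat_l; nra).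
    unfold vc. lra. }
  assert (V2 : 2 * (cu / (2 * side) + 1) + 1 <= 5 * (Rmin rho (nW s) * / side)).
  { assert (Hc2 : cu <= 2 * Rmin rho (nW s)).
    { unfold cu. unfold Rmin. destruct (Rle_dec rho (nW s)), (Rle_dec (rho + side) L); lra. }
    assert (1 <= Rmin rho (nW s) * / side) by (rewrite <- Hi1; apply Rmult_le_compat_r; lra).
    assert (cu * / side <= 2 * Rmin rho (nW s) * / side) by (apply Rmult_le_compat_r; lra).
    replace (cu / (2 * side)) with (cu * / side / 2) by (field; lra). lra. }
  replace (25 / (side * side) * (rho * Rmin rho (nW s))) with
    (5 * (rho * / side) * (5 * (Rmin rho (nW s) * / side))) by (field; lra).
  apply Rmult_le_compat; try lra.
  assert (0 < cu / (2 * side)) by (apply Rdiv_lt_0_compat; lra). lra.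
Qed.

(** The factor is the proportion of children in a window of size $\rho$. Beyond the scale [nX s]
    this proportion is $1$ and the mass of the parent is the bound. *)
Lemma children_mass : exists C2, 1 <= C2 /\ forall s S0 rho, reach (root_node N) s -> NoDup S0 ->
  incl S0 (ch s) -> side <= rho ->
  (forall c c', In c S0 -> In c' S0 -> Rabs (fst c - fst c') <= rho + side /\ Rabs (snd c - snd c') <= rho + 7) ->
  lsum (fun c => mass (c :: s)) S0 <=
  C2 * (mass s * (Rmin rho (nX s) * Rmin (Rmin rho (nX s)) (nW s) * / (nW s * nX s))).
Proof.
  pose proof side_bounds as [Hh1 Hh2].
  set (c1 := kap * kap / (160 * side)).
  assert (Hk : 0 < kap) by (unfold kap; lra).
  assert (Hc1 : 0 < c1) by (apply Rdiv_lt_0_compat; nra).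
  set (K := 25 / (side * side) * / c1).
  assert (HK : 0 < K).
  { apply Rmult_lt_0_compat; [apply Rdiv_lt_0_compat; nra|now apply Rinv_0_lt_compat]. }
  exists (1 + K). split; [lra|]. intros s S0 rho Hs Hnd Hincl HR Hclose.
  destruct (node_pos s Hs) as [HX1 [HW1 HW2]]. destruct (node_X s Hs) as (Hn & HX & _).
  pose proof (mass_pos (R * R) ch s) as Hm.
  assert (HWX : 0 < / (nW s * nX s)) by (apply Rinv_0_lt_compat; nra).
  destruct (Rle_dec rho (nX s)) as [HRX|HRX].
  - rewrite (Rmin_left rho) by auto.
    pose proof (children_count s S0 rho Hs Hnd Hincl HR Hclose) as Hcnt.
    destruct (ch_length s Hn HX) as [C1 C2]. fold c1 in C1.
    simpl. rewrite lsum_const.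
    assert (Hwt : wt (R * R) ch s <= / c1 * / (nW s * nX s)).
    { rewrite <- Rinv_mult. apply Rinv_le_contravar.
      - apply Rmult_lt_0_compat; [auto|nra].
      - eapply Rle_trans; [exact C1|]. apply le_INR. lia. }
    pose proof (wt_bounds (R * R) ch s) as [Hw0 _].
    assert (Hmm : 0 < rho * Rmin rho (nW s)).
    { apply Rmult_lt_0_compat; [lra|]. apply Rmin_pos; lra. }
    apply Rle_trans with (mass s * (/ c1 * / (nW s * nX s)) * (25 / (side * side) * (rho * Rmin rho (nW s)))).
    + apply Rmult_le_compat; auto.
      * nra.
      * apply pos_INR.
      * apply Rmult_le_compat_l; lra.
    + replace (mass s * (/ c1 * / (nW s * nX s)) * (25 / (side * side) * (rho * Rmin rho (nW s)))) with
        (K * (mass s * (rho * Rmin rho (nW s) * / (nW s * nX s)))) by (unfold K; ring).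
      apply Rmult_le_compat_r; [|lra].
      apply Rmult_le_pos; [lra|]. apply Rmult_le_pos; lra.
  - rewrite (Rmin_right rho) by lra. rewrite (Rmin_right (nX s)) by lra.
    replace (nX s * nW s * / (nW s * nX s)) with 1 by (field; lra).
    apply Rle_trans with (mass s); [|nra].
    apply Rle_trans with (lsum (fun c => mass (c :: s)) (ch s)).
    + apply lsum_incl; auto. intros c. left. apply mass_pos.
    + apply lsum_mass_children.
Qed.

(** Local form of $\mu(B)\le Cr^{1+\theta-\epsilon}$: [s] is the node where the ball splits and [S0]
    the children it meets. The hypothesis on [nLW] is $\phi_n\ge\theta$ up to linear errors. *)
Lemma ball_mass theta eps k k' t : reach (root_node N) t -> 0 <= theta <= 1 -> 0 < eps ->
  0 < 1 + theta - eps ->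
  (forall s, reach t s -> theta * (nLX s - ln (nW s)) - k * INR (length s) - k' <= nLW (tl s)) ->
  forall Lc, 0 < Lc ->
  exists Cst, 0 < Cst /\ forall s S0 r, reach t s -> NoDup S0 -> incl S0 (ch s) -> 0 < r ->
    side <= Lc * exp (2 * INR (length s) + nLX s) * r ->
    (forall c c', In c S0 -> In c' S0 ->
       Rabs (fst c - fst c') <= Lc * exp (2 * INR (length s) + nLX s) * r + side /\
       Rabs (snd c - snd c') <= Lc * exp (2 * INR (length s) + nLX s) * r + 7) ->
    lsum (fun c => mass (c :: s)) S0 <= Cst * rpow r (1 + theta - eps).
Proof.
  intros Ht Hth Heps Hs0 Hlow Lc HLc.
  destruct children_mass as (C2 & HC2 & Hch). destruct mass_bound as (Km & Bm & HKm & Hmass).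
  set (sx := 1 + theta - eps) in *.
  destruct (superlinear_bounded a hb (Km + k + 2 * sx) eps Heps) as [M HM].
  exists (C2 * exp (M + Bm + k' + sx * ln Lc)). split; [apply Rmult_lt_0_compat; [lra|apply exp_pos]|].
  intros s S0 r Hs Hnd Hincl Hr HR Hclose.
  assert (Hrs : reach (root_node N) s) by (eapply reach_trans; eauto).
  set (RR := Lc * exp (2 * INR (length s) + nLX s) * r) in *.
  pose proof side_bounds as [Hh1 Hh2].
  eapply Rle_trans; [apply (Hch s S0 RR); auto|].
  rewrite (Rmult_assoc C2 (exp _)).
  apply Rmult_le_compat_l; [lra|].
  destruct (node_pos s Hrs) as [HX1 [HW1 HW2]].
  set (R' := Rmin RR (nX s)).
  assert (HR' : 0 < R') by (apply Rmin_pos; lra).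
  set (m := Rmin R' (nW s)). assert (Hm : 0 < m) by (apply Rmin_pos; lra).
  pose proof (mass_pos (R * R) ch s) as Hms.
  rewrite rpow_pos by auto.
  rewrite <- exp_plus.
  rewrite <- (exp_ln (mass s)), <- (exp_ln (R' * m * / (nW s * nX s))); auto.
  2:{ apply Rmult_lt_0_compat; [nra|]. apply Rinv_0_lt_compat. nra. }
  rewrite <- exp_plus. apply exp_le_compat.
  rewrite ln_mult; [|nra|apply Rinv_0_lt_compat; nra].
  rewrite ln_Rinv by nra. rewrite !ln_mult by lra.
  pose proof (Hmass s Hrs) as Q1. pose proof (Hlow s Hs) as Q2.
  pose proof (nLX_tl_ge s Hrs) as Q3. destruct (nLX_tl s Hrs) as [E1 _].
  pose proof (HM (length s)) as Q4.
  assert (Q5 : ln R' <= ln Lc + (2 * INR (length s) + nLX s) + ln r).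
  { eapply Rle_trans; [apply ln_le_compat; [auto|apply Rmin_l]|]. unfold RR.
    assert (0 < exp (2 * INR (length s) + nLX s)) by apply exp_pos.
    rewrite !ln_mult, ln_exp; try lra. nra. }
  assert (Q6 : ln R' <= ln (nX s)) by (apply ln_le_compat; [auto|apply Rmin_r]).
  (* The scale [W] is the worst one: below it $m=R'$ and $\theta\le1$ is used, above it $m=W$ and
     $\theta\ge0$ is used. *)
  assert (Q7 : ln m - ln (nW s) <= theta * (ln R' - ln (nW s))).
  { unfold m. unfold Rmin. destruct (Rle_dec R' (nW s)) as [H|H].
    - assert (ln R' <= ln (nW s)) by (apply ln_le_compat; lra). nra.
    - assert (ln (nW s) <= ln R') by (apply ln_le_compat; lra). nra. }
  assert (Q8 : sx * ln R' <= sx * (ln Lc + (2 * INR (length s) + nLX s) + ln r)) by (apply Rmult_le_compat_l; lra).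
  assert (Q9 : eps * (ln R' - nLX s) <= eps * (- ln (prod1 a (length s - 1)))) by (apply Rmult_le_compat_l; lra).
  unfold sx in *. lra.
Qed.

(** Mass distribution principle. A covering set is replaced by the children it meets at the first
    level where the paths followed in it separate, or by one deep node if they never do. *)
Lemma Hs_lower theta eps k k' t : reach (root_node N) t -> 0 <= theta <= 1 -> 0 < eps ->
  0 < 1 + theta - eps ->
  (forall s, reach t s -> theta * (nLX s - ln (nW s)) - k * INR (length s) - k' <= nLW (tl s)) ->
  Hs (1 + theta - eps) (Iab lam a b) <> Finite 0.
Proof.
  intros Ht Hth Heps Hs0 Hlow Hnull.
  destruct follows_dist as (G & Lc & HLc & Hex & Hdist).
  destruct (ball_mass theta eps k k' t Ht Hth Heps Hs0 Hlow Lc HLc) as (Cst & HCst & Hball).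
  set (sx := 1 + theta - eps) in *.
  pose proof (mass_pos (R * R) ch t) as Hmt.
  destruct (Hs_null_cover sx (Iab lam a b) 0 (mass t / (4 * Cst)) Hnull) as (U & r & HU & Hr & HSB).
  { apply Rdiv_lt_0_compat; lra. }
  (* The cover pays for [mass t / 4] through its cost, and $\eta\sum2^{-i}$ is another [mass t / 4];
     together this is half of the mass to be covered. *)
  set (eta := mass t / 8). assert (Heta : 0 < eta) by (unfold eta; lra).
  assert (HtN : (N <= length t)%nat) by (apply node_X in Ht; tauto).
  assert (Hpt : forall c, is_path (R * R) ch t c -> path c) by (intros c; now apply is_path_trans).
  set (KU := fun i c z => is_path (R * R) ch t c /\ follows c z /\ Cmod z <= G /\ U i z).
  assert (HS : forall i, exists S : list (list (R * R)), NoDup S /\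
    lsum mass S <= Cst * rpow (r i) sx + eta * (/ 2) ^ i /\
    forall c z, KU i c z -> exists n, (length t <= n)%nat /\ In (pfx c n) S).
  { intros i. assert (Hp2 : 0 < (/ 2) ^ i) by (apply pow_lt; lra).
    pose proof (rpow_nonneg (r i) sx) as Hrp.
    destruct (classic (exists c z, KU i c z)) as [(c0 & z0 & H0)|Hno].
    2:{ exists []. split; [constructor|split].
        - simpl. nra.
        - intros c z H. exfalso. eauto. }
    destruct (classic (exists n c z c' z', KU i c z /\ KU i c' z' /\ pfx c (S n) <> pfx c' (S n))) as [Hn|Hn].
    - destruct (least_nat _ Hn) as (n & (c1 & z1 & c2 & z2 & K1 & K2 & Hne) & Hmin).
      assert (Hsame : forall c z, KU i c z -> pfx c n = pfx c1 n).
      { intros c z Kc. destruct n as [|n]; [reflexivity|]. apply NNPP. intros H.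
        apply (Hmin n); [lia|]. exists c, z, c1, z1. auto. }
      assert (Hnt : (length t <= n)%nat).
      { apply Nat.nlt_ge. intros Hlt. apply Hne. apply (pfx_le c1 c2 (length t)); [|lia].
        destruct K1 as [[-> _] _]. destruct K2 as [[-> _] _]. reflexivity. }
      set (s := pfx c1 n) in *.
      assert (Hs : reach t s) by (apply reach_pfx; [apply K1|auto]).
      assert (Hls : length s = n) by apply length_pfx.
      set (p := fun x => if decide (exists c z, KU i c z /\ c n = x) then true else false).
      assert (Hpx : forall x, p x = true <-> exists c z, KU i c z /\ c n = x).
      { intros x. unfold p. destruct decide; split; congruence || tauto. }
      set (S0 := filter p (ch s)).
      assert (Hd : forall c z c' z', KU i c z -> KU i c' z' ->
         Cmod (Cminus (Eiter lam n z) (Eiter lam n z')) <= Lc * exp (2 * INR (length s) + nLX s) * r i).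
      { intros c z c' z' Kc Kc'. pose proof (Hsame _ _ Kc) as E. pose proof (Hsame _ _ Kc') as E'.
        destruct Kc as (P1 & F1 & G1 & U1), Kc' as (P2 & F2 & G2 & U2).
        eapply Rle_trans; [apply (Hdist c c'); auto; [lia|congruence]|].
        rewrite E, Hls. fold s. apply Rmult_le_compat_l.
        - left. apply Rmult_lt_0_compat; [auto|apply exp_pos].
        - apply (Hr i); auto. }
      assert (Hfar : side <= Cmod (Cminus (Eiter lam n z1) (Eiter lam n z2))).
      { pose proof (Hsame _ _ K2) as E2.
        assert (Hc12 : c1 n <> c2 n).
        { intros E. apply Hne. simpl. rewrite E, E2. reflexivity. }
        apply (cells_far s (c1 n) (c2 n)); auto.
        - apply K1. lia.
        - rewrite <- E2. destruct K2 as [[_ P2] _]. apply P2. lia.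
        - apply K1. lia.
        - destruct K2 as (_ & F2 & _). apply F2. lia. }
      pose proof (Hd _ _ _ _ K1 K2) as Hd12.
      pose proof side_bounds as [Hh1 Hh2].
      assert (HE : 0 < Lc * exp (2 * INR (length s) + nLX s)) by (apply Rmult_lt_0_compat; [auto|apply exp_pos]).
      assert (Hri : 0 < r i).
      { apply Rnot_le_lt. intros Hle. nra. }
      exists (map (fun x => x :: s) S0). split; [|split].
      + apply NoDup_map_NoDup_ForallPairs; [|apply NoDup_filter, ch_NoDup].
        intros x y _ _ E. now injection E.
      + rewrite lsum_map.
        assert (lsum (fun c => mass (c :: s)) S0 <= Cst * rpow (r i) sx); [|nra].
        apply Hball; auto; [apply NoDup_filter, ch_NoDup|apply incl_filter|lra|].
        intros x y Hx Hy. apply filter_In in Hx, Hy.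
        destruct Hx as [_ Hx], Hy as [_ Hy]. apply Hpx in Hx, Hy.
        destruct Hx as (cx & zx & Kx & Ex), Hy as (cy & zy & Ky & Ey).
        pose proof (Hd _ _ _ _ Kx Ky) as Hdxy.
        destruct Kx as (_ & Fx & _), Ky as (_ & Fy & _).
        destruct (Fx n ltac:(lia)) as [X1 X2]. destruct (Fy n ltac:(lia)) as [Y1 Y2].
        rewrite Ex in X1, X2. rewrite Ey in Y1, Y2.
        pose proof (Rle_trans _ _ _ (Rabs_fst_le _) Hdxy) as A1.
        pose proof (Rle_trans _ _ _ (Rabs_snd_le _) Hdxy) as A2. simpl in A1, A2.
        apply Rabs_le_between in A1, A2.
        split; apply Rabs_le; lra.
      + intros c z Kc. exists (S n). split; [lia|]. simpl. rewrite (Hsame _ _ Kc).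
        apply (in_map (fun x => x :: s)). apply filter_In. split.
        * rewrite <- (Hsame _ _ Kc). destruct Kc as [[_ Pc] _]. now apply Pc.
        * apply Hpx. eauto.
    - assert (Hall : forall c z, KU i c z -> forall n, pfx c n = pfx c0 n).
      { intros c z Kc n. apply NNPP. intros H. apply Hn.
        destruct n as [|n]; [now elim H|]. exists n, c, z, c0, z0. auto. }
      (* Points along a single path may come with radius [0] and cost nothing, so they are charged
         to [eta]; the node masses tend to [0] along the path. *)
      assert (Hsmall : exists n, (length t <= n)%nat /\ mass (pfx c0 n) <= eta * (/ 2) ^ i).
      { destruct mass_bound as (Km & Bm & HKm & Hmass).
        destruct (superlinear_decay a hb (Km + k) (Bm + k') 1 (eta * (/ 2) ^ i) ltac:(lra)) as [m1 Hm1].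
        { apply Rmult_lt_0_compat; lra. }
        destruct (hb 0) as [m2 Hm2].
        set (n := (m1 + m2 + length t + 1)%nat). exists n. split; [lia|].
        assert (Hrt : reach t (pfx c0 n)) by (apply reach_pfx; [apply H0|lia]).
        assert (Hrn : reach (root_node N) (pfx c0 n)) by (eapply reach_trans; eauto).
        pose proof (Hmass _ Hrn) as Q1. pose proof (Hlow _ Hrt) as Q2.
        pose proof (nLX_tl_ge _ Hrn) as Q3. destruct (nLX_tl _ Hrn) as [E1 _].
        destruct (node_pos _ Hrn) as [HX1 [HW1 HW2]].
        assert (Q4 : ln (nW (pfx c0 n)) <= ln (nX (pfx c0 n))) by (apply ln_le_compat; lra).
        specialize (Hm2 (n - 1)%nat ltac:(lia)). specialize (Hm1 n ltac:(lia)).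
        rewrite length_pfx in *. rewrite Rmult_0_l in Hm2.
        rewrite <- (exp_ln (mass (pfx c0 n))) by apply mass_pos.
        eapply Rle_trans; [apply exp_le_compat|eapply Rle_trans; [exact Hm1|]].
        - assert (0 <= theta * (nLX (pfx c0 n) - ln (nW (pfx c0 n)))) by (apply Rmult_le_pos; lra).
          lra.
        - assert (0 < (/ 2) ^ n <= 1).
          { split; [apply pow_lt; lra|]. rewrite <- (pow1 n); apply pow_incr; lra. }
          assert (0 < eta * (/ 2) ^ i) by (apply Rmult_lt_0_compat; lra). nra. }
      destruct Hsmall as (n & Hn1 & Hn2). exists [pfx c0 n]. split; [repeat constructor; simpl; tauto|].
      split.
      + simpl. nra.
      + intros c z Kc. exists n. split; auto. left. symmetry. apply (Hall c z Kc). }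
  apply choice in HS. destruct HS as [S HS].
  assert (Hcov : mass t <= Cst * (mass t / (4 * Cst)) + eta * / (1 - / 2)).
  { apply (mass_cover (R * R) (0, 0) ch (T := nat * list (R * R)) (fun p => snd p)
      (fun p => In (snd p) (S (fst p))) t).
    - intros s Hs. assert (Hrs : reach (root_node N) s) by (eapply reach_trans; eauto).
      destruct (node_X s Hrs) as (A1 & A2 & _). split; [apply ch_NoDup|]. now apply ch_length.
    - intros c Hc. destruct (Hex c (Hpt c Hc)) as (z & Gz & Fz).
      destruct (HU z (follows_Iab c z (Hpt c Hc) Fz)) as [i Hi].
      destruct (HS i) as (_ & _ & H3). destruct (H3 c z) as (n & Hn1 & Hn2).
      { unfold KU. auto. }
      exists (i, pfx c n), n. auto.
    - apply SB_pair with (fun i => Cst * rpow (r i) sx + eta * (/ 2) ^ i).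
      + intros i. destruct (HS i) as (H1 & H2 & _).
        eapply SB_le; [intros; apply Rle_refl|exact H2|].
        apply SB_of_list.
        * intros; left; apply mass_pos.
        * intros s Hs. simpl. destruct decide; [lra|contradiction].
        * intros s Hs. simpl. destruct decide; [contradiction|lra].
      + intros l Hl. rewrite lsum_plus, lsum_scal. apply Rplus_le_compat.
        * apply Rmult_le_compat_l; [lra|apply (HSB l Hl)].
        * apply (SB_geom (fun i => eta * (/ 2) ^ i) eta (/ 2)); auto; try lra. intros; lra. }
  replace (Cst * (mass t / (4 * Cst))) with (mass t / 4) in Hcov by (field; lra).
  unfold eta in Hcov. lra.
Qed.

(** Where $\psi_n\ge\theta$, one ball of radius about $1/(x_1\cdots x_n)$ outweighs [M] times the
    mass of its node, because the spare exponent [eps] beats all exponential factors. Density of [F]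
    supplies a centre in every node, and bar induction assembles a finite packing. *)
Lemma dense_packing (F : C -> Prop) theta eps t G Lc : reach (root_node N) t -> 0 < eps ->
  0 < 1 + theta - eps -> 0 < Lc ->
  (forall c c' z w k, path c -> path c' -> follows c z -> follows c' w ->
     Cmod z <= G -> Cmod w <= G -> (N <= k)%nat -> pfx c k = pfx c' k ->
     Cmod (Cminus (Eiter lam k z) (Eiter lam k w)) <=
     Lc * exp (2 * INR k + nLX (pfx c k)) * Cmod (Cminus z w)) ->
  (forall s, reach t s -> exists c z, path c /\ pfx c (length s) = s /\ follows c z /\
     Cmod z <= G /\ F z) ->
  (forall c, path c -> forall m, exists n, (m <= n)%nat /\
     theta * nLX (pfx c n) <= nLW (pfx c n)) ->
  forall d M, 0 < d -> Rbar_le (Finite M) (Ps_delta (1 + theta - eps) d F).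
Proof.
  intros Ht Heps Hs0 HLc Hdist Hdense Hpsi d M0 Hd.
  set (sx := 1 + theta - eps) in *.
  destruct mass_bound as (Km & Bm & HKm & Hmass).
  pose proof side_bounds as [Hh1 Hh2].
  assert (HtN : (N <= length t)%nat) by (apply node_X in Ht; tauto).
  pose proof (mass_pos (R * R) ch t) as Hmt.
  set (M := (Rabs M0 + 1) / mass t).
  assert (HM : 0 < M) by (apply Rdiv_lt_0_compat; [pose proof (Rabs_pos M0); lra|auto]).
  (* A quarter of the guaranteed distance between points passing through different children of
     [u]. *)
  set (rsc := fun u : list (R * R) => side / (4 * Lc) * exp (- (2 * INR (length u) + nLX u))).
  assert (Hrsc : forall u, 0 < rsc u).
  { intros u. apply Rmult_lt_0_compat; [apply Rdiv_lt_0_compat; lra|apply exp_pos]. }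
  set (far := fun p p' : C * R => snd p + snd p' < Cmod (Cminus (fst p) (fst p'))).
  set (through := fun (s : list (R * R)) (z : C) =>
    exists c, path c /\ pfx c (length s) = s /\ follows c z /\ Cmod z <= G).
  (* Radii are bounded by the scale of the parent, [rsc (tl s)], which keeps packings from different
     siblings disjoint when they are merged. *)
  set (Good := fun s => exists l : list (C * R),
    (forall p, In p l -> (0 < snd p <= d /\ F (fst p)) /\ snd p <= rsc (tl s) /\ through s (fst p)) /\
    ForallOrdPairs far l /\ M * mass s <= lsum (fun p => rpow (2 * snd p) sx) l).
  assert (HG : Good t).
  { apply (bar_induction (R * R) (0, 0) ch t Good).
    - intros s Hs Hgood. assert (Hrs : reach (root_node N) s) by (eapply reach_trans; eauto).
      destruct (node_X s Hrs) as (A1 & A2 & _). destruct (ch_length s A1 A2) as [_ Hne].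
      assert (Hall : forall S0, NoDup S0 -> incl S0 (ch s) -> exists l : list (C * R),
        (forall p, In p l -> (0 < snd p <= d /\ F (fst p)) /\ snd p <= rsc s /\
           exists x, In x S0 /\ through (x :: s) (fst p)) /\
        ForallOrdPairs far l /\ M * lsum (fun x => mass (x :: s)) S0 <= lsum (fun p => rpow (2 * snd p) sx) l).
      { induction S0 as [|x S0 IH]; intros Hnd Hincl.
        - exists []. split; [intros p []|]. split; [constructor|]. simpl. lra.
        - inversion Hnd as [|? ? Hx Hnd']; subst.
          destruct IH as (l & L1 & L2 & L3); auto; [intros y Hy; apply Hincl; now right|].
          destruct (Hgood x) as (l' & M1 & M2 & M3); [apply Hincl; now left|].
          exists (l' ++ l). split; [|split].
          + intros p Hp. apply in_app_iff in Hp. destruct Hp as [Hp|Hp].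
            * destruct (M1 p Hp) as (P1 & P2 & P3). split; [auto|split; [auto|]].
              exists x. split; [now left|auto].
            * destruct (L1 p Hp) as (P1 & P2 & y & Hy & P3). split; [auto|split; [auto|]].
              exists y. split; [now right|auto].
          + apply ForallOrdPairs_app; auto. intros p p' Hp Hp'.
            destruct (M1 p Hp) as (_ & P2 & c & C1 & C2 & C3 & C4).
            destruct (L1 p' Hp') as (_ & P2' & y & Hy & c' & C1' & C2' & C3' & C4').
            simpl in C2, C2'. injection C2 as E1 E2. injection C2' as E1' E2'.
            pose proof (Hdist c c' _ _ (length s) C1 C1' C3 C3' C4 C4' A1 ltac:(congruence)) as Hdd.
            assert (Hcf : side <= Cmod (Cminus (Eiter lam (length s) (fst p)) (Eiter lam (length s) (fst p')))).
            { apply (cells_far s x y).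
              - apply Hincl. now left.
              - apply Hincl. now right.
              - intros ->. contradiction.
              - rewrite <- E1. apply C3. auto.
              - rewrite <- E1'. apply C3'. auto. }
            rewrite E2 in Hdd. unfold far. simpl tl in P2.
            set (e0 := exp (2 * INR (length s) + nLX s)) in *.
            assert (He0 : 0 < e0) by apply exp_pos.
            assert (Er : rsc s = side / (4 * Lc) * / e0) by (unfold rsc; now rewrite exp_Ropp).
            assert (Hlow : side / (Lc * e0) <= Cmod (Cminus (fst p) (fst p'))).
            { apply Rmult_le_reg_l with (Lc * e0); [nra|].
              replace (Lc * e0 * (side / (Lc * e0))) with side by (field; lra). lra. }
            assert (side / (Lc * e0) = 4 * rsc s) by (rewrite Er; field; lra).
            pose proof (Hrsc s). lra.
          + rewrite lsum_app.
            change (lsum (fun x => mass (x :: s)) (x :: S0)) with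
              (mass (x :: s) + lsum (fun x => mass (x :: s)) S0). lra. }
      destruct (Hall (ch s) (ch_NoDup s) (incl_refl _)) as (l & L1 & L2 & L3).
      exists l. split; [|split; [auto|]].
      + intros p Hp. destruct (L1 p Hp) as (P1 & P2 & x & Hx & c & C1 & C2 & C3 & C4).
        split; [auto|split].
        * eapply Rle_trans; [exact P2|]. unfold rsc. apply Rmult_le_compat_l; [left; apply Rdiv_lt_0_compat; lra|].
          apply exp_le_compat. destruct (nLX_tl s Hrs) as [E _]. rewrite E.
          destruct (node_pos s Hrs) as [HX1 _].
          assert (0 <= ln (nX s)) by (rewrite <- ln_1; apply ln_le_compat; lra).
          assert (INR (length (tl s)) <= INR (length s)) by (apply le_INR; destruct s; simpl; lia). lra.
        * exists c. split; auto. split; [|auto]. simpl in C2. now injection C2.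
      + rewrite <- (proj2 (lsum_mass_children (R * R) ch s) Hne). exact L3.
    - intros c Hc. assert (Hpc : path c) by (eapply is_path_trans; eauto).
      set (B := ln M + Bm - sx * ln (side / (2 * Lc))).
      destruct (superlinear_decay a hb (Km + 2 * sx) B eps 1 Heps ltac:(lra)) as [m1 Hm1].
      destruct (superlinear_decay a hb 0 (ln (side / (4 * Lc))) 1 d ltac:(lra) Hd) as [m2 Hm2].
      destruct (Hpsi c Hpc (m1 + m2 + length t)%nat) as (m & Hm & Hps).
      (* One level below the index of $\psi$: the mass of the node at [m + 1] is about
         $1/\prod_{k\le m}x_kw_k$, which matches the radius at [m]. *)
      exists (S m). split; [lia|].
      assert (Hr : reach t (pfx c (S m))) by (apply reach_pfx; auto; lia).
      assert (Hrd : reach (root_node N) (pfx c (S m))) by (eapply reach_trans; eauto).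
      destruct (Hdense _ Hr) as (c' & z & C1 & C2 & C3 & C4 & C5).
      pose proof (nLX_tl_ge _ Hrd) as Q3. pose proof (Hmass _ Hrd) as Q1.
      rewrite length_pfx in *. simpl tl in Q1, Q3.
      specialize (Hm1 (S m) ltac:(lia)). specialize (Hm2 (S m) ltac:(lia)).
      assert (Hpw : (/ 2) ^ S m <= 1) by (rewrite <- (pow1 (S m)); apply pow_incr; lra).
      assert (Hpw0 : 0 < (/ 2) ^ S m) by (apply pow_lt; lra).
      set (r0 := rsc (pfx c m)).
      assert (Hr0 : r0 = exp (ln (side / (4 * Lc)) - (2 * INR m + nLX (pfx c m)))).
      { unfold Rminus. rewrite exp_plus, exp_ln by (apply Rdiv_lt_0_compat; lra).
        unfold r0, rsc. now rewrite length_pfx. }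
      exists [(z, r0)]. split; [|split].
      + intros p [<-|[]]. simpl. repeat split; auto.
        * apply Hrsc.
        * rewrite Hr0. apply Rle_trans with (exp (0 * INR (S m) + ln (side / (4 * Lc)) - 1 * ln (prod1 a (S m - 1)))).
          -- apply exp_le_compat. pose proof (pos_INR m). lra.
          -- nra.
        * unfold r0. lra.
        * exists c'. simpl. rewrite length_pfx. auto.
      + repeat constructor.
      + change (lsum (fun p => rpow (2 * snd p) sx) [(z, r0)]) with (rpow (2 * r0) sx + 0).
        rewrite Rplus_0_r. rewrite rpow_pos by (pose proof (Hrsc (pfx c m)); unfold r0; lra).
        assert (E2 : ln (2 * r0) = ln (side / (2 * Lc)) - (2 * INR m + nLX (pfx c m))).
        { rewrite ln_mult by (try lra; apply Hrsc). rewrite Hr0, ln_exp.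
          replace (side / (2 * Lc)) with (2 * (side / (4 * Lc))) by (field; lra).
          rewrite (ln_mult 2) by (try lra; apply Rdiv_lt_0_compat; lra). ring. }
        rewrite E2. rewrite <- (exp_ln M), <- (exp_ln (mass (pfx c (S m)))) by (auto; apply mass_pos).
        rewrite <- exp_plus. apply exp_le_compat.
        assert (Hneg : (Km + 2 * sx) * INR (S m) + B - eps * ln (prod1 a (S m - 1)) <= 0).
        { apply Rnot_lt_le. intros Hlt. apply exp_increasing in Hlt. rewrite exp_0 in Hlt. lra. }
        assert (Q4 : eps * ln (prod1 a (S m - 1)) <= eps * nLX (pfx c m)) by (apply Rmult_le_compat_l; lra).
        unfold B in Hneg. rewrite S_INR in *. unfold sx in *. lra. }
  destruct HG as (l & L1 & L2 & L3).
  apply Ps_delta_ge_list with l; [lra| |exact L2|].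
  - intros p Hp. now apply L1.
  - eapply Rle_trans; [|exact L3]. unfold M.
    replace ((Rabs M0 + 1) / mass t * mass t) with (Rabs M0 + 1) by (field; lra).
    pose proof (Rle_abs M0). lra.
Qed.

(** If every subtree contained, for each [i], a node free of [Fi i], a path through such nodes would
    carry a point outside the whole cover. *)
Lemma Ps_lower theta eps : 0 < eps -> 0 < 1 + theta - eps ->
  (forall c, path c -> forall m, exists n, (m <= n)%nat /\
     theta * nLX (pfx c n) <= nLW (pfx c n)) ->
  Ps (1 + theta - eps) (Iab lam a b) <> Finite 0.
Proof.
  intros Heps Hs0 Hpsi.
  destruct follows_dist as (G & Lc & HLc & Hex & Hdist).
  assert (Hinf : Rbar_le p_infty (Ps (1 + theta - eps) (Iab lam a b))).
  2:{ intros E. rewrite E in Hinf. exact Hinf. }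
  apply Rbar_glb_greatest. intros v (Fi & Hcov & ->).
  destruct (classic (exists i t, reach (root_node N) t /\ forall s, reach t s -> exists c z, path c /\
     pfx c (length s) = s /\ follows c z /\ Cmod z <= G /\ Fi i z)) as [(i & t & Ht & Hdense)|Hno].
  - rewrite (rbar_sum_infinite _ i).
    + apply Rbar_le_refl.
    + intros j. apply Ps0_nonneg.
    + apply Ps0_infinite_of. intros d M Hd.
      now apply (dense_packing (Fi i) theta eps t G Lc).
  - exfalso.
    destruct (baire_path (R * R) (0, 0) ch (root_node N) (fun i s => ~ exists c z, path c /\
       pfx c (length s) = s /\ follows c z /\ Cmod z <= G /\ Fi i z)) as (c & Hc & HQ).
    + intros s Hs. destruct (node_X s Hs) as (A1 & A2 & _). now apply ch_length.
    + intros i s Hs. apply NNPP. intros H. apply Hno. exists i, s. split; auto.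
      intros s' Hs'. apply NNPP. intros H'. apply H. now exists s'.
    + destruct (Hex c Hc) as (z & Gz & Fz).
      destruct (Hcov z (follows_Iab c z Hc Fz)) as [i Hi].
      destruct (HQ i) as (n & Hn & Hq). apply Hq. exists c, z. rewrite length_pfx. auto.
Qed.

(** * From measures to dimensions *)

Lemma hbig3 k : (N <= k)%nat -> 3 <= a k.
Proof.
  intros Hk. specialize (hbig k Hk). pose proof side_bounds as [H1 H2].
  assert (3 <= 160 / side); [|lra].
  apply Rmult_le_reg_r with (side); [lra|]. unfold Rdiv. rewrite Rmult_assoc, Rinv_l by lra. lra.
Qed.

Lemma box_a : in_box a b a.
Proof. intros k Hk. specialize (hab k Hk). lra. Qed.

Lemma range x : in_box a b x -> forall d, 0 < d -> exists m, forall n, (m <= n)%nat ->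
    - d <= phi_n a b x n <= 1 /\ - d <= psi_n a b x n <= 1.
Proof.
  apply (phi_psi_range a b D hab hD0 hD hb x N).
  intros k Hk. pose proof (hbig3 k Hk). lra.
Qed.

(** The packing premeasure is not countably stable and needs bounds uniform in the point; the last
    index freezes the time from which the bound on $\psi_n$ holds. *)
Definition seg (i : (nat * list (Z * Z)) * nat) (P : C -> nat -> nat -> Prop) (z : C) : Prop :=
  piece lam a b (S (N + fst (fst i))) (snd (fst i)) z /\ P z (N + fst (fst i))%nat (snd i).

Lemma Iab_pieces z M : Iab lam a b z ->
  exists N' p, (M <= N')%nat /\ piece lam a b (S (N + N')) p z.
Proof.
  intros [N1 H]. exists (N1 + M)%nat, (rcode lam z (S (N + (N1 + M)))). split; [lia|].
  split; auto. intros k Hk. apply H. lia.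
Qed.

Lemma enum_pieces : exists d : nat -> (nat * list (Z * Z)) * nat, forall t, exists i, d i = t.
Proof.
  apply countable_surj; [exact ((0%nat, nil), 0%nat)|].
  apply countable_prod; [apply countable_prod; [apply countable_nat|]|apply countable_nat].
  apply countable_list, countable_prod; apply countable_Z.
Qed.

Lemma upper_H : Rbar_le (dimH (Iab lam a b))
  (Rbar_plus (Finite 1) (Rbar_lub (fun t => exists x, in_box a b x /\ t = LimInf_seq (phi_n a b x)))).
Proof.
  set (E := fun t => exists x, in_box a b x /\ t = LimInf_seq (phi_n a b x)).
  assert (Hub : forall x, in_box a b x -> Rbar_le (LimInf_seq (phi_n a b x)) (Rbar_lub E)).
  { intros x Hx. apply Rbar_lub_ub. now exists x. }
  assert (H0 : Rbar_le (Finite 0) (Rbar_lub E)).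
  { eapply Rbar_le_trans; [|apply (Hub a box_a)].
    destruct (Rbar_le_lt_dec (Finite 0) (LimInf_seq (phi_n a b a))) as [|Hlt]; auto. exfalso.
    destruct (Rbar_lt_between _ _ Hlt) as (r & R1 & R2). simpl in R2.
    destruct (range a box_a (- r) ltac:(lra)) as [m Hm].
    destruct (LimInf_lt _ _ R1 m) as (n & Hn & Hp). specialize (Hm n Hn). lra. }
  destruct (Rbar_lub E) as [S| |] eqn:ES; [| |contradiction].
  2:{ simpl. now destruct (dimH (Iab lam a b)). }
  simpl in H0. simpl Rbar_plus.
  replace (1 + S) with (Rmax 0 (1 + S)) by (apply Rmax_right; lra).
  apply critical_exponent_le. intros s Hs _.
  destruct enum_pieces as [d Hd].
  apply Hs_null_union with (fun i => piece lam a b (Datatypes.S (N + fst (fst (d i)))) (snd (fst (d i)))).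
  - intros z Hz. destruct (Iab_pieces z 0 Hz) as (N' & p & _ & Hp).
    destruct (Hd ((N', p), 0%nat)) as [i Hi]. exists i. now rewrite Hi.
  - intros i. apply piece_Hs_null with D ((s - 1 - S) / 2); auto; try lra.
    + intros k Hk. apply hbig3. lia.
    + intros z Hz. apply LimInf_lt.
      eapply Rbar_le_lt_trans.
      * apply Hub. intros k Hk. apply (xz_in_box lam a b _ _ hab z k Hz Hk).
      * simpl. lra.
Qed.

Lemma upper_P : Rbar_le (dimP (Iab lam a b))
  (Rbar_plus (Finite 1) (Rbar_lub (fun t => exists x, in_box a b x /\ t = LimSup_seq (psi_n a b x)))).
Proof.
  set (E := fun t => exists x, in_box a b x /\ t = LimSup_seq (psi_n a b x)).
  assert (Hub : forall x, in_box a b x -> Rbar_le (LimSup_seq (psi_n a b x)) (Rbar_lub E)).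
  { intros x Hx. apply Rbar_lub_ub. now exists x. }
  assert (H0 : Rbar_le (Finite 0) (Rbar_lub E)).
  { eapply Rbar_le_trans; [|apply (Hub a box_a)].
    destruct (Rbar_le_lt_dec (Finite 0) (LimSup_seq (psi_n a b a))) as [|Hlt]; auto. exfalso.
    destruct (Rbar_lt_between _ _ Hlt) as (r & R1 & R2). simpl in R2.
    destruct (range a box_a (- r) ltac:(lra)) as [m Hm].
    destruct (LimSup_lt _ _ R1) as [m' Hm']. specialize (Hm (m + m')%nat ltac:(lia)).
    specialize (Hm' (m + m')%nat ltac:(lia)). lra. }
  destruct (Rbar_lub E) as [S| |] eqn:ES; [| |contradiction].
  2:{ simpl. now destruct (dimP (Iab lam a b)). }
  simpl in H0. simpl Rbar_plus.
  replace (1 + S) with (Rmax 0 (1 + S)) by (apply Rmax_right; lra).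
  apply critical_exponent_le. intros s Hs _.
  destruct enum_pieces as [d Hd].
  (* For $s>2$ this makes $s-1-\epsilon=1$, and the bound in [Good] is just $w_k\le x_k$. In both
     cases $s\le2+\epsilon$, as the packing estimate requires. *)
  set (eps := if Rle_dec s 2 then (s - 1 - S) / 2 else s - 2).
  assert (Heps : 0 < eps) by (unfold eps; destruct Rle_dec; lra).
  set (Good := fun z N' M => forall n, (M <= n)%nat ->
    ln (prod1 (lw a b (xz lam a N' z)) n) <= (s - 1 - eps) * ln (prod1 (xz lam a N' z) n)).
  apply Ps_null_union with (fun i => seg (d i) Good).
  - intros z Hz. destruct (Iab_pieces z 0 Hz) as (N' & p & _ & Hp).
    assert (Hbox : in_box a b (xz lam a (N + N') z)).
    { intros k Hk. apply (xz_in_box lam a b _ _ hab z k Hp Hk). }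
    assert (HM : exists M, Good z (N + N')%nat M).
    { destruct (box_pos a b D hab hD0 hD _ Hbox) as (_ & _ & X3 & X4).
      unfold Good, eps. destruct (Rle_dec s 2) as [Hs2|Hs2].
      - destruct (LimSup_lt (psi_n a b (xz lam a (N + N') z)) (s - 1 - (s - 1 - S) / 2)) as [M HM].
        { eapply Rbar_le_lt_trans; [apply (Hub _ Hbox)|]. simpl. lra. }
        destruct (hb 1) as [m1 Hm1]. exists (M + m1 + 1)%nat. intros n Hn.
        specialize (HM n ltac:(lia)). specialize (Hm1 n ltac:(lia)). specialize (X3 n).
        assert (1 <= INR n) by (apply (le_INR 1); lia).
        unfold psi_n in HM.
        change (fun k : nat => Rmin (Delta_n a b (Datatypes.S k)) (xz lam a (N + N') z k)) with
          (lw a b (xz lam a (N + N') z)) in HM.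
        apply Rmult_lt_compat_r with (r := ln (prod1 (xz lam a (N + N') z) n)) in HM; [|lra].
        unfold Rdiv in HM at 1. rewrite Rmult_assoc, Rinv_l, Rmult_1_r in HM by lra. lra.
      - exists 0%nat. intros n _. replace (s - 1 - (s - 2)) with 1 by ring. specialize (X4 n). lra. }
    destruct HM as [M HM]. destruct (Hd ((N', p), M)) as [i Hi]. exists i. rewrite Hi. split; auto.
  - intros i. destruct (d i) as [[N' p] M]. unfold seg; simpl fst; simpl snd.
    destruct (psi_le_code lam a b D (N + N') p hab hD0 hD ltac:(intros k Hk; apply hbig3; lia) (s - 1 - eps))
      as (K2 & B2 & HK2 & Hcode).
    apply (piece_Ps0_null lam a b D (N + N') p hlam hab hD0 hD) with (eps := eps) (K2 := K2) (B2 := B2) (m0 := M); auto.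
    + intros k Hk. apply hbig3. lia.
    + lra.
    + unfold eps. destruct Rle_dec; lra.
    + intros z Hz. apply Hz.
    + intros z n [Hz HG] Hn Hn'. apply Hcode; auto.
Qed.

Lemma xc_in_box c : path c -> in_box a b (xc c).
Proof.
  intros Hc k Hk. now apply path_X.
Qed.

Lemma lower_P : Rbar_le
  (Rbar_plus (Finite 1) (Rbar_glb (fun t => exists x, in_box a b x /\ t = LimSup_seq (psi_n a b x))))
  (dimP (Iab lam a b)).
Proof.
  set (E := fun t => exists x, in_box a b x /\ t = LimSup_seq (psi_n a b x)).
  assert (Hlb : forall x, in_box a b x -> Rbar_le (Rbar_glb E) (LimSup_seq (psi_n a b x))).
  { intros x Hx. apply Rbar_glb_lb. now exists x. }
  assert (H1 : Rbar_le (Rbar_glb E) (Finite 1)).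
  { eapply Rbar_le_trans; [apply (Hlb a box_a)|].
    destruct (Rbar_le_lt_dec (LimSup_seq (psi_n a b a)) (Finite 1)) as [|Hlt]; auto. exfalso.
    destruct (range a box_a 1 ltac:(lra)) as [m Hm].
    destruct (LimSup_gt _ _ Hlt m) as (n & Hn & Hp). specialize (Hm n Hn). lra. }
  destruct (Rbar_glb E) as [f| |] eqn:EE; [|contradiction|exact I].
  simpl Rbar_plus. apply Rbar_glb_greatest. intros v (s & -> & Hs & Hnull).
  simpl. apply Rnot_lt_le. intros Hlt.
  (* A midpoint, so that $s=1+\theta-\epsilon$ with $\epsilon>0$ while $\theta$ is still below the
     infimum. *)
  set (theta := (s - 1 + f) / 2). assert (Ht : s - 1 < theta < f) by (unfold theta; lra).
  apply (Ps_lower theta (1 + theta - s)); try lra.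
  2:{ now replace (1 + theta - (1 + theta - s)) with s by ring. }
  intros c Hc m. pose proof (xc_in_box c Hc) as Hbox.
  destruct (hb 1) as [m1 Hm1].
  destruct (LimSup_gt (psi_n a b (xc c)) theta) with (N := (m + m1 + 1)%nat) as (n & Hn & Hp).
  { eapply Rbar_lt_le_trans; [|apply (Hlb _ Hbox)]. simpl. lra. }
  exists n. split; [lia|].
  destruct (box_pos a b D hab hD0 hD _ Hbox) as (_ & _ & X3 & _).
  specialize (Hm1 n ltac:(lia)). specialize (X3 n).
  assert (1 <= INR n) by (apply (le_INR 1); lia).
  rewrite path_LX, path_LW by auto.
  unfold psi_n in Hp.
  change (fun k : nat => Rmin (Delta_n a b (S k)) (xc c k)) with (lw a b (xc c)) in Hp.
  apply Rmult_lt_compat_r with (r := ln (prod1 (xc c) n)) in Hp; [|lra].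
  unfold Rdiv in Hp. rewrite Rmult_assoc, Rinv_l, Rmult_1_r in Hp by lra. lra.
Qed.

Lemma reach_extend t m : reach (root_node N) t ->
  exists t', reach t t' /\ (m <= length t')%nat.
Proof.
  intros Ht. induction m as [|m (t' & I1 & I2)].
  - exists t. split; [constructor|lia].
  - assert (Hr : reach (root_node N) t') by (eapply reach_trans; eauto).
    destruct (node_X t' Hr) as (A1 & A2 & _).
    destruct (ch_length t' A1 A2) as [_ Hne].
    destruct (ch t') as [|x l] eqn:Ex; [congruence|].
    exists (x :: t'). split; [|simpl; lia]. constructor; auto. rewrite Ex. now left.
Qed.

(* The lower bound [phi_n > theta] holds along each path from some index on; by Baire category
   this index is uniform on some subtree. *)
Lemma uniform_subtree theta :
  (forall c, path c -> exists m, forall n, (m <= n)%nat -> theta < phi_n a b (xc c) n) ->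
  exists t, reach (root_node N) t /\ forall s, reach t s ->
    theta * (nLX s - ln (nW s)) <= nLW (tl s).
Proof.
  intros Hphi. apply NNPP. intros Hno.
  destruct (baire_path (R * R) (0, 0) ch (root_node N) (fun i s => (i <= length s)%nat /\
     nLW (tl s) < theta * (nLX s - ln (nW s)))) as (c & Hc & HQ).
  - intros s Hs.
    destruct (node_X s Hs) as (A1 & A2 & _).
    now apply (ch_length s A1 A2).
  - intros i t Ht. destruct (reach_extend t i Ht) as (t' & T1 & T2).
    apply NNPP. intros H. apply Hno. exists t'. split; [eapply reach_trans; eauto|].
    intros s Hs. apply Rnot_lt_le. intros Hlt. apply H. exists s. split; [eapply reach_trans; eauto|].
    split; auto. apply reach_length in Hs. lia.
  - destruct (Hphi c Hc) as [m Hm]. destruct (hb 1) as [m1 Hm1].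
    destruct (HQ (m + m1 + 2)%nat) as (n & _ & Hn1 & Hn2). rewrite length_pfx in Hn1.
    destruct n as [|n]; [lia|]. specialize (Hm (S n) ltac:(lia)). specialize (Hm1 n ltac:(lia)).
    pose proof (xc_in_box c Hc) as Hbox.
    destruct (box_pos a b D hab hD0 hD _ Hbox) as (X1 & X2 & X3 & _). specialize (X3 n).
    assert (1 <= INR n) by (apply (le_INR 1); lia).
    change (tl (pfx c (S n))) with (pfx c n) in Hn2.
    rewrite path_LX, path_LW in Hn2 by auto.
    assert (EW : nW (pfx c (S n)) = lw a b (xc c) (S n)).
    { rewrite nW_eq, length_pfx, nX_pfx. reflexivity. }
    rewrite EW in Hn2. unfold phi_n in Hm. replace (S n - 1)%nat with n in Hm by lia.
    change (fun k : nat => Rmin (Delta_n a b (S k)) (xc c k)) with (lw a b (xc c)) in Hm.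
    change (Rmin (Delta_n a b (S (S n))) (xc c (S n))) with (lw a b (xc c) (S n)) in Hm.
    assert (Hden : 0 < ln (prod1 (xc c) (S n)) - ln (lw a b (xc c) (S n))).
    { rewrite ln_prod1_S by auto. destruct (X2 (S n) ltac:(lia)) as [W1 W2].
      pose proof (ln_le_compat _ _ W1 W2). lra. }
    apply Rmult_lt_compat_r with (r := ln (prod1 (xc c) (S n)) - ln (lw a b (xc c) (S n))) in Hm; auto.
    unfold Rdiv in Hm. rewrite Rmult_assoc, Rinv_l, Rmult_1_r in Hm by lra. lra.
Qed.

(** Serves [lower_H] when the chosen [theta] is negative: the value $0$ is used instead, and its
    condition only asks for widths bounded below by a constant, up to a linear error. *)
Lemma nLW_tl_lower : exists k k', forall s, reach (root_node N) s ->
  - k * INR (length s) - k' <= nLW (tl s).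
Proof.
  set (c := Rmin D 1). assert (Hc : 0 < c <= 1) by (split; [apply Rmin_pos; lra|apply Rmin_r]).
  assert (Hlc : ln c <= 0) by (rewrite <- ln_1; apply ln_le_compat; lra).
  exists (- ln c), (Rabs (nLW (root_node N)) + Rabs (nLW (tl (root_node N)))).
  pose proof (Rle_abs (- nLW (root_node N))) as B1. rewrite Rabs_Ropp in B1.
  pose proof (Rle_abs (- nLW (tl (root_node N)))) as B2. rewrite Rabs_Ropp in B2.
  pose proof (Rabs_pos (nLW (root_node N))). pose proof (Rabs_pos (nLW (tl (root_node N)))).
  assert (Hs : forall s, reach (root_node N) s -> INR (length s) * ln c - Rabs (nLW (root_node N)) <= nLW s).
  { induction 1 as [|s x Hs IH Hx].
    - pose proof (pos_INR (length (root_node N))). assert (INR (length (root_node N)) * ln c <= 0) by nra. lra.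
    - assert (Hr : reach (root_node N) (x :: s)) by (now constructor).
      destruct (nLX_tl _ Hr) as [_ E]. rewrite E.
      destruct (node_pos _ Hr) as [P1 _].
      assert (Hw : ln c <= ln (nW (x :: s))).
      { apply ln_le_compat; [lra|]. rewrite nW_eq. pose proof (hD (S (length (x :: s))) ltac:(lia)).
        apply Rmin_glb; [eapply Rle_trans; [apply Rmin_l|auto]|eapply Rle_trans; [apply Rmin_r|auto]]. }
      change (length (x :: s)) with (S (length s)) in *. rewrite S_INR. simpl tl. lra. }
  intros s Hr. pose proof (pos_INR (length s)).
  assert (INR (length s) * ln c <= 0) by nra.
  destruct Hr as [|s x Hr Hx]; [lra|]. specialize (Hs s Hr).
  change (length (x :: s)) with (S (length s)) in *. rewrite S_INR in *. simpl tl. lra.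
Qed.

Lemma lower_H : Rbar_le
  (Rbar_plus (Finite 1) (Rbar_glb (fun t => exists x, in_box a b x /\ t = LimInf_seq (phi_n a b x))))
  (dimH (Iab lam a b)).
Proof.
  set (E := fun t => exists x, in_box a b x /\ t = LimInf_seq (phi_n a b x)).
  assert (Hlb : forall x, in_box a b x -> Rbar_le (Rbar_glb E) (LimInf_seq (phi_n a b x))).
  { intros x Hx. apply Rbar_glb_lb. now exists x. }
  assert (H1 : Rbar_le (Rbar_glb E) (Finite 1)).
  { eapply Rbar_le_trans; [apply (Hlb a box_a)|].
    destruct (Rbar_le_lt_dec (LimInf_seq (phi_n a b a)) (Finite 1)) as [|Hlt]; auto. exfalso.
    destruct (range a box_a 1 ltac:(lra)) as [m Hm].
    destruct (LimInf_gt _ _ Hlt) as [m' Hm']. specialize (Hm (m + m')%nat ltac:(lia)).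
    specialize (Hm' (m + m')%nat ltac:(lia)). lra. }
  destruct (Rbar_glb E) as [f| |] eqn:EE; [|contradiction|exact I].
  simpl in H1. simpl Rbar_plus. apply Rbar_glb_greatest. intros v (s & -> & Hs & Hnull).
  simpl. apply Rnot_lt_le. intros Hlt.
  set (theta := (s - 1 + f) / 2). assert (Ht : s - 1 < theta < f) by (unfold theta; lra).
  destruct (Rle_dec 0 theta) as [H0|H0].
  - destruct (uniform_subtree theta) as (t & Hr & Ht2).
    { intros c Hc. apply LimInf_gt. eapply Rbar_lt_le_trans; [|apply Hlb; now apply xc_in_box]. simpl. lra. }
    apply (Hs_lower theta (1 + theta - s) 0 0 t); auto; try lra.
    + intros u Hu. specialize (Ht2 u Hu). lra.
    + now replace (1 + theta - (1 + theta - s)) with s by ring.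
  - destruct nLW_tl_lower as (k & k' & Hk).
    apply (Hs_lower 0 (1 + 0 - s) k k' (root_node N)); try lra.
    + constructor.
    + intros u Hu. specialize (Hk u Hu). lra.
    + now replace (1 + 0 - (1 + 0 - s)) with s by ring.
Qed.

End LowerTree.

Theorem theorem2p6 :
  forall (q Delta : R), 0 < q < 1 -> 0 < Delta ->
  exists a0 : R, 0 < a0 /\
  forall (lam : nat -> C) (a b : nat -> R),
    (forall n : nat, (1 <= n)%nat -> lam n <> (0, 0)) ->
    (forall n : nat, (1 <= n)%nat -> 0 < a n < b n) ->
    (* (a) *)
    (exists N : nat, forall n : nat, (N <= n)%nat ->
        a (S n) <= Cmod (lam (S n)) * exp (q * a n) /\
        Cmod (lam (S n)) * exp (- (q * a n)) <= b (S n)) ->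
    (* (b) *)
    is_lim_seq (fun n => Rpower (prod1 a n) (/ INR n)) p_infty ->
    (* (c) *)
    (forall n : nat, (1 <= n)%nat -> Delta < Delta_n a b n) ->
    (* (d) *)
    Rbar_lt (Finite a0) (LimInf_seq a) ->
    let I := Iab lam a b in
    Rbar_le (Rbar_plus (Finite 1)
               (Rbar_glb (fun t => exists x, in_box a b x /\ t = LimInf_seq (phi_n a b x))))
            (dimH I) /\
    Rbar_le (dimH I)
            (Rbar_plus (Finite 1)
               (Rbar_lub (fun t => exists x, in_box a b x /\ t = LimInf_seq (phi_n a b x)))) /\
    Rbar_le (Rbar_plus (Finite 1)
               (Rbar_glb (fun t => exists x, in_box a b x /\ t = LimSup_seq (psi_n a b x))))
            (dimP I) /\
    Rbar_le (dimP I)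
            (Rbar_plus (Finite 1)
               (Rbar_lub (fun t => exists x, in_box a b x /\ t = LimSup_seq (psi_n a b x)))).
Proof.
  intros q Delta Hq HDelta. pose proof (side_bounds Delta HDelta) as [Hh1 Hh2].
  (* With $kap=side/8$ this is the condition $kap\,a_n\ge20$: every rectangle of children holds at
     least one row of boxes. *)
  exists (160 / side Delta). split; [apply Rdiv_lt_0_compat; lra|].
  intros lam a b Hlam Hab [N1 Hstrip] Hlim HD Hinf I0.
  destruct (LimInf_gt _ _ Hinf) as [N2 Hbig].
  assert (Hb : superlinear a) by (apply superlinear_of_lim; auto; intros; now apply Hab).
  assert (HD' : forall n, (1 <= n)%nat -> Delta <= Delta_n a b n) by (intros n Hn; left; auto).
  set (N := (N1 + N2 + 1)%nat).
  assert (HN : (1 <= N)%nat) by (unfold N; lia).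
  assert (Hstrip' : forall n, (N <= n)%nat ->
    a (S n) <= Cmod (lam (S n)) * exp (q * a n) /\
    Cmod (lam (S n)) * exp (- (q * a n)) <= b (S n)) by (intros n Hn; apply Hstrip; unfold N in Hn; lia).
  assert (Hbig' : forall n, (N <= n)%nat -> 160 / side Delta <= a n).
  { intros n Hn. left. apply Hbig. unfold N in Hn. lia. }
  split; [|split; [|split]].
  - now apply (lower_H lam a b q Delta N).
  - now apply (upper_H lam a b q Delta N).
  - now apply (lower_P lam a b q Delta N).
  - now apply (upper_P lam a b q Delta N).
Qed.
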